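(* Under the unstable-form hypothesis (U) stated in the context, the form $$\mathfrak q[u,v]=\int_{B_R}\mathfrak aD_uD_v\,dx-\int_{B_R}\mathfrak G(D_ua_v+a_uD_v)\,dx+\int_{B_R}\mathfrak Ga_ua_v\,dx-4\pi\langle(-\Delta)^{-1}D_u,D_v\rangle$$ on $\mathcal V=\{u\in Y:D_u\in L^2_{\mathfrak a}(B_R)\}$ is densely defined, closed, and lower semibounded on $Y=L^2_{\rho_0}(B_R;\mathbb R^3)$. It determines a unique self-adjoint operator $\widetilde L:D(\widetilde L)\subset Y\to Y$ with $$\mathfrak q[u,v]=(\widetilde Lu,v)_Y\qquad(u\in D(\widetilde L),\ v\in\mathcal V).$$
   Context: Newton operator: $((-\Delta)^{-1}h)(x)=\frac1{4\pi}\int_{\mathbb R^3}\frac{h(y)}{|x-y|}dy$ (functions on $B_R$ extended by zero), $V_h=-4\pi(-\Delta)^{-1}h$; $\langle h,k\rangle=\int hk\,dx$; $L^2_w(B_R)$ has norm squared $\int_{B_R}w|h|^2dx$. Hypothesis (P). $P\in C^3(\mathbb R\times(0,\infty))\cap C^1(\mathbb R\times[0,\infty))$, $P=P(S,\rho)$, $P(S,0)=0$, and $P_\rho>0$, $P_S>0$ for $\rho>0$. There are $\gamma_0\in(6/5,2)$, $\alpha_0>0$ such that for every compact interval $J\subset\mathbb R$ there is $K\in C^2(J)$ with $\inf_JK>0$ and $\partial_S^j\partial_\rho^k(P(S,\rho)-K(S)\rho^{\gamma_0})=O_J(\rho^{\gamma_0-k+\alpha_0})$ as $\rho\downarrow0$,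 uniformly in $S\in J$, for $j+k\le2$; and $|\partial_S^j\partial_\rho^kP(S,\rho)|\le C_J\rho^{\gamma_0-k}$ for $j+k=3$, $0<\rho\le1$, $S\in J$. Hypothesis (U). $P$ satisfies (P). $(\rho_0(r),S_0(r),0)$, $r=|x|$, is a compactly supported radial equilibrium: $\operatorname{supp}\rho_0=\overline{B_R}$, $B_R=\{x\in\mathbb R^3:|x|<R\}$, $\nabla P(S_0,\rho_0)+\rho_0\nabla V_{\rho_0}=0$ in $B_R$; $\rho_0\in C^2([0,R))\cap C^1([0,R])$, $\rho_0(0)>0$, $\rho_0'(0)=0$, $\rho_0'<0$ on $(0,R)$, $\rho_0(R)=0$; $S_0\in C^1([0,R])\cap C^2((0,R))$, $S_0'(0)=0$; $S_0=f(\rho_0)$ with $f\in C([0,\rho_0(0)])\cap C^2((0,\rho_0(0)))$. There are $r_1<R$ and $c,C>0$ with $c(R-r)^{1/(\gamma_0-1)}\le\rho_0(r)\le C(R-r)^{1/(\gamma_0-1)}$ and $c(R-r)^{(2-\gamma_0)/(\gamma_0-1)}\le-\rho_0'(r)\le C(R-r)^{(2-\gamma_0)/(\gamma_0-1)}$ for $r_1<r<R$. With $\mathfrak G(r)=-P_S(S_0,\rho_0)f'(\rho_0)/\rho_0$ and $\mathfrak a(r)=P_\rho(S_0,\rho_0)/\rho_0$: $P_\rho(S_0,\rho_0)>0$, $\mathfrak G<0$ on a nonempty open set $U\Subset B_R$, and $\big(|\mathfrak G|+\mathfrak G^2/\mathfrak a\big)|\nabla\rho_0|^2/\rho_0\in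 L^\infty(B_R)$. Notation: $D_u=\operatorname{div}(\rho_0u)$ in the sense of distributions on $B_R$, $a_u=\nabla\rho_0\cdot u$. *)

(* Defs.v *)
From mathcomp Require Import all_boot all_order all_algebra.
From mathcomp Require Import all_classical all_reals all_analysis.

Set Implicit Arguments.
Unset Strict Implicit.
Unset Printing Implicit Defensive.

Import Order.TTheory GRing.Theory Num.Theory.
Import numFieldNormedType.Exports.

Local Open Scope classical_set_scope.
Local Open Scope ring_scope.

(** * Functions of class C^k *)

Section Ck.
Context {R : realType} {E : normedModType R}.

(* [iter_derive [:: v1; ...; vn] g] is the iterated directional derivative
   D_v1 (... (D_vn g)). *)
Definition iter_derive (vs : seq E) (g : E -> R) : E -> R :=
  foldr (fun v (h : E -> R) => fun x => 'D_v h x) g vs.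

Definition Ck_open (k : nat) (O : set E) (g : E -> R) : Prop :=
  forall vs : seq E, (size vs <= k)%N ->
    (forall x, O x -> {for x, continuous (iter_derive vs g)}) /\
    ((size vs < k)%N -> forall v x, O x -> derivable (iter_derive vs g) x v).

(* C^k on a set A that need not be open (closed interval, closed half-plane):
   restriction to A of a C^k function on an open neighbourhood of A. *)
Definition Ck_on (k : nat) (A : set E) (g : E -> R) : Prop :=
  exists (O : set E) (h : E -> R),
    [/\ open O, A `<=` O, Ck_open k O h & {in A, g =1 h}].

End Ck.

Definition right_derivative {R : realType} (g : R -> R) (a l : R) : Prop :=
  h^-1 * (g (a + h) - g a) @[h --> 0^'+] --> l.

(** * The Euclidean space R^3 *)

Section R3.
Context {R : realType}.

Definition dot (x y : R * R * R) : R :=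
  x.1.1 * y.1.1 + x.1.2 * y.1.2 + x.2 * y.2.

(* The norm [`|x|] that the library puts on a product is the sup norm. *)
Definition enorm (x : R * R * R) : R := Num.sqrt (dot x x).

Definition eball (rad : R) : set (R * R * R) := [set x | enorm x < rad].

Definition leb3 : {measure set
    (measurableTypeR R * measurableTypeR R * measurableTypeR R)%type
      -> \bar R} :=
  ((@lebesgue_measure R \x @lebesgue_measure R) \x @lebesgue_measure R)%E.

Definition grad (g : R * R * R -> R) (x : R * R * R) : R * R * R :=
  ('D_((1, 0, 0) : R * R * R) g x,
   'D_((0, 1, 0) : R * R * R) g x,
   'D_((0, 0, 1) : R * R * R) g x).

Definition radial (g : R -> R) (x : R * R * R) : R := g (enorm x).

Definition Linfty (B : set (R * R * R)) (g : R * R * R -> R) : Prop :=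
  measurable_fun B g /\
  exists M : R, {ae leb3, forall x, B x -> `|g x| <= M}.

Definition L2w (B : set (R * R * R)) (w h : R * R * R -> R) : Prop :=
  measurable_fun B h /\
  (\int[leb3]_(x in B) (w x * h x ^+ 2)%:E < +oo)%E.

(* Functions carry arbitrary values outside B; here they are extended by 0. *)
Definition newton_kernel (B : set (R * R * R)) (h : R * R * R -> R)
    (x y : R * R * R) : R := (h \_ B) y / enorm (x - y).

Definition newton (B : set (R * R * R)) (h : R * R * R -> R)
    (x : R * R * R) : R :=
  (4 * pi)^-1 * \int[leb3]_y newton_kernel B h x y.

Definition potential (B : set (R * R * R)) (h : R * R * R -> R)
    (x : R * R * R) : R := - (4 * pi) * newton B h x.

Definition test_function (B : set (R * R * R)) (phi : R * R * R -> R) : Prop :=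
  [/\ forall k, Ck_open k setT phi,
      compact (closure [set x | phi x != 0]) &
      closure [set x | phi x != 0] `<=` B].

Definition div_distr (B : set (R * R * R)) (w : R * R * R -> R * R * R)
    (phi : R * R * R -> R) : R :=
  - \int[leb3]_(x in B) dot (w x) (grad phi x).

Definition distr_eq_fun (B : set (R * R * R)) (T : (R * R * R -> R) -> R)
    (h : R * R * R -> R) : Prop :=
  forall phi, test_function B phi ->
    T phi = \int[leb3]_(x in B) (h x * phi x).

End R3.

(** * Forms and operators in a real Hilbert space of classes of functions

   The Hilbert space is given by the space Y of representatives, with its
   (semi-definite) inner product [ip]; two representatives denote the same
   vector when their distance is 0. *)

Section Forms.
Context {R : realType} {E : lmodType R}.
Variables (Y : set E) (ip : E -> E -> R).

Definition hnorm (u : E) : R := Num.sqrt (ip u u).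

Definition heq (u v : E) : Prop := hnorm (u - v) = 0.

Definition hdense (V : set E) : Prop :=
  V `<=` Y /\
  forall u, Y u -> forall e : R, 0 < e -> exists2 v, V v & hnorm (u - v) < e.

Definition lin_subspace {F : lmodType R} (V : set F) : Prop :=
  V 0 /\ forall (c : R) u v, V u -> V v -> V (c *: u + v).

Definition symm_bilinear_form (V : set E) (q : E -> E -> R) : Prop :=
  [/\ lin_subspace V,
      forall u v, V u -> V v -> q u v = q v u &
      forall (c : R) u v w, V u -> V v -> V w ->
        q (c *: u + v) w = c * q u w + q v w].

Definition lower_semibounded (V : set E) (q : E -> E -> R) : Prop :=
  exists m : R, forall u, V u -> m * ip u u <= q u u.

Definition closed_form (V : set E) (q : E -> E -> R) : Prop :=
  forall (u_ : nat -> E) (u : E), (forall n, V (u_ n)) -> Y u ->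
    hnorm (u_ n - u) @[n --> \oo] --> (0 : R) ->
    (forall e : R, 0 < e -> exists N, forall n m, (N <= n)%N -> (N <= m)%N ->
       `|q (u_ n - u_ m) (u_ n - u_ m)| < e) ->
    V u /\ q (u_ n - u) (u_ n - u) @[n --> \oo] --> (0 : R).

(* Operators are given by their graphs, saturated for [heq]. *)
Definition op_dom (L : set (E * E)) : set E := [set z.1 | z in L].

Definition linear_operator (L : set (E * E)) : Prop :=
  [/\ L `<=` Y `*` Y,
      lin_subspace L,
      forall u u' w w', L (u, w) -> Y u' -> Y w' -> heq u u' -> heq w w' ->
        L (u', w') &
      forall u u' w w', L (u, w) -> L (u', w') -> heq u u' -> heq w w'].

Definition adjoint_graph (L : set (E * E)) : set (E * E) :=
  [set z | [/\ Y z.1, Y z.2 &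
               forall t, L t -> ip t.2 z.1 = ip t.1 z.2]].

Definition self_adjoint (L : set (E * E)) : Prop :=
  [/\ linear_operator L, hdense (op_dom L) & L = adjoint_graph L].

Definition represents_form (V : set E) (q : E -> E -> R) (L : set (E * E)) :
    Prop :=
  op_dom L `<=` V /\ forall u w v, L (u, w) -> V v -> q u v = ip w v.

End Forms.

(** * The pressure law *)

Section Pressure.
Context {R : realType}.
Implicit Types (P : R * R -> R).

Definition dS : R * R := (1, 0).
Definition drho : R * R := (0, 1).

Definition dSrho (j k : nat) P (S rho : R) : R :=
  iter_derive (nseq j dS ++ nseq k drho) P (S, rho).

(* The function K in C^2(J) is taken to be the restriction to J = [a, b] of a
   C^2 function on the line, so that the derivatives in S make sense at the end
   points as well. *)
Definition polytropic_near_vacuum P (gamma0 alpha0 a b : R) : Prop :=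
  exists K : R -> R,
    [/\ Ck_open 2 setT K,
        0 < inf [set K S | S in `[a, b]] &
        forall j k, (j + k <= 2)%N ->
          exists C : R, \forall rho \near 0^'+,
            forall S, S \in `[a, b] ->
            `|dSrho j k (fun z => P z - K z.1 * z.2 `^ gamma0) S rho|
               <= C * rho `^ (gamma0 - k%:R + alpha0)].

Record hypP P (gamma0 : R) : Prop := {
  hypP_C3 : Ck_on 3 [set z : R * R | 0 < z.2] P ;
  hypP_C1 : Ck_on 1 [set z : R * R | 0 <= z.2] P ;
  hypP_vacuum : forall S, P (S, 0) = 0 ;
  hypP_rho_gt0 : forall S rho : R, 0 < rho -> 0 < dSrho 0 1 P S rho ;
  hypP_S_gt0 : forall S rho : R, 0 < rho -> 0 < dSrho 1 0 P S rho ;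
  hypP_gamma0 : 6 / 5 < gamma0 < 2 ;
  hypP_asympt : exists2 alpha0 : R, 0 < alpha0 &
    forall a b, a < b -> polytropic_near_vacuum P gamma0 alpha0 a b ;
  hypP_third : forall a b, a < b -> exists C : R,
    forall j k, (j + k = 3)%N ->
    forall S rho : R, S \in `[a, b] -> 0 < rho <= 1 ->
      `|dSrho j k P S rho| <= C * rho `^ (gamma0 - k%:R)
}.

End Pressure.

(** * The equilibrium and its form *)

Section Equilibrium.
Context {R : realType}.
Variables (P : R * R -> R) (rad : R) (rho0 S0 f : R -> R).

Let B : set (R * R * R) := eball rad.

(* f'(rho0 0) need not exist, so [frakG 0] has no meaning.  This is harmless:
   [frakG] only enters through integrals and almost everywhere bounds, and in
   [hypU_unstable] the set U may always be replaced by U minus the origin. *)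
Definition frakG (r : R) : R :=
  - dSrho 1 0 P (S0 r) (rho0 r) * derive1 f (rho0 r) / rho0 r.

Definition fraka (r : R) : R := dSrho 0 1 P (S0 r) (rho0 r) / rho0 r.

Record hypU (gamma0 : R) : Prop := {
  hypU_P : hypP P gamma0 ;
  hypU_rad : 0 < rad ;
  hypU_supp : closure [set x : R * R * R | radial rho0 x != 0] = closure B ;
  hypU_equilibrium : forall x, B x ->
    grad (fun y => P (S0 (enorm y), rho0 (enorm y))) x
      + radial rho0 x *: grad (potential B (radial rho0)) x = 0 ;
  hypU_rho_C2 : Ck_on 2 `[0, rad[ rho0 ;
  hypU_rho_C1 : Ck_on 1 `[0, rad] rho0 ;
  hypU_rho_center : 0 < rho0 0 ;
  hypU_drho_center : right_derivative rho0 0 0 ;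
  hypU_drho_lt0 : forall r : R, 0 < r < rad -> derive1 rho0 r < 0 ;
  hypU_rho_boundary : rho0 rad = 0 ;
  hypU_S_C1 : Ck_on 1 `[0, rad] S0 ;
  hypU_S_C2 : Ck_on 2 `]0, rad[ S0 ;
  hypU_dS_center : right_derivative S0 0 0 ;
  hypU_S_f : forall r : R, 0 <= r <= rad -> S0 r = f (rho0 r) ;
  hypU_f_C0 : {within `[0, rho0 0], continuous f} ;
  hypU_f_C2 : Ck_on 2 `]0, rho0 0[ f ;
  hypU_vacuum : exists r1 c C : R,
    [/\ 0 <= r1 < rad, 0 < c, 0 < C &
        forall r : R, r1 < r < rad ->
          c * (rad - r) `^ (gamma0 - 1)^-1 <= rho0 r
            <= C * (rad - r) `^ (gamma0 - 1)^-1 /\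
          c * (rad - r) `^ ((2 - gamma0) / (gamma0 - 1)) <= - derive1 rho0 r
            <= C * (rad - r) `^ ((2 - gamma0) / (gamma0 - 1))] ;
  hypU_Prho : forall r : R, 0 <= r < rad -> 0 < dSrho 0 1 P (S0 r) (rho0 r) ;
  hypU_unstable : exists U : set (R * R * R),
    [/\ open U, U !=set0, compact (closure U), closure U `<=` B &
        forall x, U x -> radial frakG x < 0] ;
  hypU_Linfty : Linfty B (fun x =>
    (`|radial frakG x| + radial frakG x ^+ 2 / radial fraka x)
      * dot (grad (radial rho0) x) (grad (radial rho0) x) / radial rho0 x)
}.

Definition Yspace : set (R * R * R -> R * R * R) :=
  [set u | measurable_fun B u /\
     (\int[leb3]_(x in B) (radial rho0 x * dot (u x) (u x))%:E < +oo)%E].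

(* As rho0 > 0 in B, two elements of [Yspace] are at distance 0 if and only if
   they are equal almost everywhere in B. *)
Definition Yip (u v : R * R * R -> R * R * R) : R :=
  \int[leb3]_(x in B) (radial rho0 x * dot (u x) (v x)).

(* D_u, as a distribution on B *)
Definition Ddistr (u : R * R * R -> R * R * R) : (R * R * R -> R) -> R :=
  div_distr B (fun x => radial rho0 x *: u x).

Definition D_L2a (u : R * R * R -> R * R * R) : set (R * R * R -> R) :=
  [set h | L2w B (radial fraka) h /\ distr_eq_fun B (Ddistr u) h].

Definition Vspace : set (R * R * R -> R * R * R) :=
  Yspace `&` [set u | D_L2a u !=set0].

(* D_u, as a function in L^2_a, for u in [Vspace]: a representative, unique up
   to a null set of B *)
Definition Dfun (u : R * R * R -> R * R * R) : R * R * R -> R :=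
  get (D_L2a u).

Definition afun (u : R * R * R -> R * R * R) (x : R * R * R) : R :=
  dot (grad (radial rho0) x) (u x).

Definition frakq (u v : R * R * R -> R * R * R) : R :=
  \int[leb3]_(x in B) (radial fraka x * Dfun u x * Dfun v x)
  - \int[leb3]_(x in B)
      (radial frakG x * (Dfun u x * afun v x + afun u x * Dfun v x))
  + \int[leb3]_(x in B) (radial frakG x * afun u x * afun v x)
  - 4 * pi * \int[leb3]_(x in B) (newton B (Dfun u) x * Dfun v x).

(* Every integral occurring in [frakq] converges absolutely (a divergent
   [Rintegral] would have a conventional value). *)
Definition frakq_well_defined : Prop :=
  forall u v, Vspace u -> Vspace v ->
  [/\ leb3.-integrable B
        (fun x => (radial fraka x * Dfun u x * Dfun v x)%:E),
      leb3.-integrable B (fun x =>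
        (radial frakG x * (Dfun u x * afun v x + afun u x * Dfun v x))%:E),
      leb3.-integrable B
        (fun x => (radial frakG x * afun u x * afun v x)%:E),
      forall x, leb3.-integrable setT
        (fun y => (newton_kernel B (Dfun u) x y)%:E) &
      leb3.-integrable B (fun x => (newton B (Dfun u) x * Dfun v x)%:E)].

End Equilibrium.

(* Main.v *)
From HB Require Import structures.
Require Import Defs.
From mathcomp Require Import all_boot all_order all_algebra.
From mathcomp Require Import all_classical all_reals all_analysis.
From mathcomp Require Import measurable_realfun.
From mathcomp Require Import ring lra.

Set Implicit Arguments.
Unset Strict Implicit.
Unset Printing Implicit Defensive.

Import Order.TTheory GRing.Theory Num.Theory.
Import numFieldNormedType.Exports.

Local Open Scope classical_set_scope.
Local Open Scope ring_scope.


(** Write [A = L^2_a(B_R)].  The leading term of the form is [||D_u||_A^2]; closedness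
    and semiboundedness hold because each of the other terms is bounded by a part
    of it plus a multiple of [||u||_Y^2].

    The mixed terms.  The bound on [(|G| + G^2/a) |grad rho0|^2 / rho0] turns
    [a_u^2 <= |grad rho0|^2 |u|^2] into [|G| a_u^2 <= M rho0 |u|^2] and
    [G^2/a a_u^2 <= M rho0 |u|^2]; Young's inequality then absorbs the terms in
    [G] into half of the leading one ([pair_form_local_part]).

    The Newton energy is not bounded by a small multiple of the leading term, but
    it is compact relative to it.  Since [P_rho >= c rho^(gamma0 - 1)] near the
    vacuum and [gamma0 < 2], the weight [a] is bounded below ([fraka_lower_bound]),
    so [A] embeds in [L^2(B_R)].  There the kernel [1/|x - y|] is square-integrable
    in [y], uniformly in [x], so the energies of a weakly null sequence tend to 0
    ([newton_energy_cvg0]).  As [u] small in Y forces [D_u] to be small as a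
    distribution, an argument by contradiction gives
    [energy D_u <= e ||D_u||_A^2 + C_e ||u||_Y^2] for every [e > 0] ([energy_small]).

    Hence, for [C] large, [q + C ||.||_Y^2] is equivalent to the squared graph norm of the weak divergence
    ([pair_form_bounds]), which is a closed operator from Y to [A]
    ([D_L2a_closed]); completeness of weighted L^2 spaces ([wip_complete]) gives
    closedness of the form.  The domain is dense because it contains the fields
    [phi / rho0] with smooth compactly supported components, whose divergence is
    computed by integration by parts ([bump_by_parts]), and because a function
    orthogonal to all bumps vanishes ([bump_vanish_ae]).

    The operator is that of the first representation theorem
    ([form_representation]), proved here for semi-definite inner products on
    spaces of representatives: the Riesz theorem solves [(L + k) t = w], which
    makes the symmetric graph of the form self-adjoint. *)

(** * Semi-inner product spaces of representatives *)

Lemma normr_lt_sqr (R : realDomainType) (x e : R) :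
  0 < e -> (`|x| < e) = (x ^+ 2 < e ^+ 2).
Proof.
move=> e0; rewrite -(real_normK (num_real x)).
by rewrite ltr_pXn2r // nnegrE ?normr_ge0 // ltW.
Qed.

Section SemiInner.
Context {R : realType} {E : lmodType R}.
Implicit Types (W : set E) (b : E -> E -> R).

Definition ip_cauchy b (u_ : nat -> E) : Prop :=
  forall e : R, 0 < e -> exists N, forall n m, (N <= n)%N -> (N <= m)%N ->
    b (u_ n - u_ m) (u_ n - u_ m) < e.

Definition ip_cvg b (u_ : nat -> E) (u : E) : Prop :=
  forall e : R, 0 < e -> exists N, forall n, (N <= n)%N ->
    b (u_ n - u) (u_ n - u) < e.

Definition ip_complete W b : Prop :=
  forall u_, (forall n, W (u_ n)) -> ip_cauchy b u_ ->
    exists2 u, W u & ip_cvg b u_ u.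

Section Basic.
Variables (W : set E) (b : E -> E -> R).
Hypothesis Wb : symm_bilinear_form W b.

Lemma subspace0 : W 0. Proof. by case: Wb => -[]. Qed.

Lemma subspaceDZ c u v : W u -> W v -> W (c *: u + v).
Proof. by case: Wb => -[_ +] _ _ => /(_ c u v). Qed.

Lemma subspaceD u v : W u -> W v -> W (u + v).
Proof. by move=> Wu Wv; have := subspaceDZ 1 Wu Wv; rewrite scale1r. Qed.

Lemma subspaceZ c u : W u -> W (c *: u).
Proof. by move=> Wu; have := subspaceDZ c Wu subspace0; rewrite addr0. Qed.

Lemma subspaceB u v : W u -> W v -> W (u - v).
Proof.
by move=> Wu Wv; have := subspaceDZ (-1) Wv Wu; rewrite scaleN1r addrC.
Qed.

Lemma formC u v : W u -> W v -> b u v = b v u.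
Proof. by case: Wb => _ + _ => /(_ u v). Qed.

Lemma formDZ c u v w : W u -> W v -> W w -> b (c *: u + v) w = c * b u w + b v w.
Proof. by case: Wb => _ _ /(_ c u v w). Qed.

Lemma formD u v w : W u -> W v -> W w -> b (u + v) w = b u w + b v w.
Proof. by move=> *; rewrite -[u]scale1r formDZ // scale1r mul1r. Qed.

Lemma form0 w : W w -> b 0 w = 0.
Proof.
move=> Ww; have := formD subspace0 subspace0 Ww.
by rewrite addr0 => /eqP; rewrite -subr_eq subrr eq_sym => /eqP.
Qed.

Lemma formZ c u w : W u -> W w -> b (c *: u) w = c * b u w.
Proof.
move=> Wu Ww; rewrite -[c *: u]addr0 formDZ //; last exact: subspace0.
by rewrite form0 // addr0.
Qed.

Lemma formB u v w : W u -> W v -> W w -> b (u - v) w = b u w - b v w.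
Proof.
by move=> *; rewrite addrC -scaleN1r formDZ // mulN1r addrC.
Qed.

Lemma formDr u v w : W u -> W v -> W w -> b w (u + v) = b w u + b w v.
Proof.
by move=> Wu Wv Ww; rewrite formC ?formD 1?formC 1?(formC Wv) //; exact: subspaceD.
Qed.

Lemma formZr c u w : W u -> W w -> b w (c *: u) = c * b w u.
Proof.
by move=> Wu Ww; rewrite formC ?formZ 1?formC //; exact: subspaceZ.
Qed.

Lemma formBr u v w : W u -> W v -> W w -> b w (u - v) = b w u - b w v.
Proof.
by move=> Wu Wv Ww; rewrite formC ?formB 1?formC 1?(formC Wv) //; exact: subspaceB.
Qed.

Lemma form_sqrDZ t u v : W u -> W v ->
  b (u + t *: v) (u + t *: v) = b u u + 2 * t * b u v + t ^+ 2 * b v v.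
Proof.
move=> Wu Wv; have Wtv := subspaceZ t Wv; have Wuv := subspaceD Wu Wtv.
rewrite formD // !formDr // !formZ // !formZr // (formC Wv Wu); ring.
Qed.

Lemma form_sqrB u v : W u -> W v ->
  b (u - v) (u - v) = b u u - 2 * b u v + b v v.
Proof.
by move=> Wu Wv; rewrite -[- v]scaleN1r form_sqrDZ //; ring.
Qed.

Hypothesis b0 : forall u, W u -> 0 <= b u u.

Lemma form_CS u v : W u -> W v -> b u v ^+ 2 <= b u u * b v v.
Proof.
move=> Wu Wv.
have H t : 0 <= b u u + 2 * t * b u v + t ^+ 2 * b v v.
  by rewrite -form_sqrDZ //; apply/b0/subspaceD => //; exact: subspaceZ.
have := b0 Wv; rewrite le_eqVlt => /predU1P[v0|v0].
  rewrite -v0 mulr0.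
  have [->|/eqP uv0] := pselect (b u v = 0); first by rewrite expr0n.
  have := H (- (b u u + 1) / (2 * b u v)); rewrite -v0 mulr0 addr0.
  by rewrite (_ : 2 * _ * _ = - (b u u + 1)); [lra|field].
have := H (- b u v / b v v).
rewrite (_ : _ + _ = (b u u * b v v - b u v ^+ 2) / b v v); last by field; lra.
by rewrite pmulr_lge0 ?invr_gt0 // subr_ge0.
Qed.

Lemma form_null u v : W u -> W v -> b u u = 0 -> b u v = 0.
Proof.
move=> Wu Wv u0; have := form_CS Wu Wv; rewrite u0 mul0r => uv.
by apply/eqP; rewrite -sqrf_eq0 eq_le uv sqr_ge0.
Qed.

Lemma form_triangle u v w : W u -> W v -> W w ->
  b (u - w) (u - w) <= 2 * b (u - v) (u - v) + 2 * b (v - w) (v - w).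
Proof.
move=> Wu Wv Ww.
set x := u - v; set y := v - w; have Wx : W x by exact: subspaceB.
have Wy : W y by exact: subspaceB.
have -> : u - w = x + 1 *: y by rewrite scale1r /x /y addrA subrK.
rewrite form_sqrDZ // mulr1 expr1n mul1r.
have := b0 (subspaceB Wx Wy); rewrite form_sqrB //; lra.
Qed.

Lemma ip_cvg_form u_ u v : (forall n, W (u_ n)) -> W u -> W v ->
  ip_cvg b u_ u -> forall e : R, 0 < e -> exists N, forall n, (N <= n)%N ->
    `|b (u_ n) v - b u v| < e.
Proof.
move=> Wn Wu Wv uu e e0.
have d0 : 0 < e ^+ 2 / (b v v + 1).
  by rewrite divr_gt0 ?exprn_gt0 // ltr_wpDl // b0.
have [N HN] := uu _ d0; exists N => n Nn.
rewrite -formB // normr_lt_sqr //.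
have Wnu := subspaceB (Wn n) Wu.
apply: le_lt_trans (form_CS Wnu Wv) _.
have bv := b0 Wv.
have := HN n Nn; rewrite ltr_pdivlMr ?ltr_wpDl //; apply: le_lt_trans.
by rewrite ler_wpM2l ?b0 // lerDl.
Qed.

Lemma ip_cvg_cauchy u_ u : (forall n, W (u_ n)) -> W u ->
  ip_cvg b u_ u -> ip_cauchy b u_.
Proof.
move=> Wn Wu uu e e0; have e4 : 0 < e / 4 by lra.
have [N HN] := uu _ e4; exists N => n m Nn Nm.
have := HN _ Nn; have := HN _ Nm.
have := form_triangle (Wn n) Wu (Wn m).
have -> : u - u_ m = (-1) *: (u_ m - u) by rewrite scaleN1r opprB.
have Wm := subspaceB (Wn m) Wu.
rewrite formZ ?formZr //; last exact: subspaceZ.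
lra.
Qed.

(** Minimising [b v v - 2 * l v] gives a sequence that is Cauchy by the
    parallelogram law and represents [l] in the limit; the limit itself may
    live in a larger space, which is how this yields projections as well as
    the Riesz representation. *)
Lemma riesz_sequence (l : E -> R) (C : R) :
  (forall c u v, W u -> W v -> l (c *: u + v) = c * l u + l v) ->
  (forall u, W u -> l u ^+ 2 <= C * b u u) ->
  exists w_ : nat -> E, [/\ forall n, W (w_ n), ip_cauchy b w_ &
    forall v, W v -> forall e : R, 0 < e -> exists N, forall n, (N <= n)%N ->
      `|b (w_ n) v - l v| < e].
Proof.
move=> llin lC.
have l0 : l 0 = 0.
  have := llin 1 0 0 subspace0 subspace0; rewrite scaler0 addr0 mul1r.
  by move/eqP; rewrite -subr_eq subrr eq_sym => /eqP.
have lZ c u : W u -> l (c *: u) = c * l u.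
  by move=> Wu; have := llin c u 0 Wu subspace0; rewrite !addr0 l0 addr0.
have lD u v : W u -> W v -> l (u + v) = l u + l v.
  by move=> Wu Wv; have := llin 1 u v Wu Wv; rewrite scale1r mul1r.
pose J v := b v v - 2 * l v.
have Jlb v : W v -> - `|C| <= J v.
  move=> Wv; rewrite /J; have := lC v Wv; have bv := b0 Wv.
  have CC : C * b v v <= `|C| * b v v by rewrite ler_wpM2r // ler_norm.
  move=> lv; have {}lv := le_trans lv CC; have C0 := normr_ge0 C.
  move: (b v v) (l v) `|C| bv lv C0 => x y c x0 yc c0.
  have : `|2 * y| <= x + c.
    rewrite -(@ler_pXn2r _ 2) ?nnegrE ?addr_ge0 // real_normK ?num_real //.
    by have := sqr_ge0 (x - c); nra.
  by have := ler_norm (2 * y); lra.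
pose S := [set J v | v in W].
have S0 : S !=set0 by exists (J 0); exists 0 => //; exact: subspace0.
have Slb : has_lbound S by exists (- `|C|) => _ [v Wv <-]; exact: Jlb.
pose d := inf S.
have dJ v : W v -> d <= J v by move=> Wv; apply: ge_inf => //; exists v.
have ex n : exists v, W v /\ J v < d + n.+1%:R^-1.
  have : 0 < n.+1%:R^-1 :> R by rewrite invr_gt0.
  by move=> n0; have [_ [v Wv <-] ?] := inf_adherent n0 (conj S0 Slb); exists v.
pose w_ n := projT1 (cid (ex n)).
have Ww n : W (w_ n) by case: (projT2 (cid (ex n))).
have Jw n : J (w_ n) < d + n.+1%:R^-1 by case: (projT2 (cid (ex n))).
have small (e : R) : 0 < e -> exists N, forall n, (N <= n)%N -> n.+1%:R^-1 < e.
  move=> e0; exists (Num.truncn e^-1) => n Nn.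
  rewrite invf_plt ?posrE //; apply: lt_le_trans (truncnS_gt _) _.
  by rewrite ler_nat.
exists w_; split => //.
  move=> e e0; have e4 : 0 < e / 4 by lra.
  have [N HN] := small _ e4; exists N => n m Nn Nm.
  have Wnm := subspaceD (Ww n) (Ww m).
  have := dJ _ (subspaceZ 2^-1 Wnm); rewrite /J formZ ?formZr //; last exact: subspaceZ.
  rewrite lZ // lD // -[in b _ _](scale1r (w_ m)) form_sqrDZ // form_sqrB //.
  have := Jw n; have := Jw m; rewrite /J; have := HN _ Nn; have := HN _ Nm.
  by move: n.+1%:R^-1 m.+1%:R^-1 => x y; lra.
move=> v Wv e e0.
have bv := b0 Wv.
have d0 : 0 < e ^+ 2 / (b v v + 1) by rewrite divr_gt0 ?exprn_gt0 // ltr_wpDl.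
have [N HN] := small _ d0; exists N => n Nn.
rewrite normr_lt_sqr //.
have := HN _ Nn; rewrite ltr_pdivlMr ?ltr_wpDl //; apply: le_lt_trans.
set D := b (w_ n) v - l v; pose t := - D / (b v v + 1).
have := dJ _ (subspaceD (Ww n) (subspaceZ t Wv)); have := Jw n; rewrite /J.
rewrite form_sqrDZ // lD ?lZ //; last exact: subspaceZ.
move=> h1 h2.
have : 0 <= n.+1%:R^-1 + 2 * t * D + t ^+ 2 * (b v v + 1).
  by move: n.+1%:R^-1 (sqr_ge0 t) h1 h2 => x; rewrite /D; move: t => t; lra.
rewrite (_ : _ + _ = n.+1%:R^-1 - D ^+ 2 / (b v v + 1)); last first.
  rewrite /t; move: n.+1%:R^-1 => x.
  field; lra.
by rewrite subr_ge0 ler_pdivrMr // ltr_wpDl.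
Qed.

Lemma riesz (l : E -> R) (C : R) : ip_complete W b ->
  (forall c u v, W u -> W v -> l (c *: u + v) = c * l u + l v) ->
  (forall u, W u -> l u ^+ 2 <= C * b u u) ->
  exists2 w, W w & forall v, W v -> b w v = l v.
Proof.
move=> Wc llin lC; have [w_ [Ww wC wl]] := riesz_sequence llin lC.
have [w Ww' ww] := Wc _ Ww wC; exists w => // v Wv.
apply/eqP; rewrite -subr_eq0 -normr_le0; apply/ler_addgt0Pl => e e0; rewrite addr0.
have e2 : 0 < e / 2 by lra.
have [N1 H1] := wl v Wv _ e2.
have [N2 H2] := ip_cvg_form Ww Ww' Wv ww e2.
have := H1 _ (leq_maxl N1 N2); have := H2 _ (leq_maxr N1 N2).
rewrite distrC; set x := b (w_ _) v => h2 h1.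
rewrite -[b w v](subrK x) -addrA (le_trans (ler_normD _ _)) //; lra.
Qed.

End Basic.

Lemma hnorm_cvg W b u_ u : symm_bilinear_form W b ->
  (forall v, W v -> 0 <= b v v) -> (forall n, W (u_ n)) -> W u ->
  (hnorm b (u_ n - u) @[n --> \oo] --> (0 : R)) <-> ip_cvg b u_ u.
Proof.
move=> Wb b0 Wn Wu.
have pos n : 0 <= b (u_ n - u) (u_ n - u) by exact/b0/(subspaceB Wb).
split.
  move/cvgrPdist_lt => h e e0; have s0 : 0 < Num.sqrt e by rewrite sqrtr_gt0.
  have [N _ HN] := h _ s0; exists N => n Nn.
  have := HN n Nn; rewrite sub0r normrN /hnorm ger0_norm ?sqrtr_ge0 //.
  by rewrite ltr_sqrt.
move=> h; apply/cvgrPdist_lt => e e0.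
have [N HN] := h _ (exprn_gt0 2 e0); exists N => // n Nn.
rewrite sub0r normrN /hnorm ger0_norm ?sqrtr_ge0 //.
rewrite -[ltRHS](gtr0_norm e0) -sqrtr_sqr ltr_sqrt ?exprn_gt0 //.
exact: HN.
Qed.

End SemiInner.

(** * Self-adjoint operators from closed forms *)

Section FormOperator.
Context {R : realType} {E : lmodType R}.
Variables (Y : set E) (ip : E -> E -> R).
Hypothesis Yip : symm_bilinear_form Y ip.
Hypothesis ip0 : forall u, Y u -> 0 <= ip u u.
Hypothesis Yc : ip_complete Y ip.

Lemma hnorm_eq0 u : Y u -> hnorm ip u = 0 <-> ip u u = 0.
Proof.
move=> Yu; rewrite /hnorm; split=> [/eqP|->]; last by rewrite sqrtr0.
by rewrite sqrtr_eq0 => h; apply/eqP; rewrite eq_le h ip0.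
Qed.

(** The gap between a vector and the limit of its projecting sequence is
    orthogonal to [W], hence null. *)
Lemma dense_of_orthogonal (W : set E) : W `<=` Y -> lin_subspace W ->
  (forall y, Y y -> (forall w, W w -> ip y w = 0) -> ip y y = 0) ->
  hdense Y ip W.
Proof.
move=> WY Wlin Worth; split=> // u Yu e e0.
have Wip : symm_bilinear_form W ip.
  split=> // [v w /WY Yv /WY Yw|c v w z /WY Yv /WY Yw /WY Yz].
    exact: (formC Yip).
  exact: (formDZ Yip).
have ipW v : W v -> 0 <= ip v v by move=> /WY /ip0.
have [||w_ [Ww wC wl]] := @riesz_sequence _ _ _ _ Wip ipW (ip u) (ip u u).
- move=> c v w /WY Yv /WY Yw; rewrite (formDr Yip) ?(formZr Yip) //.
  exact: (subspaceZ Yip).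
- by move=> v /WY Yv; exact: (form_CS Yip).
have Yw n : Y (w_ n) by exact: WY.
have [w Yw' ww] := Yc Yw wC.
have Yuw := subspaceB Yip Yu Yw'.
have uw0 : ip (u - w) (u - w) = 0.
  apply: Worth => // v Wv; have Yv := WY _ Wv.
  apply/eqP; rewrite -normr_le0; apply/ler_addgt0Pl => d d0; rewrite addr0.
  have d2 : 0 < d / 2 by lra.
  have [N1 H1] := wl v Wv _ d2.
  have [N2 H2] := ip_cvg_form Yip ip0 Yw Yw' Yv ww d2.
  have := H1 _ (leq_maxl N1 N2); have := H2 _ (leq_maxr N1 N2).
  rewrite distrC (formB Yip) //; set x := ip (w_ _) v => h2 h1.
  have -> : ip u v - ip w v = - (x - ip u v) + (x - ip w v) by ring.
  by rewrite (le_trans (ler_normD _ _)) // normrN (distrC x (ip w v)); lra.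
have [N HN] := ww (e ^+ 2 / 2) (divr_gt0 (exprn_gt0 2 e0) (ltr0Sn _ 1)).
exists (w_ N) => //; rewrite /hnorm.
rewrite -[ltRHS](gtr0_norm e0) -sqrtr_sqr ltr_sqrt ?exprn_gt0 //.
apply: le_lt_trans (form_triangle Yip ip0 Yu Yw' (Yw N)) _.
rewrite uw0 mulr0 add0r.
have -> : w - w_ N = (-1) *: (w_ N - w) by rewrite scaleN1r opprB.
have YNw := subspaceB Yip (Yw N) Yw'.
rewrite (formZ Yip) ?(formZr Yip) //; last exact: (subspaceZ Yip).
have := HN _ (leqnn N); lra.
Qed.

(** A vector of positive norm lies at less than its own norm from some [w]; but an
    orthogonal [w] is at least that far away. *)
Lemma dense_orthogonal_null (W : set E) y : hdense Y ip W -> Y y ->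
  (forall w, W w -> ip y w = 0) -> ip y y = 0.
Proof.
move=> [WY Wd] Yy y0.
have [//|/eqP yy0] := pselect (ip y y = 0).
have yy : 0 < ip y y by rewrite lt_neqAle eq_sym yy0 ip0.
have sy : 0 < Num.sqrt (ip y y) by rewrite sqrtr_gt0.
have [w Ww] := Wd y Yy _ sy; have Yw := WY _ Ww.
rewrite /hnorm ltr_sqrt // (form_sqrB Yip) // (y0 w) // mulr0 subr0.
by have := ip0 Yw; lra.
Qed.

Variables (V : set E) (q : E -> E -> R).
Hypothesis Vq : symm_bilinear_form V q.
Hypothesis Vd : hdense Y ip V.
Hypothesis Vcl : closed_form Y ip V q.
Hypothesis Vlb : lower_semibounded ip V q.

Let VY : V `<=` Y. Proof. by case: Vd. Qed.

Definition form_graph : set (E * E) :=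
  [set z | [/\ V z.1, Y z.2 & forall v, V v -> q z.1 v = ip z.2 v]].

Definition shifted_form (k : R) (u v : E) : R := q u v + k * ip u v.

Lemma shifted_formP k : symm_bilinear_form V (shifted_form k).
Proof.
split; first by case: Vq.
  move=> u v Vu Vv; rewrite /shifted_form (formC Vq) // (formC Yip) //; exact: VY.
move=> c u v w Vu Vv Vw.
rewrite /shifted_form (formDZ Vq) // (formDZ Yip); try exact: VY.
ring.
Qed.

Lemma shifted_form_ge : exists k, forall u, V u -> ip u u <= shifted_form k u u.
Proof.
have [m Hm] := Vlb; exists (1 - m) => u Vu; rewrite /shifted_form.
have := Hm u Vu; lra.
Qed.

(** A Cauchy sequence for the shifted form is Cauchy for [ip] and hence for [q],
    so that it converges in Y and closedness applies. *)
Lemma shifted_form_complete k : (forall u, V u -> ip u u <= shifted_form k u u) ->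
  ip_complete V (shifted_form k).
Proof.
move=> kge u_ Vu uC.
have Yu n : Y (u_ n) by exact: VY.
have small e : 0 < e -> exists N, forall n m, (N <= n)%N -> (N <= m)%N ->
    ip (u_ n - u_ m) (u_ n - u_ m) < e.
  move=> e0; have [N HN] := uC _ e0; exists N => n m Nn Nm.
  exact: le_lt_trans (kge _ (subspaceB Vq (Vu n) (Vu m))) (HN _ _ Nn Nm).
have [u Yu' uu] := Yc Yu small.
have [|Vu' qu] := Vcl Vu Yu' ((hnorm_cvg Yip ip0 Yu Yu').2 uu).
  move=> e e0; have e2 : 0 < e / 2 by lra.
  have ek : 0 < e / 2 / (`|k| + 1) by rewrite divr_gt0 // ltr_wpDl.
  have [N1 H1] := uC _ e2; have [N2 H2] := small _ ek.
  exists (maxn N1 N2) => n m; rewrite !geq_max => /andP[n1 n2] /andP[m1 m2].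
  have := H1 _ _ n1 m1; have := H2 _ _ n2 m2.
  have := kge _ (subspaceB Vq (Vu n) (Vu m)).
  have := ip0 (subspaceB Yip (Yu n) (Yu m)).
  rewrite /shifted_form; move: (q _ _) (ip _ _) => x y y0 yx.
  rewrite ltr_pdivlMr ?ltr_wpDl // => ye xe.
  have ky : `|k * y| <= `|k| * y by rewrite normrM (ger0_norm y0).
  have -> : x = (x + k * y) - k * y by ring.
  rewrite (le_lt_trans (ler_normB _ _)) // (ger0_norm (le_trans y0 yx)).
  lra.
exists u => // e e0.
have e2 : 0 < e / 2 by lra.
have ek : 0 < e / 2 / (`|k| + 1) by rewrite divr_gt0 // ltr_wpDl.
have [N2 H2] := uu _ ek.
have [N1 _ H1] := (cvgrPdist_lt _ _).1 qu _ e2.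
exists (maxn N1 N2) => n; rewrite !geq_max => /andP[n1 n2].
have := H1 n n1; have := H2 n n2.
have := ip0 (subspaceB Yip (Yu n) Yu').
rewrite /shifted_form sub0r normrN; move: (q _ _) (ip _ _) => x y y0.
rewrite ltr_pdivlMr ?ltr_wpDl // => ye xe.
have ky : k * y <= `|k| * y by rewrite ler_wpM2r // ler_norm.
have := ler_norm x; lra.
Qed.

(** Riesz representation for the shifted form, which is a complete inner
    product on [V]: the operator [L + k] is onto [Y]. *)
Lemma form_graph_surj : exists k, (forall u, V u -> ip u u <= shifted_form k u u) /\
  forall w, Y w -> exists2 t, V t & forall v, V v -> shifted_form k t v = ip w v.
Proof.
have [k kge] := shifted_form_ge; exists k; split=> // w Yw.
have bP := shifted_formP k.
have b0 u : V u -> 0 <= shifted_form k u u.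
  by move=> Vu; apply: le_trans (kge _ Vu); exact/ip0/VY.
have [c v v' /VY Yv /VY Yv'|v Vv|t Vt tP] :=
  riesz bP b0 (l := ip w) (C := ip w w) (shifted_form_complete kge).
- by rewrite (formDr Yip) ?(formZr Yip) //; exact: (subspaceZ Yip).
- apply: le_trans (form_CS Yip ip0 Yw (VY Vv)) _.
  by rewrite ler_wpM2l ?ip0 // kge.
- by exists t.
Qed.

(** Closedness, applied to a constant sequence, shows that membership in [V] and
    the values of [q] depend only on the vectors, not on their representatives. *)
Lemma form_domain_heq u u' : V u -> Y u' -> heq ip u u' ->
  V u' /\ forall v, V v -> q u v = q u' v.
Proof.
move=> Vu Yu' uu'; have Yu := VY Vu; have Yuu := subspaceB Yip Yu Yu'.
have uu0 : ip (u - u') (u - u') = 0 by apply/hnorm_eq0.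
have [| |Vu' qu] := Vcl (fun=> Vu) Yu'.
- apply/(hnorm_cvg Yip ip0 (fun=> Yu) Yu') => e e0; exists 0%N => n _.
  by rewrite uu0.
- by move=> e e0; exists 0%N => n m _ _; rewrite subrr (form0 Vq) ?normr0 //; exact: (subspace0 Vq).
split=> // v Vv; have Vuu := subspaceB Vq Vu Vu'.
have q0 : q (u - u') (u - u') = 0.
  by have /cvg_lim := qu; rewrite lim_cst //; apply; exact: Rhausdorff.
have [k [kge _]] := form_graph_surj.
have b0 w : V w -> 0 <= shifted_form k w w.
  by move=> Vw; apply: le_trans (kge _ Vw); exact/ip0/VY.
have := form_null (shifted_formP k) b0 Vuu Vv.
rewrite /shifted_form q0 uu0 mulr0 addr0 => /(_ erefl).
rewrite (form_null Yip ip0 Yuu (VY Vv) uu0) mulr0 addr0 (formB Vq) //.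
by move/eqP; rewrite subr_eq0 => /eqP.
Qed.

Lemma form_graph_linear : linear_operator Y ip form_graph.
Proof.
split.
- by move=> [u w] [/= Vu Yw _]; split=> //; exact: VY.
- split.
    split=> /=; [exact: (subspace0 Vq)|exact: (subspace0 Yip)|].
    by move=> v Vv; rewrite (form0 Vq) // (form0 Yip) //; exact: VY.
  move=> c [u w] [u' w'] [/= Vu Yw Lu] [/= Vu' Yw' Lu'].
  split=> /=; [exact: (subspaceDZ Vq)|exact: (subspaceDZ Yip)|].
  move=> v Vv; rewrite (formDZ Vq) // (formDZ Yip) //; last exact: VY.
  by rewrite Lu // Lu'.
- move=> u u' w w' [/= Vu Yw Lu] Yu' Yw' uu' ww'.
  have [Vu' qu] := form_domain_heq Vu Yu' uu'.
  split=> //= v Vv; rewrite -qu // Lu //.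
  have Yww := subspaceB Yip Yw Yw'.
  have ww0 : ip (w - w') (w - w') = 0 by apply/hnorm_eq0.
  have := form_null Yip ip0 Yww (VY Vv) ww0; rewrite (formB Yip) //; last exact: VY.
  by move/eqP; rewrite subr_eq0 => /eqP.
- move=> u u' w w' [/= Vu Yw Lu] [/= Vu' Yw' Lu'] uu'.
  have Yww := subspaceB Yip Yw Yw'.
  apply/hnorm_eq0 => //; apply: (dense_orthogonal_null Vd) => // v Vv.
  have [_ qu] := form_domain_heq Vu (VY Vu') uu'.
  rewrite (formB Yip) //; last exact: VY.
  by rewrite -Lu // -Lu' // qu // subrr.
Qed.

Lemma form_graph_symm : form_graph `<=` adjoint_graph Y ip form_graph.
Proof.
move=> [u w] [/= Vu Yw Lu]; split=> //=; first exact: VY.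
move=> [u' w'] [/= Vu' Yw' Lu'].
by rewrite -Lu' // (formC Vq) // Lu // (formC Yip) //; exact: VY.
Qed.

(** A vector [y] orthogonal to the domain is in particular orthogonal to the
    solution [t] of [(L + k) t = y], which forces [t], and then [y], to be null. *)
Lemma form_graph_dense : hdense Y ip (op_dom form_graph).
Proof.
have [_ [L0 LD] _ _] := form_graph_linear.
apply: dense_of_orthogonal.
- by move=> _ [[u w] [/= Vu _ _] <-]; exact: VY.
- split; first by exists 0.
  move=> c _ _ [[u w] Lu <-] [[u' w'] Lu' <-] /=.
  by exists (c *: (u, w) + (u', w')) => //; exact: LD.
move=> y Yy yL; have [k [kge ksurj]] := form_graph_surj.
have [t Vt tP] := ksurj y Yy; have Yt := VY Vt.
have yt : ip y t = 0.
  apply: yL; exists (t, y - k *: t) => //; split=> //=.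
    by apply: (subspaceB Yip) => //; exact: (subspaceZ Yip).
  move=> v Vv; have Yv := VY Vv.
  rewrite (formB Yip) ?(formZ Yip) //; last exact: (subspaceZ Yip).
  by rewrite -tP // /shifted_form; ring.
have tt : ip t t = 0.
  by apply/eqP; rewrite eq_le ip0 // andbT -yt -tP // kge.
apply: (dense_orthogonal_null Vd) => // v Vv; rewrite -tP //.
apply: (form_null (shifted_formP k)) => //.
  by move=> w Vw; apply: le_trans (kge _ Vw); exact/ip0/VY.
by rewrite tP.
Qed.

(** A pair [(z, z')] in the adjoint differs by a null vector from the solution
    [t] of [(L + k) t = z' + k z]. *)
Lemma form_graph_self_adjoint : self_adjoint Y ip form_graph.
Proof.
split; [exact: form_graph_linear|exact: form_graph_dense|].
apply/seteqP; split; first exact: form_graph_symm.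
move=> [z z'] [/= Yz Yz' zP]; have [k [kge ksurj]] := form_graph_surj.
have Ykz := subspaceZ Yip k Yz; have Yzz := subspaceD Yip Yz' Ykz.
have [t Vt tP] := ksurj _ Yzz; have Yt := VY Vt.
have Ykt := subspaceZ Yip k Yt.
have Ltz : form_graph (t, z' + k *: z - k *: t).
  split=> //=; first exact: (subspaceB Yip).
  move=> v Vv; have Yv := VY Vv; rewrite (formB Yip) // (formZ Yip) //.
  by rewrite -tP // /shifted_form; ring.
have [_ _ Lsat _] := form_graph_linear.
have Ytz := subspaceB Yip Yt Yz.
have tz0 : ip (t - z) (t - z) = 0.
  have [s Vs sP] := ksurj _ Ytz; have Ys := VY Vs.
  have Yks := subspaceZ Yip k Ys.
  have Ls : form_graph (s, t - z - k *: s).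
    split=> //=; first exact: (subspaceB Yip).
    move=> v Vv; have Yv := VY Vv; rewrite (formB Yip (u := t - z)) // (formZ Yip) //.
    by rewrite -sP // /shifted_form; ring.
  have /= sz := zP _ Ls.
  rewrite (formBr Yip) // -{1}sP // (formC (shifted_formP k)) // tP //.
  have -> : ip (t - z) z = ip (t - z - k *: s) z + k * ip s z.
    by rewrite (formB Yip (u := t - z)) // (formZ Yip) //; ring.
  rewrite sz (formD Yip) // (formZ Yip) // (formC Yip Yz' Ys) (formC Yip Yz Ys).
  ring.
apply: (Lsat _ _ _ _ Ltz) => //; first exact/hnorm_eq0.
apply/hnorm_eq0; first by apply: (subspaceB Yip) => //; exact: (subspaceB Yip).
have -> : z' + k *: z - k *: t - z' = (- k) *: (t - z).
  by rewrite scalerBr !scaleNr opprK addrC !addrA addNr add0r addrC.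
by rewrite (formZ Yip) ?(formZr Yip) ?tz0 ?mulr0 //; exact: (subspaceZ Yip).
Qed.

(** First representation theorem for closed semibounded forms; uniqueness holds
    because a self-adjoint operator has no proper self-adjoint extension. *)
Theorem form_representation : exists! L : set (E * E),
  self_adjoint Y ip L /\ represents_form ip V q L.
Proof.
exists form_graph; split.
  split; first exact: form_graph_self_adjoint.
  split; first by move=> _ [[u w] [/= Vu _ _] <-].
  by move=> u w v [/= _ _ Lu] Vv; exact: Lu.
move=> L' [[[L'Y L'lin _ _] _ L'adj] [L'V L'q]].
have sub : L' `<=` form_graph.
  move=> [u w] Luw; have [_ /= Yw] := L'Y _ Luw.
  split=> //=; first by apply: L'V; exists (u, w).
  by move=> v Vv; exact: L'q Luw Vv.
apply/seteqP; split=> //.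
have [_ _ ->] := form_graph_self_adjoint.
rewrite L'adj => z [Yz1 Yz2 zP]; split=> // t L't.
exact/zP/sub.
Qed.

End FormOperator.

(** * Weighted square-integrable functions *)

Section RealIntegrals.
Context d (T : measurableType d) {R : realType} (mu : {measure set T -> \bar R}).
Variable D : set T.
Hypothesis mD : measurable D.
Implicit Types f g : T -> R.

Lemma EFin_Rintegral f : mu.-integrable D (EFin \o f) ->
  (\int[mu]_(x in D) f x)%:E = (\int[mu]_(x in D) (f x)%:E)%E.
Proof. by move=> If; rewrite /Rintegral fineK // integrable_fin_num. Qed.

Lemma integrable_le f g : measurable_fun D f -> (forall x, D x -> `|f x| <= g x) ->
  mu.-integrable D (EFin \o g) -> mu.-integrable D (EFin \o f).
Proof.
move=> mf fg; apply: le_integrable => //; first exact/measurable_EFinP.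
move=> x Dx /=; rewrite lee_fin (le_trans (fg x Dx)) //.
by rewrite ler_norm.
Qed.

Lemma integrable_ge0 f : measurable_fun D f -> (forall x, D x -> 0 <= f x) ->
  (\int[mu]_(x in D) (f x)%:E < +oo)%E -> mu.-integrable D (EFin \o f).
Proof.
move=> mf f0 foo; apply/integrableP; split; first exact/measurable_EFinP.
rewrite (eq_integral (fun x => (f x)%:E)) // => x; rewrite inE => Dx /=.
by rewrite ger0_norm ?f0.
Qed.

Lemma eq_integrable_fun f g : {in D, f =1 g} ->
  mu.-integrable D (EFin \o f) -> mu.-integrable D (EFin \o g).
Proof. by move=> fg; apply: eq_integrable => // x Dx /=; rewrite fg. Qed.

Lemma integrable_add f g : mu.-integrable D (EFin \o f) ->
  mu.-integrable D (EFin \o g) -> mu.-integrable D (EFin \o (fun x => f x + g x)).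
Proof. by move=> If Ig; exact: (integrableD mD If Ig). Qed.

Lemma integrable_mull k f : mu.-integrable D (EFin \o f) ->
  mu.-integrable D (EFin \o (fun x => k * f x)).
Proof.
move=> If; have := integrableZl mD k If.
by apply: eq_integrable => // x _; rewrite /= EFinM.
Qed.

Lemma ae_eq_Rintegral f g : measurable_fun D f -> measurable_fun D g ->
  {ae mu, forall x, D x -> f x = g x} ->
  \int[mu]_(x in D) f x = \int[mu]_(x in D) g x.
Proof.
move=> mf mg fg; congr fine; apply: ae_eq_integral => //; try exact/measurable_EFinP.
by apply: filterS fg => x + Dx /= => ->.
Qed.

End RealIntegrals.

Section WeightedL2.
Context d (T : measurableType d) {R : realType} (mu : {measure set T -> \bar R}).
Variables (D : set T) (w : T -> R).
Hypothesis mD : measurable D.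
Hypothesis mw : measurable_fun D w.
Hypothesis w0 : forall x, D x -> 0 < w x.
Implicit Types f g : T -> R.

(** Convertible with [L2w] when [mu] is [leb3]. *)
Definition wL2 : set (T -> R) := [set h : T -> R | measurable_fun D h /\
  (\int[mu]_(x in D) (w x * h x ^+ 2)%:E < +oo)%E].

Definition wip f g : R := \int[mu]_(x in D) (w x * f x * g x).

Lemma wL2_sqr_integrable f : wL2 f ->
  mu.-integrable D (EFin \o (fun x => w x * f x ^+ 2)).
Proof.
move=> [mf f2]; apply: integrable_ge0 => //.
  by apply: measurable_funM => //; exact: measurable_funX.
by move=> x Dx; rewrite mulr_ge0 ?sqr_ge0 // ltW // w0.
Qed.

Lemma wL2_measurable_mul f g : measurable_fun D f -> measurable_fun D g ->
  measurable_fun D (fun x => w x * f x * g x).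
Proof. by move=> mf mg; apply: measurable_funM => //; exact: measurable_funM. Qed.

Lemma wL2_mul_integrable f g : wL2 f -> wL2 g ->
  mu.-integrable D (EFin \o (fun x => w x * f x * g x)).
Proof.
move=> Lf Lg; have If := wL2_sqr_integrable Lf; have Ig := wL2_sqr_integrable Lg.
apply: (integrable_le mD _ _ (integrable_add mD If Ig)).
  by apply: wL2_measurable_mul; [case: Lf|case: Lg].
move=> x Dx; have wx := w0 Dx; rewrite -mulrA normrM (gtr0_norm wx) -mulrDr.
rewrite ler_wpM2l ?(ltW wx) //.
have := sqr_ge0 (f x - g x); have := sqr_ge0 (f x + g x).
have := sqr_ge0 (f x); have := sqr_ge0 (g x).
by rewrite ler_norml; move: (f x) (g x) => a b; nra.
Qed.

Lemma wip_EFin f g : wL2 f -> wL2 g ->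
  (wip f g)%:E = (\int[mu]_(x in D) (w x * f x * g x)%:E)%E.
Proof. by move=> Lf Lg; rewrite EFin_Rintegral //; exact: wL2_mul_integrable. Qed.

Lemma wL2_subspace : lin_subspace wL2.
Proof.
split.
  split; first exact: measurable_cst.
  under eq_integral do rewrite expr0n mulr0.
  by rewrite integral0.
move=> c f g Lf Lg; have [mf _] := Lf; have [mg _] := Lg.
have mfg : measurable_fun D (c *: f + g).
  by apply: measurable_funD => //; apply: measurable_funM.
split => //.
have If := wL2_sqr_integrable Lf; have Ig := wL2_sqr_integrable Lg.
have Is := integrable_add mD (integrable_mull mD (2 * c ^+ 2) If) (integrable_mull mD 2 Ig).
suff /integrableP[_] : mu.-integrable D (EFin \o (fun x => w x * (c *: f + g) x ^+ 2)).
  apply: le_lt_trans; rewrite le_eqVlt; apply/orP; left; apply/eqP/eq_integral => x.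
  rewrite inE => Dx /=; rewrite ger0_norm // mulr_ge0 ?sqr_ge0 //.
  exact/ltW/w0.
apply: (integrable_le mD _ _ Is); first by apply: measurable_funM => //; exact: measurable_funX.
move=> x Dx; have wx := w0 Dx; rewrite ger0_norm; last exact: (mulr_ge0 (ltW wx) (sqr_ge0 _)).
rewrite fctE /=.
have -> : (c *: f) x = c * f x by [].
have := sqr_ge0 (c * f x - g x); have wx0 := ltW wx.
move: (f x) (g x) => a b h.
have : 0 <= w x * (c * a - b) ^+ 2 by rewrite mulr_ge0.
by nra.
Qed.

Lemma wip_form : symm_bilinear_form wL2 wip.
Proof.
split; first exact: wL2_subspace.
  by move=> f g _ _; apply: eq_Rintegral => x _; ring.
move=> c f g h Lf Lg Lh.
have Ifh := wL2_mul_integrable Lf Lh; have Igh := wL2_mul_integrable Lg Lh.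
rewrite /wip -RintegralZl // -RintegralD //; last exact: integrable_mull.
apply: eq_Rintegral => x _; rewrite fctE.
have -> : (c *: f) x = c * f x by [].
ring.
Qed.

Lemma wip_ge0 f : 0 <= wip f f.
Proof.
apply: Rintegral_ge0 => x Dx; rewrite -mulrA -expr2 mulr_ge0 ?sqr_ge0 //.
exact/ltW/w0.
Qed.

Lemma wip_sqr f : wL2 f -> (wip f f)%:E = (\int[mu]_(x in D) (w x * f x ^+ 2)%:E)%E.
Proof.
by move=> Lf; rewrite wip_EFin //; apply: eq_integral => x _; rewrite -mulrA expr2.
Qed.

(** Riesz-Fischer.  Along a subsequence with [||v_(k+1) - v_k||^2 <= 8^-k] the
    series of [4^k w (v_(k+1) - v_k)^2] is integrable, hence finite almost
    everywhere, so that [v_k] converges geometrically there. *)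
Lemma wip_complete : ip_complete wL2 wip.
Proof.
have W := wip_form; have W0 f (_ : wL2 f) := wip_ge0 f.
move=> u_ Lu uC.
have sub k : exists N, forall n m, (N <= n)%N -> (N <= m)%N ->
    wip (u_ n - u_ m) (u_ n - u_ m) < (8 ^+ k)^-1.
  by apply: uC; rewrite invr_gt0 exprn_gt0.
pose N0 k := projT1 (cid (sub k)).
have N0P k : forall n m, (N0 k <= n)%N -> (N0 k <= m)%N ->
    wip (u_ n - u_ m) (u_ n - u_ m) < (8 ^+ k)^-1.
  exact: (projT2 (cid (sub k))).
pose N k := (\sum_(i < k.+1) (N0 i).+1)%N.
have NN0 k : (N0 k <= N k)%N by rewrite /N big_ord_recr /= addnS leqW // leq_addl.
have kN k : (k <= N k)%N.
  elim: k => // k IH; rewrite /N big_ord_recr /= -/(N k) addnS ltnS.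
  exact: leq_trans IH (leq_addr _ _).
have NS k : (N k <= N k.+1)%N by rewrite /N [in leqRHS]big_ord_recr leq_addr.
pose v k := u_ (N k).
have Lv k : wL2 (v k) by exact: Lu.
have mv k : measurable_fun D (v k) by case: (Lv k).
pose t k x := 4 ^+ k * (w x * (v k.+1 x - v k x) ^+ 2).
have t0 k x : D x -> 0 <= t k x.
  move=> Dx; apply: mulr_ge0; first exact: exprn_ge0.
  exact: (mulr_ge0 (ltW (w0 Dx)) (sqr_ge0 _)).
have mt k : measurable_fun D (t k).
  apply: measurable_funM => //; apply: measurable_funM => //.
  by apply: measurable_funX; exact: measurable_funB.
have It k : (\int[mu]_(x in D) (t k x)%:E <= (2 / (2 ^ (k + 1))%:R)%:E)%E.
  have Lvk := subspaceB W (Lv k.+1) (Lv k).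
  have -> : (\int[mu]_(x in D) (t k x)%:E = (4 ^+ k * wip (v k.+1 - v k) (v k.+1 - v k))%:E)%E.
    rewrite EFinM wip_sqr // -ge0_integralZl //.
    - by apply/measurable_EFinP/measurable_funM => //; apply: measurable_funX; exact: measurable_funB.
    - by move=> x Dx; rewrite lee_fin mulr_ge0 ?sqr_ge0 // ltW // w0.
  rewrite lee_fin natrX exprD expr1 invfM mulrCA divff // mulr1 -ler_pdivlMl ?exprn_gt0 //.
  have := N0P k _ _ (leq_trans (NN0 k) (NS k)) (NN0 k) => /ltW /le_trans; apply.
  by rewrite -invfM -exprMn; rewrite (_ : 4 * 2 = 8) //; ring.
pose S x := (\sum_(k <oo) (t k x)%:E)%E.
have mS : measurable_fun D S.
  apply: ge0_emeasurable_sum => [k x Dx _|k _]; first by rewrite lee_fin t0.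
  exact/measurable_EFinP.
have S0 x : D x -> (0 <= S x)%E.
  by move=> Dx; apply: nneseries_ge0 => k _ _; rewrite lee_fin t0.
have IS : mu.-integrable D S.
  apply/integrableP; split => //.
  rewrite (eq_integral S); last by move=> x; rewrite inE => Dx; rewrite gee0_abs ?S0.
  rewrite integral_nneseries //; last by move=> k; exact/measurable_EFinP.
  apply: (@le_lt_trans _ _ (\sum_(k <oo) (2 / (2 ^ (k + 1))%:R)%:E)%E).
    apply: lee_nneseries => // k _ _.
    by apply: integral_ge0 => x Dx; rewrite lee_fin t0.
  have /cvg_lim := @cvg_geometric_eseries_half R 2 0.
  by rewrite /eseries => -> //; rewrite ltry.
pose G := D `&` [set x | (S x < +oo)%E].
have mG : measurable G by exact: measurable_lte.
pose h k x := v k x * \1_G x.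
have mh k : measurable_fun D (h k).
  by apply: measurable_funM => //; exact: measurable_indic.
have hcvg x : D x -> cvgn (h ^~ x).
  move=> Dx; have [Gx|Gx] := pselect (G x); last first.
    rewrite (_ : h ^~ x = cst 0); first exact: is_cvg_cst.
    by apply/funext => k; rewrite /h indicE memNset // mulr0.
  rewrite (_ : h ^~ x = v ^~ x); last first.
    by apply/funext => k; rewrite /h indicE mem_set // mulr1.
  have wx := w0 Dx; have [_ /= Sx] := Gx.
  have Sfin : S x \is a fin_num by rewrite ge0_fin_numE ?S0.
  pose C := Num.sqrt (fine (S x) / w x).
  have dv k : `|v k.+1 x - v k x| <= geometric C 2^-1 k.
    rewrite /geometric /= -(@ler_pXn2r _ 2) ?nnegrE ?mulr_ge0 ?sqrtr_ge0 ?exprn_ge0 //.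
    rewrite real_normK ?num_real // exprMn sqr_sqrtr; last first.
      by apply: divr_ge0; [exact/fine_ge0/S0|exact: ltW].
    have : ((t k x)%:E <= S x)%E.
      rewrite /S (nneseriesD1 (n := k)) //.
        by rewrite leeDl // nneseries_ge0 // => j _ _; rewrite lee_fin t0.
      by move=> j _; rewrite lee_fin t0.
    rewrite -(fineK Sfin) lee_fin /t => tS.
    rewrite -exprM mulnC exprM (_ : 2^-1 ^+ 2 = 4^-1); last by field.
    rewrite exprVn !ler_pdivlMr ?exprn_gt0 //.
    by rewrite (_ : _ * _ * _ = 4 ^+ k * (w x * (v k.+1 x - v k x) ^+ 2)) //; ring.
  have : cvgn (series (fun k => v k.+1 x - v k x)).
    apply: normed_cvg; apply: (series_le_cvg _ _ dv) => //.
      by move=> k; rewrite /geometric /= mulr_ge0 ?sqrtr_ge0 ?exprn_ge0.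
    apply: is_cvg_geometric_series; rewrite ger0_norm //; lra.
  move=> sc.
  rewrite (_ : v ^~ x = fun k => v 0%N x + series (fun k => v k.+1 x - v k x) k).
    by apply: is_cvgD => //; exact: is_cvg_cst.
  by apply/funext => k; rewrite seriesEnat /= telescope_sumr // addrC subrK.
pose u x := limn (h ^~ x).
have hu x : D x -> h ^~ x @ \oo --> u x by exact: hcvg.
have mu_ : measurable_fun D u by exact: measurable_fun_cvg hu.
have Gae : {ae mu, forall x, D x -> G x}.
  apply: filterS (integrable_ae mD IS) => x + Dx => /(_ Dx) Sx; split => //=.
  by rewrite -ge0_fin_numE ?S0.
have key e : 0 < e -> exists M, forall n, (M <= n)%N ->
    (\int[mu]_(x in D) (w x * (u_ n x - u x) ^+ 2)%:E <= e%:E)%E.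
  move=> e0; have [M HM] := uC e e0; exists M => n Mn.
  have mun : measurable_fun D (u_ n) by case: (Lu n).
  pose F k x := (w x * (u_ n x - h k x) ^+ 2)%:E.
  have mF k : measurable_fun D (F k).
    apply/measurable_EFinP/measurable_funM => //; apply: measurable_funX.
    exact: measurable_funB.
  have F0 k x : D x -> (0 <= F k x)%E.
    by move=> Dx; rewrite lee_fin mulr_ge0 ?sqr_ge0 // ltW // w0.
  have Flim x : D x -> limn_einf (F ^~ x) = (w x * (u_ n x - u x) ^+ 2)%:E.
    move=> Dx; have cF : F ^~ x @ \oo --> (w x * (u_ n x - u x) ^+ 2)%:E.
      apply: cvg_EFin; first by apply: nearW.
      apply: cvgMr; rewrite /comp /= expr2.
      under eq_fun do rewrite expr2.
      by apply: cvgM; apply: cvgB; [exact: cvg_cst|exact: hu|exact: cvg_cst|exact: hu].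
    by rewrite is_cvg_limn_einfE; [exact: cvg_lim cF|apply/cvg_ex; eexists; exact: cF].
  have -> : (\int[mu]_(x in D) (w x * (u_ n x - u x) ^+ 2)%:E =
             \int[mu]_(x in D) limn_einf (F ^~ x))%E.
    by apply: eq_integral => x; rewrite inE => Dx; rewrite Flim.
  apply: le_trans (fatou mu mD mF F0) _.
  rewrite limn_einf_lim; apply: lime_le; first exact: is_cvg_einfs.
  exists M => // k /= Mk; have Nk := leq_trans Mk (kN k).
  have IF : (\int[mu]_(x in D) F k x <= e%:E)%E.
    have Lnj := subspaceB W (Lu n) (Lv k).
    rewrite (ge0_ae_eq_integral (g := fun x => (w x * (u_ n x - v k x) ^+ 2)%:E)) //.
    - by rewrite -(wip_sqr Lnj) lee_fin ltW // HM.
    - apply/measurable_EFinP/measurable_funM => //; apply: measurable_funX.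
      exact: measurable_funB.
    - by move=> x; exact: F0.
    - by move=> x Dx; rewrite lee_fin mulr_ge0 ?sqr_ge0 // ltW // w0.
    - apply: filterS Gae => x + Dx => /(_ Dx) Gx.
      by rewrite /F /h indicE mem_set // mulr1.
  by apply: le_trans IF; apply: ereal_inf_lbound; exists k => //=.
have [M HM] := key 1 ltr01.
have Lu' : wL2 u.
  have -> : u = u_ M - (u_ M - u) by rewrite opprB addrC subrK.
  apply: (subspaceB W) => //; split.
    by apply: measurable_funB => //; case: (Lu M).
  by apply: le_lt_trans (HM M (leqnn M)) _; rewrite ltry.
exists u => // e e0; have e2 : 0 < e / 2 by lra.
have [K HK] := key _ e2; exists K => n Kn.
have := HK n Kn; rewrite -(wip_sqr (subspaceB W (Lu n) Lu')) lee_fin; lra.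
Qed.

End WeightedL2.

Lemma wL2_dominated d (T : measurableType d) (R : realType)
    (mu : {measure set T -> \bar R}) (D : set T) (w w' f g : T -> R) K :
  measurable D -> measurable_fun D w -> (forall x, D x -> 0 < w x) ->
  measurable_fun D w' -> (forall x, D x -> 0 < w' x) -> measurable_fun D f ->
  wL2 mu D w' g -> (forall x, D x -> w x * f x ^+ 2 <= K * (w' x * g x ^+ 2)) ->
  wL2 mu D w f.
Proof.
move=> mD mw w0 mw' w'0 mf Lg fg; split=> //.
have /integrableP[_] := integrable_mull mD K (wL2_sqr_integrable mw' w'0 Lg).
apply: le_lt_trans; apply: ge0_le_integral => //.
- by move=> x Dx; rewrite lee_fin mulr_ge0 ?sqr_ge0 // ltW // w0.
- by apply/measurable_EFinP; apply: measurable_funM => //; exact: measurable_funX.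
- apply: measurableT_comp => //; apply/measurable_EFinP; apply: measurable_funM => //.
  by apply: measurable_funM => //; apply: measurable_funX; case: Lg.
- by move=> x Dx; rewrite /= lee_fin; apply: le_trans (ler_norm _); exact: fg.
Qed.

(** * Smooth functions built from the flat exponential *)

Section Flat.
Context {R : realType}.
Implicit Types (p : {poly R}) (t : R).

(** The family [p(1/t) exp(-1/t)] is closed under differentiation, so that each
    of its members is of class C^oo although it vanishes for [t <= 0]. *)
Definition flat p t : R := if 0 < t then p.[t^-1] * expR (- t^-1) else 0.

Definition flat_deriv p : {poly R} := 'X^2 * (p - p^`()).

Lemma monomial_expR_le (y : R) n : 0 < y -> y ^+ n.+1 * expR (- y) <= n.+1`!%:R.
Proof.
move=> y0; rewrite expRN ler_pdivrMr ?expR_gt0 //.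
have /(le_trans _) := expR_ge1Dxn n (ltW y0).
move=> /(_ (y ^+ n.+1 / n.+1`!%:R)); rewrite lerDr ler01 => /(_ isT).
by rewrite ler_pdivrMr ?ltr0n ?fact_gt0 // mulrC.
Qed.

(** Faster than linear decay at 0, where the difference quotient therefore tends
    to 0. *)
Lemma flat_le_sqr p : exists C, forall t, `|flat p t| <= C * t ^+ 2.
Proof.
exists (\sum_(i < size p) `|p`_i| * i.+2`!%:R) => t; rewrite /flat.
case: ifPn => t0; last first.
  by rewrite normr0 mulr_ge0 ?sqr_ge0 // sumr_ge0 // => i _; rewrite mulr_ge0.
have y0 : 0 < t^-1 by rewrite invr_gt0.
rewrite -ler_pdivrMr ?exprn_gt0 // -exprVn horner_coef.
move: t^-1 y0 => y y0; rewrite normrM (ger0_norm (expR_ge0 _)).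
apply: (@le_trans _ _ (\sum_(i < size p) `|p`_i * y ^+ i| * expR (- y) * y ^+ 2)).
  rewrite -!mulr_suml ler_wpM2r ?exprn_ge0 ?(ltW y0) // ler_wpM2r ?expR_ge0 //.
  exact: ler_norm_sum.
apply: ler_sum => i _; rewrite normrM -!mulrA ler_wpM2l //.
rewrite normrX (gtr0_norm y0).
rewrite (_ : y ^+ i * _ = y ^+ i.+2 * expR (- y)); first exact: monomial_expR_le.
rewrite (_ : y ^+ i.+2 = y ^+ i * y ^+ 2); last by rewrite -exprD addn2.
move: (y ^+ i) (expR (- y)) => a b; ring.
Qed.

Lemma flat_is_derive p t : is_derive t 1 (flat p) (flat (flat_deriv p) t).
Proof.
have [t0|t0|->] := ltgtP t 0.
- rewrite {2}/flat lt_gtF //.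
  apply: (near_eq_is_derive (f := cst 0)).
  by near=> x; rewrite /flat lt_gtF //; near: x; exact: lt_nbhsl.
- apply: (near_eq_is_derive (f := fun x : R => p.[x^-1] * expR (- x^-1) : R)).
    by near=> x; rewrite /flat ifT //; near: x; exact: lt_nbhsr.
  have t1 : t != 0 by rewrite gt_eqF.
  have dV : is_derive t 1 (fun x : R => x^-1) (- t ^- 2).
    have := @is_deriveV R id t 1 1 t1 (is_derive_id t 1).
    by rewrite /GRing.scale /= mulr1.
  have dp : is_derive t 1 (fun x => p.[x^-1]) (p^`().[t^-1] * - t ^- 2).
    exact: (is_derive1_comp (is_derive_poly p t^-1) dV).
  have dN : is_derive t 1 (fun x : R => - x^-1) (- - t ^- 2) by exact: is_deriveN.
  have de : is_derive t 1 (fun x : R => expR (- x^-1)) (expR (- t^-1) * t ^- 2).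
    have := @is_derive1_comp _ expR (fun x : R => - x^-1) t _ _ (is_derive_expR _) dN.
    by rewrite opprK.
  apply: is_derive_eq (is_deriveM dp de) _.
  rewrite /flat t0 /flat_deriv hornerM hornerXn hornerD hornerN -!exprVn /GRing.scale /=.
  by move: p.[_] p^`().[_] => a b; ring.
- have [C HC] := flat_le_sqr p.
  have C0 : 0 <= C.
    by have := le_trans (normr_ge0 _) (HC 1); rewrite expr1n mulr1.
  have cv : (fun h => h^-1 *: ((flat p \o shift 0) (h *: 1) - flat p 0)) @ 0^' --> (0 : R).
    apply/cvgrPdist_le => e e0; near=> h.
    have h0 : h != 0 by near: h; exact: nbhs_dnbhs_neq.
    rewrite /= /GRing.scale /= mulr1 addr0 {2}/flat ltxx subr0 sub0r normrN.
    rewrite normrM normfV ler_pdivrMl ?normr_gt0 //.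
    apply: le_trans (HC h) _; rewrite -(real_normK (num_real h)) expr2 mulrCA.
    rewrite ler_wpM2l //.
    apply: (@le_trans _ _ ((C + 1) * `|h|)); first by rewrite ler_wpM2r // lerDl.
    rewrite -ler_pdivlMl ?ltr_wpDl // mulrC.
    near: h; apply: dnbhs0_le; rewrite divr_gt0 // ltr_wpDl //.
  rewrite {2}/flat ltxx; apply: DeriveDef; first by apply/cvg_ex; exists 0.
  exact: cvg_lim cv.
Unshelve. all: by end_near. Qed.

End Flat.

Section Smooth.
Context {R : realType}.
Implicit Types (f g : R * R * R -> R) (x v : R * R * R).

(** An algebra of C^oo functions on R^3 given by its generators: enough bump
    functions for the fundamental lemma of the calculus of variations, and a
    derivative that can be computed by induction. *)
Inductive smooth : (R * R * R -> R) -> Prop :=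
| smooth_cst c : smooth (fun=> c)
| smooth_x1 : smooth (fun x => x.1.1)
| smooth_x2 : smooth (fun x => x.1.2)
| smooth_x3 : smooth (fun x => x.2)
| smooth_add f g : smooth f -> smooth g -> smooth (fun x => f x + g x)
| smooth_mul f g : smooth f -> smooth g -> smooth (fun x => f x * g x)
| smooth_flat p f : smooth f -> smooth (fun x => flat p (f x)).

Lemma continuous_x1 : continuous (fun x : R * R * R => x.1.1).
Proof. by move=> x; apply: (continuous_comp (f := fst)); exact: cvg_fst. Qed.

Lemma continuous_x2 : continuous (fun x : R * R * R => x.1.2).
Proof.
by move=> x; apply: (continuous_comp (f := fst)); [exact: cvg_fst|exact: cvg_snd].
Qed.

Lemma continuous_x3 : continuous (fun x : R * R * R => x.2).
Proof. by move=> x; exact: cvg_snd. Qed.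

Lemma differentiable_x1 x : differentiable (fun x : R * R * R => x.1.1) x.
Proof.
exact: (@linear_differentiable _ _ _ (fst \o fst : {linear _ -> _}) x continuous_x1).
Qed.

Lemma differentiable_x2 x : differentiable (fun x : R * R * R => x.1.2) x.
Proof.
exact: (@linear_differentiable _ _ _ (snd \o fst : {linear _ -> _}) x continuous_x2).
Qed.

Lemma differentiable_x3 x : differentiable (fun x : R * R * R => x.2) x.
Proof.
exact: (@linear_differentiable _ _ _ (snd : {linear _ -> _}) x continuous_x3).
Qed.

Lemma derive_x1 x v : 'D_v (fun x : R * R * R => x.1.1) x = v.1.1.
Proof.
rewrite deriveE; last exact: differentiable_x1.
by rewrite (diff_lin (f := fst \o fst : {linear _ -> _}) x continuous_x1).
Qed.

Lemma derive_x2 x v : 'D_v (fun x : R * R * R => x.1.2) x = v.1.2.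
Proof.
rewrite deriveE; last exact: differentiable_x2.
by rewrite (diff_lin (f := snd \o fst : {linear _ -> _}) x continuous_x2).
Qed.

Lemma derive_x3 x v : 'D_v (fun x : R * R * R => x.2) x = v.2.
Proof.
rewrite deriveE; last exact: differentiable_x3.
by rewrite (diff_lin (f := snd : {linear _ -> _}) x continuous_x3).
Qed.

Lemma derive_comp1 (h : R -> R) f x v : differentiable h (f x) ->
  differentiable f x -> 'D_v (h \o f) x = derive1 h (f x) * 'D_v f x.
Proof.
move=> dh df; rewrite deriveE; last exact: differentiable_comp.
rewrite diff_comp //= diff1E // -deriveE //.
by rewrite /GRing.scale /= mulrC.
Qed.

Lemma smooth_differentiable f x : smooth f -> differentiable f x.
Proof.
elim=> {f} [c||||f g _ df _ dg|f g _ df _ dg|p f _ df].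
- exact: differentiable_cst.
- exact: differentiable_x1.
- exact: differentiable_x2.
- exact: differentiable_x3.
- exact: differentiableD.
- exact: differentiableM.
- apply: (differentiable_comp (g := flat p)) => //.
  by apply/derivable1_diffP; case: (flat_is_derive p (f x)).
Qed.

Lemma smooth_continuous f : smooth f -> continuous f.
Proof. by move=> sf x; exact/differentiable_continuous/smooth_differentiable. Qed.

Lemma smooth_derive f v : smooth f -> smooth ('D_v f).
Proof.
elim=> {f} [c||||f g sf df sg dg|f g sf df sg dg|p f sf df].
- rewrite (_ : 'D_v _ = fun=> 0); first exact: smooth_cst.
  by apply/funext => x; rewrite derive_cst.
- rewrite (_ : 'D_v _ = fun=> v.1.1); first exact: smooth_cst.
  by apply/funext => x; rewrite derive_x1.
- rewrite (_ : 'D_v _ = fun=> v.1.2); first exact: smooth_cst.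
  by apply/funext => x; rewrite derive_x2.
- rewrite (_ : 'D_v _ = fun=> v.2); first exact: smooth_cst.
  by apply/funext => x; rewrite derive_x3.
- rewrite (_ : 'D_v _ = (fun x => 'D_v f x + 'D_v g x)); first exact: smooth_add.
  by apply/funext => x; rewrite deriveD //; exact/diff_derivable/smooth_differentiable.
- rewrite (_ : 'D_v _ = (fun x => f x * 'D_v g x + g x * 'D_v f x)).
    by apply: smooth_add; exact: smooth_mul.
  by apply/funext => x; rewrite deriveM //; exact/diff_derivable/smooth_differentiable.
- rewrite (_ : 'D_v _ = (fun x => flat (flat_deriv p) (f x) * 'D_v f x)).
    by apply: smooth_mul => //; exact: smooth_flat.
  apply/funext => x; have dp := flat_is_derive p (f x).
  rewrite (derive_comp1 (h := flat p)); last exact: smooth_differentiable.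
    by rewrite derive1E derive_val.
  by apply/derivable1_diffP; case: dp.
Qed.

Lemma smooth_Ck f k : smooth f -> Ck_open k setT f.
Proof.
move=> sf vs _; have sD : smooth (iter_derive vs f).
  by elim: vs => //= v vs IH; exact: smooth_derive.
split=> [x _|_ v x _]; first exact: smooth_continuous.
exact/diff_derivable/smooth_differentiable.
Qed.

Lemma smooth_dot : smooth (fun x => dot x x).
Proof. by apply: smooth_add; [apply: smooth_add|]; apply: smooth_mul; constructor. Qed.

End Smooth.

Section Euclidean.
Context {R : realType}.
Implicit Types (x y : R * R * R).

Lemma dotC x y : dot x y = dot y x.
Proof. by rewrite /dot; ring. Qed.

Lemma dot_ge0 x : 0 <= dot x x.
Proof. by rewrite /dot -!expr2 !addr_ge0 ?sqr_ge0. Qed.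

Lemma dot_CS x y : dot x y ^+ 2 <= dot x x * dot y y.
Proof.
rewrite /dot; move: x y => [[a b] c] [[d e] f] /=.
have := sqr_ge0 (a * e - b * d); have := sqr_ge0 (a * f - c * d).
have := sqr_ge0 (b * f - c * e); nra.
Qed.

Lemma enorm_ge0 x : 0 <= enorm x. Proof. exact: sqrtr_ge0. Qed.

Lemma enorm_sqr x : enorm x ^+ 2 = dot x x.
Proof. by rewrite sqr_sqrtr // dot_ge0. Qed.

Lemma norm_x1_le x : `|x.1.1| <= enorm x.
Proof.
rewrite -sqrtr_sqr ler_wsqrtr // /dot.
by have := sqr_ge0 x.1.2; have := sqr_ge0 x.2; nra.
Qed.

Lemma norm_x2_le x : `|x.1.2| <= enorm x.
Proof.
rewrite -sqrtr_sqr ler_wsqrtr // /dot.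
by have := sqr_ge0 x.1.1; have := sqr_ge0 x.2; nra.
Qed.

Lemma norm_x3_le x : `|x.2| <= enorm x.
Proof.
rewrite -sqrtr_sqr ler_wsqrtr // /dot.
by have := sqr_ge0 x.1.1; have := sqr_ge0 x.1.2; nra.
Qed.

Lemma continuous_enorm : continuous (@enorm R).
Proof.
move=> x; apply: (continuous_comp (f := fun x => dot x x)).
  by apply: smooth_continuous; exact: smooth_dot.
exact: sqrt_continuous.
Qed.

Definition cube (r : R) : set (R * R * R) := (`[-r, r] `*` `[-r, r]) `*` `[-r, r].

Lemma compact_cube r : compact (cube r).
Proof. by do 2![apply: compact_setX; last exact: segment_compact]; exact: segment_compact. Qed.

Lemma cubeP r x : cube r x <-> [/\ `|x.1.1| <= r, `|x.1.2| <= r & `|x.2| <= r].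
Proof.
rewrite /cube /=; split.
  by move=> [[/= ]]; rewrite !in_itv /= -!ler_norml => -> -> ->.
by move=> [x1 x2 x3]; split; [split|]; rewrite /= in_itv /= -ler_norml.
Qed.

Lemma enorm_le_cube r x : enorm x <= r -> cube r x.
Proof.
move=> xr; apply/cubeP; split; apply: le_trans xr; [exact: norm_x1_le|exact: norm_x2_le|exact: norm_x3_le].
Qed.

Lemma closed_enorm_le (r : R) : closed [set x : R * R * R | enorm x <= r].
Proof.
apply: (closed_comp (f := @enorm R) (D := [set t | t <= r])); last exact: closed_le.
by move=> x _; exact: continuous_enorm.
Qed.

Lemma continuous_bounded_cube (f : R * R * R -> R) r : continuous f ->
  exists2 M, 0 <= M & forall x, cube r x -> `|f x| <= M.
Proof.
move=> cf; have : compact (f @` cube r).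
  apply: continuous_compact; last exact: compact_cube.
  exact: continuous_subspaceT.
move/compact_bounded => [M [_ HM]]; exists (`|M| + 1); first by rewrite addr_ge0.
move=> x cx; apply: (HM (`|M| + 1)); last by exists x.
by rewrite (le_lt_trans (ler_norm M)) // ltrDl.
Qed.

Lemma smooth_test_function (r rad : R) f : smooth f -> r < rad ->
  (forall x, f x != 0 -> enorm x <= r) -> test_function (eball rad) f.
Proof.
move=> sf rR fr.
have sub : closure [set x | f x != 0] `<=` [set x | enorm x <= r].
  rewrite [X in _ `<=` X](closure_id _).1; last exact: closed_enorm_le.
  by apply: closure_subset => x /=; exact: fr.
split=> [k||]; first exact: smooth_Ck.
  have cs : closure [set x | f x != 0] `<=` cube r.
    by move=> x /sub; exact: enorm_le_cube.
  apply: (@subclosed_compact _ _ (cube r)) => //; first exact: closed_closure.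
  exact: compact_cube.
by move=> x /sub /=; rewrite /eball /=; move/le_lt_trans; apply.
Qed.

End Euclidean.

(** * Lebesgue measure on R^3 *)

Section ProductSigmaFinite.
Context d1 d2 (T1 : measurableType d1) (T2 : measurableType d2) {R : realType}.
Variable m1 : {sigma_finite_measure set T1 -> \bar R}.
Variable m2 : {sigma_finite_measure set T2 -> \bar R}.

(** The product of two sigma-finite measures as a sigma-finite measure, so that
    Fubini applies to the iterated product [leb3]. *)
Definition sigma_finite_product : set (T1 * T2) -> \bar R := (m1 \x m2)%E.

HB.instance Definition _ := Measure.on sigma_finite_product.

Lemma sigma_finite_productP : sigma_finite setT sigma_finite_product.
Proof.
have /sigma_finiteP[F [TF ndF Foo]] := sigma_finiteT m1.
have /sigma_finiteP[G [TG ndG Goo]] := sigma_finiteT m2.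
exists (fun n => F n `*` G n).
  apply/seteqP; split=> // -[x y] _.
  have [i _ Fx] : (\bigcup_i F i) x by rewrite -TF.
  have [j _ Gy] : (\bigcup_i G i) y by rewrite -TG.
  exists (maxn i j) => //; split=> /=.
    exact: (subsetPset _ _ (ndF _ _ (leq_maxl i j))).
  exact: (subsetPset _ _ (ndG _ _ (leq_maxr i j))).
move=> n; have [mF Fn] := Foo n; have [mG Gn] := Goo n.
split; first exact: measurableX.
by rewrite /sigma_finite_product product_measure1E // lte_mul_pinfty // ge0_fin_numE.
Qed.

HB.instance Definition _ := Measure_isSigmaFinite.Build _ _ _ sigma_finite_product
  sigma_finite_productP.

End ProductSigmaFinite.

Section Leb3.
Context {R : realType}.
Local Notation leb := (@lebesgue_measure R).

Definition leb2 : {sigma_finite_measure set (measurableTypeR R * measurableTypeR R)%type -> \bar R} :=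
  sigma_finite_product leb leb.

Definition leb3_sf : {sigma_finite_measure set
    (measurableTypeR R * measurableTypeR R * measurableTypeR R)%type -> \bar R} :=
  sigma_finite_product leb2 leb.

Lemma leb3E : @leb3 R = leb3_sf :> {measure set
    (measurableTypeR R * measurableTypeR R * measurableTypeR R)%type -> \bar R}.
Proof. by []. Qed.

Lemma leb3_box (A B C : set R) : measurable A -> measurable B -> measurable C ->
  leb3 ((A `*` B) `*` C) = (leb A * leb B * leb C)%E.
Proof.
move=> mA mB mC; rewrite leb3E [LHS]product_measure1E //; last exact: measurableX.
by congr (_ * _)%E; exact: product_measure1E.
Qed.

Lemma measurable_cube (r : R) : measurable (cube r : set (R * R * R)).
Proof. by apply: measurableX => //; exact: measurableX. Qed.

Lemma leb3_cube (r : R) : 0 <= r -> leb3 (cube r) = ((2 * r) ^+ 3)%:E.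
Proof.
move=> r0; rewrite leb3_box // !lebesgue_measure_itv /= lte_fin.
case: ifPn => [_|]; first by rewrite -!EFinM; congr EFin; ring.
rewrite -leNgt => h; have -> : r = 0 by lra.
by rewrite mulr0 expr0n /= !mule0.
Qed.

Lemma measurable_x1 (D : set (R * R * R)) : measurable_fun D (fun x : R * R * R => x.1.1).
Proof. by apply: measurable_funTS; exact: (measurableT_comp measurable_fst measurable_fst). Qed.

Lemma measurable_x2 (D : set (R * R * R)) : measurable_fun D (fun x : R * R * R => x.1.2).
Proof. by apply: measurable_funTS; exact: (measurableT_comp measurable_snd measurable_fst). Qed.

Lemma measurable_x3 (D : set (R * R * R)) : measurable_fun D (fun x : R * R * R => x.2).
Proof. by apply: measurable_funTS; exact: measurable_snd. Qed.

Definition round (n : nat) (t : R) : R := (Num.floor (n.+1%:R * t))%:~R / n.+1%:R.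

Lemma round_cvg t : round n t @[n --> \oo] --> t.
Proof.
apply/cvgrPdist_le => e e0; near=> n.
have n0 : 0 < n.+1%:R :> R by [].
have /andP[lo hi] := floor_itv (n.+1%:R * t).
have -> : t - round n t = (n.+1%:R * t - (Num.floor (n.+1%:R * t))%:~R) / n.+1%:R.
  by rewrite /round; field.
rewrite normrM normfV (gtr0_norm n0) ler_pdivrMr // ger0_norm ?subr_ge0 //.
apply: (@le_trans _ _ 1); first by move: hi; rewrite intrD; lra.
rewrite -ler_pdivrMl // mulr1; near: n; exists (Num.truncn e^-1) => // n /= Nn.
apply/ltW; apply: lt_le_trans (truncnS_gt _) _.
by rewrite ler_nat ltnS.
Unshelve. all: by end_near. Qed.

Lemma round3_cvg (x : R * R * R) :
  (round n x.1.1, round n x.1.2, round n x.2) @[n --> \oo] --> x.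
Proof.
case: x => [[x1 x2] x3] /=; apply: (@cvg_pair _ _ _ \oo (nbhs (x1, x2)) (nbhs x3)); last exact: round_cvg.
by apply: (@cvg_pair _ _ _ \oo (nbhs x1) (nbhs x2)); exact: round_cvg.
Qed.

(** The product sigma-algebra contains the open sets of R^3 because the grid
    approximations of a continuous function factor through the countable type
    [int * int * int]. *)
Lemma continuous_measurable3 (f : R * R * R -> R) : continuous f ->
  measurable_fun setT f.
Proof.
move=> cf; pose g n (x : R * R * R) := f (round n x.1.1, round n x.1.2, round n x.2).
apply: (measurable_fun_cvg (h := g)); last first.
  move=> x _.
  exact: (cvg_comp _ _ (@round3_cvg x) (cf x)).
move=> n _ Y mY; rewrite setTI.
pose fl (x : R * R * R) : int * int * int :=
  (Num.floor (n.+1%:R * x.1.1), Num.floor (n.+1%:R * x.1.2), Num.floor (n.+1%:R * x.2)).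
pose h (z : int * int * int) : R :=
  f (z.1.1%:~R / n.+1%:R, z.1.2%:~R / n.+1%:R, z.2%:~R / n.+1%:R).
have -> : g n @^-1` Y = \bigcup_z (fl @^-1` ([set z] `&` h @^-1` Y)).
  apply/seteqP; split=> [x Yx|x [z _ [/= flz hz]]]; first by exists (fl x).
  exact: hz.
apply: countable_bigcupT_measurable; first exact: countableP.
move=> z; have [Yz|Yz] := pselect (Y (h z)); last first.
  rewrite (_ : _ @^-1` _ = set0) //.
  by apply/seteqP; split=> // x [/= flz hx]; apply: Yz; rewrite -flz; exact: hx.
have mfl (u : R * R * R -> R) k : measurable_fun setT u ->
    measurable [set x | Num.floor (n.+1%:R * u x) = k].
  move=> mu; have mnu : measurable_fun setT (fun x => n.+1%:R * u x).
    exact: measurable_funM.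
  have := mnu measurableT `[k%:~R, (k + 1)%:~R[%classic (measurable_itv _).
  rewrite setTI (_ : _ @^-1` _ = [set x | Num.floor (n.+1%:R * u x) = k]) //.
  apply/seteqP; split=> x /=; rewrite in_itv /=; first exact: floor_def.
  by move=> <-; exact: floor_itv.
rewrite (_ : _ @^-1` _ = [set x | Num.floor (n.+1%:R * x.1.1) = z.1.1] `&`
    [set x | Num.floor (n.+1%:R * x.1.2) = z.1.2] `&`
    [set x | Num.floor (n.+1%:R * x.2) = z.2]).
  by apply: measurableI; [apply: measurableI|]; apply: mfl;
    [exact: measurable_x1|exact: measurable_x2|exact: measurable_x3].
apply/seteqP; split=> x /=; first by move=> [<- _].
move=> [[e1 e2] e3]; have flz : fl x = z.
  by case: z e1 e2 e3 {Yz} => [[a b] c] /= <- <- <-.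
by split=> //; rewrite flz.
Qed.

Lemma measurable_enorm : measurable_fun setT (@enorm R).
Proof. by apply: continuous_measurable3; exact: continuous_enorm. Qed.

Lemma measurable_eball (r : R) : measurable (eball r : set (R * R * R)).
Proof.
have := measurable_enorm measurableT (measurable_itv `]-oo, r[).
by rewrite setTI.
Qed.

Lemma eball_cube (r : R) : eball r `<=` cube r.
Proof. by move=> x /ltW; exact: enorm_le_cube. Qed.

Lemma leb3_eball_fin (r : R) : (leb3 (eball r : set (R * R * R)) < +oo)%E.
Proof.
have [r0|r0] := leP 0 r.
  apply: (@le_lt_trans _ _ (leb3 (cube r))); last by rewrite leb3_cube // ltry.
  by apply: le_measure; rewrite ?inE; [exact: measurable_eball|exact: measurable_cube|exact: eball_cube].
rewrite (_ : eball r = set0) ?measure0 //; apply/seteqP; split=> // x.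
by rewrite /eball /= => xr; have := lt_trans xr r0; rewrite ltNge enorm_ge0.
Qed.

End Leb3.

(** * The fundamental lemma of the calculus of variations *)

Section Dominated.
Context d (T : measurableType d) {R : realType} (mu : {measure set T -> \bar R}).
Variable D : set T.
Hypothesis mD : measurable D.

Lemma dominated_Rintegral (f_ : nat -> T -> R) (f g : T -> R) :
  (forall n, measurable_fun D (f_ n)) ->
  (forall x, D x -> f_ n x @[n --> \oo] --> f x) ->
  mu.-integrable D (EFin \o g) ->
  (forall n x, D x -> `|f_ n x| <= g x) ->
  \int[mu]_(x in D) f_ n x @[n --> \oo] --> \int[mu]_(x in D) f x.
Proof.
move=> mf ff Ig fg.
have mlim : measurable_fun D f by exact: measurable_fun_cvg ff.
have [|||||If _] := dominated_convergence (mu := mu) mD (f_ := fun n x => (f_ n x)%:E)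
  (f := EFin \o f) (g := EFin \o g).
- by move=> n; exact/measurable_EFinP.
- exact/measurable_EFinP.
- apply: aeW => x Dx; apply: cvg_EFin; first exact: nearW.
  exact: ff.
- exact: Ig.
- by apply: aeW => x n Dx; rewrite lee_fin fg.
rewrite -(EFin_Rintegral mD If) => cI.
exact: fine_cvg cI.
Qed.

(** The sets [A] on which the signed measure [k dmu], pushed forward by [pi],
    vanishes form a lambda-system. *)
Lemma Rintegral_lambda_system d' (T' : measurableType d') (pi : T -> T')
    (G : set (set T')) (k : T -> R) :
  measurable_fun setT pi -> setI_closed G -> G setT ->
  measurable = <<s G >> -> mu.-integrable D (EFin \o k) ->
  (forall A, G A -> \int[mu]_(x in D) (k x * \1_A (pi x)) = 0) ->
  forall A, measurable A -> \int[mu]_(x in D) (k x * \1_A (pi x)) = 0.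
Proof.
move=> mpi GI GT mG Ik G0.
pose H := [set A | measurable A /\ \int[mu]_(x in D) (k x * \1_A (pi x)) = 0].
have mk : measurable_fun D k by apply/measurable_EFinP; case/integrableP: Ik.
have m1 (A : set T') : measurable A -> measurable_fun D (fun x => k x * \1_A (pi x)).
  move=> mA; apply: measurable_funM => //; apply: measurable_funTS.
  by apply: measurableT_comp => //; exact: measurable_indic.
have I1 (A : set T') : measurable A -> mu.-integrable D (EFin \o (fun x => k x * \1_A (pi x))).
  move=> mA; apply: (integrable_le mD (m1 A mA) _ (integrable_norm Ik)) => x Dx.
  rewrite normrM; apply: ler_piMr => //.
  by rewrite indicE; case: (_ \in _); rewrite ?normr1 ?normr0.
suff : <<s G >> `<=` H by move=> GH A mA; apply: (GH _ _).2; rewrite -mG.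
have GmG A : G A -> measurable A by move=> GA; rewrite mG; exact: sub_sigma_algebra.
apply: lambda_system_subset => //; last by move=> A GA; split; [exact: GmG|exact: G0].
split=> //.
- by split=> //; exact: G0.
- move=> A B BA [mA A0] [mB B0]; split; first exact: measurableD.
  rewrite -[RHS](subrr 0) -{1}A0 -B0 -RintegralB //; [|exact: I1|exact: I1].
  apply: eq_Rintegral => x _; rewrite -mulrBr; congr (_ * _).
  rewrite !indicE in_setD; have [Bx|] := boolP (pi x \in B); last by rewrite andbT subr0.
  by rewrite (mem_set (BA _ (set_mem Bx))) subrr.
- move=> F ndF HF; have mF : measurable (\bigcup_i F i).
    by apply: bigcup_measurable => i _; case: (HF i).
  split=> //; apply/esym.
  have := @dominated_Rintegral (fun n x => k x * \1_(F n) (pi x))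
    (fun x => k x * \1_(\bigcup_i F i) (pi x)) (fun x => `|k x|).
  move=> /(_ _ _ (integrable_norm Ik) _)/cvg_lim <- //.
  - rewrite (_ : (fun n => _) = cst 0) ?lim_cst //.
    by apply/funext => n; case: (HF n).
  - by move=> n; apply: m1; case: (HF n).
  - move=> x Dx; apply: cvgMr.
    have [[N _ FN]|nF] := pselect ((\bigcup_i F i) (pi x)).
      apply: cvg_near_cst; exists N => // n /= Nn.
      rewrite !indicE !mem_set //; first by exists N.
      exact: (subsetPset _ _ (ndF _ _ Nn)).
    rewrite indicE memNset //; apply: cvg_near_cst; apply: nearW => n.
    by rewrite indicE memNset // => Fn; apply: nF; exists n.
  - move=> n x Dx; rewrite normrM; apply: ler_piMr => //.
    by rewrite indicE; case: (_ \in _); rewrite ?normr1 ?normr0.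
Qed.

End Dominated.

Section Fundamental.
Context {R : realType}.
Variable rad : R.
Local Notation T3 := (measurableTypeR R * measurableTypeR R * measurableTypeR R)%type.
Let B : set T3 := eball rad.

(** The explicit radius serves to bound the coefficients of the equilibrium on the
    support: they are only controlled away from the boundary of the ball. *)
Definition bump : set (R * R * R -> R) := [set phi | smooth phi /\
  exists2 r, r < rad & forall x, phi x != 0 -> enorm x <= r].

Lemma bump_mul phi g : bump phi -> smooth g -> bump (fun x => phi x * g x).
Proof.
move=> [sphi [r rR Hr]] sg; split; first exact: smooth_mul.
by exists r => // x; rewrite mulf_eq0 negb_or => /andP[/Hr].
Qed.

Lemma bump_subspace : lin_subspace bump.
Proof.
split.
  split; first exact: smooth_cst.
  by exists (rad - 1) => [|x]; [rewrite ltrBlDr ltrDl|rewrite eqxx].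
move=> c f g [sf [r rR fr]] [sg [s sR gs]]; split.
  by apply: smooth_add => //; apply: smooth_mul => //; exact: smooth_cst.
exists (Num.max r s); first by rewrite gt_max rR sR.
move=> x; rewrite le_max; have [f0|/fr -> //] := eqVneq (f x) 0.
have [g0|/gs ->] := eqVneq (g x) 0; last by rewrite orbT.
by rewrite (_ : (c *: f + g) x = c * f x + g x) // f0 g0 mulr0 addr0 eqxx.
Qed.

Lemma flat1_ge0 (t : R) : 0 <= flat 1 t.
Proof. by rewrite /flat; case: ifP => // _; rewrite hornerC mul1r expR_ge0. Qed.

Lemma flat1_le1 (t : R) : flat 1 t <= 1.
Proof.
rewrite /flat; case: ifP => // t0; rewrite hornerC mul1r -expR0 ler_expR.
by rewrite oppr_le0 invr_ge0 ltW.
Qed.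

Lemma flat1_norm (t : R) : `|flat 1 t| <= 1.
Proof. by rewrite ger0_norm ?flat1_ge0 // flat1_le1. Qed.

Lemma flat1_near1 (t : R) : 0 < t -> `|1 - flat 1 t| <= t^-1.
Proof.
move=> t0; rewrite ger0_norm ?subr_ge0 ?flat1_le1 //.
by rewrite /flat t0 hornerC mul1r; have := expR_ge1Dx (- t^-1); lra.
Qed.

Lemma flat1_cvg1 (a b : R) : 0 < a -> flat 1 (n%:R * a - b) @[n --> \oo] --> (1 : R).
Proof.
move=> a0; apply/cvgrPdist_le => e e0; near=> n.
have e1 : 0 < e^-1 by rewrite invr_gt0.
have ne : e^-1 <= n%:R * a - b.
  rewrite lerBrDr -ler_pdivrMr //; near: n; exact: nbhs_infty_ger.
apply: le_trans (flat1_near1 (lt_le_trans e1 ne)) _.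
by rewrite -[leRHS]invrK lef_pV2 // posrE (lt_le_trans e1).
Unshelve. all: by end_near. Qed.

(** Pointwise bounded limits of smooth functions; these include the indicators
    of half-spaces. *)
Definition step_limit (g : R * R * R -> R) : Prop := exists g_ : nat -> R * R * R -> R,
  [/\ forall n, smooth (g_ n), forall n x, `|g_ n x| <= 1 &
      forall x, g_ n x @[n --> \oo] --> g x].

Lemma step_limit1 : step_limit (fun=> 1).
Proof.
exists (fun _ _ => 1); split=> [n|n x|x]; [exact: smooth_cst|by rewrite normr1|exact: cvg_cst].
Qed.

Lemma step_limit_mul f g : step_limit f -> step_limit g -> step_limit (fun x => f x * g x).
Proof.
move=> [f_ [sf f1 ff]] [g_ [sg g1 gg]]; exists (fun n x => f_ n x * g_ n x); split.
- by move=> n; exact: smooth_mul.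
- by move=> n x; rewrite normrM mulr_ile1.
- by move=> x; exact: cvgM.
Qed.

Lemma step_limit_ray (u : R * R * R -> R) (a : R) : smooth u ->
  step_limit (fun x => \1_(`]a, +oo[%classic : set R) (u x)).
Proof.
move=> su; exists (fun n x => flat 1 (n%:R * (u x - a) - 0)); split.
- move=> n; apply: smooth_flat; rewrite (_ : (fun x => _) = fun x => n%:R * (u x + - a) + 0).
    by repeat (apply: smooth_add || apply: smooth_mul || exact: smooth_cst).
  by apply/funext => x; rewrite subr0 addr0.
- by move=> n x; exact: flat1_norm.
- move=> x; rewrite indicE; have [ax|ax] := ltP a (u x).
    by rewrite mem_set /= ?in_itv /= ?ax //; apply: flat1_cvg1; rewrite subr_gt0.
  rewrite memNset /= ?in_itv /= ?ltNge ?ax //; apply: cvg_near_cst; apply: nearW => n.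
  by rewrite /flat subr0 ltNge mulr_ge0_le0 // subr_le0.
Qed.

Definition rays : set (set R) := [set A | A = setT \/ exists a, A = `]a, +oo[%classic].

Lemma rays_setI : setI_closed rays.
Proof.
move=> A C [->|[a ->]] [->|[c ->]]; rewrite ?setIT ?setTI; [by left|by right; exists c|by right; exists a|].
right; exists (Num.max a c); apply/seteqP; split=> x /=; rewrite !in_itv /= !andbT gt_max.
  by move=> [-> ->].
by move=> /andP[].
Qed.

Lemma rays_measurable : (measurable : set (set R)) = <<s rays >>.
Proof.
apply/seteqP; split.
  rewrite [X in X `<=` _](RGenOInfty.measurableE R).
  apply: smallest_sub; first exact: smallest_sigma_algebra.
  by move=> A [a ->]; apply: sub_sigma_algebra; right; exists a.
apply: smallest_sub; first exact: sigma_algebra_measurable.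
by move=> A [->|[a ->]]; [exact: measurableT|exact: measurable_itv].
Qed.

Lemma step_limit_rays (u : R * R * R -> R) A : smooth u -> rays A ->
  step_limit (fun x => \1_A (u x)).
Proof.
move=> su [->|[a ->]]; last exact: step_limit_ray.
by under eq_fun do rewrite indicE in_setT; exact: step_limit1.
Qed.

(** Bumps that exhaust the ball. *)
Definition cutoff n (x : R * R * R) : R := flat 1 (n%:R * (rad ^+ 2 - dot x x) - 1).

Lemma cutoff_bump n : 0 < rad -> bump (cutoff n).
Proof.
move=> rad0; split.
  apply: smooth_flat.
  rewrite (_ : (fun x => _) = fun x => n%:R * (rad ^+ 2 + (-1) * dot x x) + - 1).
    exact: (smooth_add (smooth_mul (smooth_cst _)
      (smooth_add (smooth_cst _) (smooth_mul (smooth_cst _) smooth_dot))) (smooth_cst _)).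
  by apply/funext => x; rewrite mulN1r.
have n1 : 0 < n.+1%:R^-1 :> R by rewrite invr_gt0.
exists (Num.sqrt (rad ^+ 2 - n.+1%:R^-1)).
  rewrite -[ltRHS](gtr0_norm rad0) -sqrtr_sqr ltr_sqrt ?exprn_gt0 //.
  by rewrite ltrBlDr ltrDl.
move=> x; rewrite /cutoff /flat; case: ifPn; last by rewrite eqxx.
rewrite subr_gt0 => h _; apply: ler_wsqrtr.
have n0 : (0 < n)%N by case: n h {n1} => //; rewrite mul0r ltr10.
have nn : n.+1%:R^-1 <= n%:R^-1 :> R by rewrite lef_pV2 ?posrE ?ltr0n // ler_nat.
have : n%:R^-1 < rad ^+ 2 - dot x x by rewrite -[ltLHS]mulr1 ltr_pdivrMl ?ltr0n.
by move: nn; move: (n.+1%:R^-1) (n%:R^-1) => a b; lra.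
Qed.

Lemma cutoff_norm n x : `|cutoff n x| <= 1. Proof. exact: flat1_norm. Qed.

Lemma cutoff_cvg x : 0 < rad -> B x -> cutoff n x @[n --> \oo] --> (1 : R).
Proof.
move=> rad0 Bx; apply: flat1_cvg1; rewrite subr_gt0 -enorm_sqr.
by rewrite ltr_pXn2r // nnegrE ?enorm_ge0 // ltW.
Qed.

Section Vanishing.
Variable h : R * R * R -> R.
Hypothesis rad0 : 0 < rad.
Hypothesis Ih : leb3.-integrable B (EFin \o h).
Hypothesis hphi : forall phi, bump phi -> \int[leb3]_(x in B) (h x * phi x) = 0.

Let mB : measurable B. Proof. exact: measurable_eball. Qed.

Lemma integrable_mul_bounded (g : R * R * R -> R) M : measurable_fun B g ->
  (forall x, B x -> `|g x| <= M) -> leb3.-integrable B (EFin \o (fun x => h x * g x)).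
Proof.
move=> mg gM; have mh : measurable_fun B h.
  by apply/measurable_EFinP; case/integrableP: Ih.
have IM := integrable_mull mB M (integrable_norm Ih).
apply: (integrable_le mB _ _ IM).
  exact: measurable_funM.
by move=> x Bx; rewrite normrM mulrC ler_wpM2r // gM.
Qed.

(** A bump times a smooth function is a bump; dominated convergence removes the
    cutoff and passes to the limit. *)
Lemma step_limit_vanish g : step_limit g -> \int[leb3]_(x in B) (h x * g x) = 0.
Proof.
move=> [g_ [sg g1 gg]]; have mh : measurable_fun B h.
  by apply/measurable_EFinP; case/integrableP: Ih.
have ms f : smooth f -> measurable_fun B f.
  by move=> sf; apply: measurable_funTS; exact: (continuous_measurable3 (smooth_continuous sf)).
have cb n := cutoff_bump n rad0.
have := @dominated_Rintegral _ _ _ leb3 B mB (fun n x => h x * (cutoff n x * g_ n x))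
  (fun x => h x * g x) (fun x => `|h x|).
move=> /(_ _ _ (integrable_norm Ih) _)/cvg_lim <- //.
- rewrite (_ : (fun n => _) = cst 0) ?lim_cst //.
  by apply/funext => n; apply: hphi; exact: bump_mul.
- move=> n; apply: measurable_funM => //; apply: measurable_funM; apply: ms => //.
  by case: (cb n).
- move=> x Bx; apply: cvgMr; rewrite -[g x]mul1r; apply: cvgM; last exact: gg.
  exact: cutoff_cvg.
- move=> n x Bx; rewrite normrM ler_piMr // normrM mulr_ile1 //.
  exact: cutoff_norm.
Qed.

Lemma indic_norm_le1 (T : Type) (A : set T) x : `|\1_A x : R| <= 1.
Proof. by rewrite indicE; case: (_ \in _); rewrite ?normr1 ?normr0. Qed.

(** Half-lines are replaced by measurable sets in one coordinate [pi] at a time;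
    [k] is the product of the indicators in the other coordinates. *)
Lemma vanish_extend d' (T' : measurableType d') (pi : T3 -> T') (G : set (set T'))
    (k : R * R * R -> R) : measurable_fun setT pi -> setI_closed G -> G setT ->
  measurable = <<s G >> -> measurable_fun B k -> (forall x, `|k x| <= 1) ->
  (forall A, G A -> \int[leb3]_(x in B) (h x * (k x * \1_A (pi x))) = 0) ->
  forall A, measurable A -> \int[leb3]_(x in B) (h x * (k x * \1_A (pi x))) = 0.
Proof.
move=> mpi GI GT mG mk k1 G0 A mA.
have Ik := integrable_mul_bounded mk (fun x _ => k1 x).
have := @Rintegral_lambda_system _ _ _ leb3 B mB _ _ pi G _ mpi GI GT mG Ik.
under eq_Rintegral do rewrite mulrA.
apply=> // C GC; have := G0 C GC.
by under eq_Rintegral do rewrite mulrA.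
Qed.

Lemma measurable_indic_comp (pi : R * R * R -> R) (A : set R) :
  measurable_fun setT pi -> measurable A -> measurable_fun B (fun x => \1_A (pi x) : R).
Proof.
move=> mpi mA; apply: measurable_funTS.
have m1 : measurable_fun setT (\1_A : R -> R) by exact: measurable_indic.
have H := measurableT_comp m1 mpi; exact H.
Qed.

Lemma box_vanish (A1 A2 A3 : set R) : measurable A1 -> measurable A2 -> measurable A3 ->
  \int[leb3]_(x in B) (h x * (\1_A1 x.1.1 * \1_A2 x.1.2 * \1_A3 x.2)) = 0.
Proof.
have mR A : rays A -> measurable A by move=> rA; rewrite rays_measurable; exact: sub_sigma_algebra.
have rT : rays setT by left.
have mI2 (u v : R * R * R -> R) (A C : set R) : measurable_fun setT u -> measurable_fun setT v ->
    measurable A -> measurable C -> measurable_fun B (fun x => \1_A (u x) * \1_C (v x) : R).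
  by move=> mu mv mA mC; apply: measurable_funM; exact: measurable_indic_comp.
have b2 (A C : set R) (u v : R * R * R -> R) x : `|\1_A (u x) * \1_C (v x) : R| <= 1.
  by rewrite normrM mulr_ile1 // indic_norm_le1.
have step0 A C D : rays A -> rays C -> rays D ->
    \int[leb3]_(x in B) (h x * (\1_C x.1.2 * \1_D x.2 * \1_A x.1.1)) = 0.
  move=> rA rC rD; apply: step_limit_vanish.
  by apply: step_limit_mul; [apply: step_limit_mul|]; apply: step_limit_rays => //; constructor.
have step1 A C D : measurable A -> rays C -> rays D ->
    \int[leb3]_(x in B) (h x * (\1_A x.1.1 * \1_D x.2 * \1_C x.1.2)) = 0.
  move=> mA rC rD; under eq_Rintegral do rewrite mulrAC -mulrA [X in _ * X]mulrC.
  move: A mA; apply: (@vanish_extend _ R (fun x => x.1.1) rays (fun x => \1_C x.1.2 * \1_D x.2)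
    (@measurable_x1 R setT) rays_setI rT rays_measurable).
  - exact: (mI2 _ _ _ _ (@measurable_x2 R setT) (@measurable_x3 R setT) (mR _ rC) (mR _ rD)).
  - by move=> x; exact: (b2 C D (fun x => x.1.2) (fun x => x.2)).
  - by move=> A rA; exact: step0.
have step2 A C D : measurable A -> measurable C -> rays D ->
    \int[leb3]_(x in B) (h x * (\1_A x.1.1 * \1_C x.1.2 * \1_D x.2)) = 0.
  move=> mA mC rD; under eq_Rintegral do rewrite mulrAC.
  move: C mC; apply: (@vanish_extend _ R (fun x => x.1.2) rays (fun x => \1_A x.1.1 * \1_D x.2)
    (@measurable_x2 R setT) rays_setI rT rays_measurable).
  - exact: (mI2 _ _ _ _ (@measurable_x1 R setT) (@measurable_x3 R setT) mA (mR _ rD)).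
  - by move=> x; exact: (b2 A D (fun x => x.1.1) (fun x => x.2)).
  - by move=> C rC; exact: step1.
move=> m1 m2; move: A3; apply: (@vanish_extend _ R (fun x => x.2) rays (fun x => \1_A1 x.1.1 * \1_A2 x.1.2)
    (@measurable_x3 R setT) rays_setI rT rays_measurable).
- exact: (mI2 _ _ _ _ (@measurable_x1 R setT) (@measurable_x2 R setT) m1 m2).
- by move=> x; exact: (b2 A1 A2 (fun x => x.1.1) (fun x => x.1.2)).
- by move=> D rD; exact: step2.
Qed.

Lemma rectangle_setI d1 d2 (T1 : measurableType d1) (T2 : measurableType d2) :
  setI_closed [set A `*` C | A in (measurable : set (set T1)) & C in (measurable : set (set T2))].
Proof.
move=> _ _ [A mA [C mC <-]] [A' mA' [C' mC' <-]].
exists (A `&` A'); first exact: measurableI.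
by exists (C `&` C'); [exact: measurableI|rewrite setXI].
Qed.

Lemma rectangle_setT d1 d2 (T1 : measurableType d1) (T2 : measurableType d2) :
  [set A `*` C | A in (measurable : set (set T1)) & C in (measurable : set (set T2))] setT.
Proof. by exists setT => //; exists setT => //; rewrite setXTT. Qed.

Lemma indicX (T1 T2 : Type) (A : set T1) (C : set T2) x :
  \1_(A `*` C) x = \1_A x.1 * \1_C x.2 :> R.
Proof. by rewrite !indicE in_setX; case: (_ \in A); rewrite ?mul1r ?mul0r. Qed.

(** From half-spaces to all measurable sets, one coordinate at a time and then
    from boxes, by monotone classes. *)
Lemma integral_bump_vanish (A : set T3) : measurable A ->
  \int[leb3]_(x in B) (h x * \1_A x) = 0.
Proof.
have cyl (A12 : set (measurableTypeR R * measurableTypeR R)) (A3 : set (measurableTypeR R)) :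
    measurable A12 -> measurable A3 ->
    \int[leb3]_(x in B) (h x * (\1_A3 x.2 * \1_A12 x.1)) = 0.
  move=> + m3; move: A12; apply: (vanish_extend (T' := (measurableTypeR R * measurableTypeR R)%type)
    measurable_fst (@rectangle_setI _ _ _ _) (@rectangle_setT _ _ _ _)
    (measurable_prod_measurableType _ _)).
  - by apply: measurable_indic_comp => //; exact: measurable_x3.
  - by move=> x; exact: indic_norm_le1.
  - move=> _ [A1 m1 [A2 m2 <-]]; under eq_Rintegral do rewrite indicX mulrC.
    rewrite -[RHS](box_vanish m1 m2 m3); apply: eq_Rintegral => x _; ring.
move=> mA; have := @vanish_extend _ T3 id _ (cst 1) (@measurable_id _ _ _)
    (@rectangle_setI _ _ _ _) (@rectangle_setT _ _ _ _)
    (measurable_prod_measurableType _ _).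
move=> /(_ _ _ _ A mA).
under eq_Rintegral do rewrite /= mul1r; apply.
- exact: measurable_cst.
- by move=> x; rewrite normr1.
- move=> _ [A12 m12 [A3 m3 <-]]; under eq_Rintegral do rewrite indicX mul1r mulrC.
  rewrite -[RHS](cyl _ _ m12 m3); apply: eq_Rintegral => x _; ring.
Qed.

(** The integrals over all measurable sets determine an integrable function up to
    a null set. *)
Lemma bump_vanish_ae : {ae leb3, forall x, B x -> h x = 0}.
Proof.
have H : ae_eq leb3 B (EFin \o h) (cst 0%E).
  apply: integral_ae_eq => //.
  move=> E EB mE; rewrite integral0 -(setIidr EB) integral_mkcondr.
  have mE1 : measurable_fun B (\1_E : R * R * R -> R) by exact: measurable_indic.
  have I1 := integrable_mul_bounded mE1 (fun x _ => indic_norm_le1 E x).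
  have := EFin_Rintegral mB I1; rewrite integral_bump_vanish // => H0.
  apply: etrans (esym H0); apply: eq_integral => x _; rewrite patchE /= indicE.
  by case: (_ \in _); rewrite ?mulr1 ?mulr0.
by apply: filterS H => x + Bx => /(_ Bx) [].
Qed.

End Vanishing.
End Fundamental.

(** * Integration by parts against bump functions *)

Section BoundedSupport.
Context d (T : measurableType d) {R : realType} (mu : {measure set T -> \bar R}).

Lemma integrable_bounded_support (A : set T) (g : T -> R) M : measurable A ->
  (mu A < +oo)%E -> measurable_fun setT g -> (forall x, A x -> `|g x| <= M) ->
  (forall x, ~ A x -> g x = 0) -> mu.-integrable setT (EFin \o g).
Proof.
move=> mA Aoo mg gM g0.
have IA : mu.-integrable A (EFin \o g).
  apply: measurable_bounded_integrable => //; first exact: measurable_funTS.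
  exists M; split; first by rewrite num_real.
  by move=> N MN x Ax; exact: le_trans (gM x Ax) (ltW MN).
have := (integrable_mkcond (EFin \o g) mA).1 IA.
rewrite (_ : (EFin \o g) \_ A = EFin \o g) //; apply/funext => x.
by rewrite patchE; have [//|/negP Ax] := ifPn; rewrite /= g0 // => Ax'; apply: Ax; rewrite inE.
Qed.

End BoundedSupport.

Section Divergence.
Context {R : realType}.
Local Notation leb := (@lebesgue_measure R).
Local Notation T3 := (measurableTypeR R * measurableTypeR R * measurableTypeR R)%type.
Implicit Types (psi : R * R * R -> R).

Lemma difference_quotient_line (E : normedModType R) (psi : E -> R) (x v : E)
    (F : R -> R) t : (forall h, F (h + t) = psi (h *: v + x)) ->
  (fun h : R => h^-1 *: ((F \o shift t) (h *: 1) - F t)) =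
  (fun h : R => h^-1 *: ((psi \o shift x) (h *: v) - psi x)).
Proof.
move=> Fpsi.
have Ft : F t = psi x by have := Fpsi 0; rewrite scale0r !add0r.
apply/funext => h; have h1 : h *: (1 : R) = h by exact: mulr1.
by rewrite /= h1 Fpsi Ft.
Qed.

Lemma is_derive_line (E : normedModType R) (psi : E -> R) (x v : E) (F : R -> R) t :
  (forall h, F (h + t) = psi (h *: v + x)) -> derivable psi x v ->
  is_derive t 1 F ('D_v psi x).
Proof.
move=> /difference_quotient_line Q dpsi.
by split; [rewrite /derivable Q|rewrite /derive Q].
Qed.

(** The converse of [is_derive_line]: a directional derivative can be computed on
    the line. *)
Lemma is_derive_of_line (E : normedModType R) (psi : E -> R) (x v : E) (F : R -> R) t l :
  (forall h, F (h + t) = psi (h *: v + x)) -> is_derive t (1 : R) F l ->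
  is_derive x v psi l.
Proof.
move=> /difference_quotient_line Q [dF <-].
by split; [rewrite /derivable -Q|rewrite /derive Q].
Qed.

Lemma integral_derivative_line (F f : R -> R) (M : R) : 0 < M ->
  (forall t : R, is_derive t (1 : R) F (f t)) -> continuous f ->
  (forall t, M <= `|t| -> F t = 0) -> (forall t, M < `|t| -> f t = 0) ->
  (\int[leb]_t (f t)%:E = 0)%E.
Proof.
move=> M0 dF cf F0 f0.
have cF : continuous F.
  by move=> t; apply/differentiable_continuous/derivable1_diffP; case: (dF t).
have -> : (\int[leb]_t (f t)%:E = \int[leb]_(t in `[(- M)%R, M]) (f t)%:E)%E.
  rewrite [RHS]integral_mkcond; apply: eq_integral => t _; rewrite patchE.
  have [//|] := ifPn; rewrite notin_setE /= in_itv /= -ler_norml => /negP.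
  by rewrite -ltNge => /f0 ->.
rewrite (@continuous_FTC2 _ f F) //.
- by rewrite !F0 ?normrN ?ger0_norm ?(ltW M0) // sube0.
- lra.
- exact: continuous_subspaceT.
- split; first by move=> t _; case: (dF t).
    exact/cvg_at_right_filter/cF.
  exact/cvg_at_left_filter/cF.
- by move=> t _; rewrite derive1E; case: (dF t).
Qed.

Section Vanish.
Variables (psi g : R * R * R -> R) (r : R).
Hypothesis cg : continuous g.
Hypothesis psi0 : forall x, r < enorm x -> psi x = 0.
Hypothesis g0 : forall x, r < enorm x -> g x = 0.

Let M : R := `|r| + 1.
Let M0 : 0 < M. Proof. by rewrite /M ltr_wpDl. Qed.
Let rM : r < M. Proof. by rewrite /M; have := ler_norm r; lra. Qed.

Let out (h : R * R * R -> R) : (forall x, r < enorm x -> h x = 0) ->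
  [/\ forall x, M <= `|x.1.1| -> h x = 0, forall x, M <= `|x.1.2| -> h x = 0 &
      forall x, M <= `|x.2| -> h x = 0].
Proof.
move=> h0; split=> x Mx; apply: h0; apply: (lt_le_trans rM); apply: le_trans Mx _;
  [exact: norm_x1_le|exact: norm_x2_le|exact: norm_x3_le].
Qed.

Let mg : measurable_fun setT (g : T3 -> R).
Proof. exact: continuous_measurable3. Qed.

Let bg : exists C, forall x, cube M x -> `|g x| <= C.
Proof. by have [C _ gC] := continuous_bounded_cube M cg; exists C. Qed.

Let gcube x : ~ cube M x -> g x = 0.
Proof.
move=> nx; apply: g0; rewrite ltNge; apply/negP => xr; apply: nx.
by apply: enorm_le_cube; apply: le_trans xr (ltW rM).
Qed.

Let Ig : leb3_sf.-integrable setT (EFin \o g).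
Proof.
have [C gC] := bg.
apply: (@integrable_bounded_support _ _ _ leb3_sf (cube M) g C) => //.
  exact: measurable_cube.
rewrite -leb3E leb3_cube ?ltW //; exact: ltry.
Qed.

Let cline (F : R -> R * R * R) : continuous F -> continuous (g \o F).
Proof. by move=> cF t; apply: continuous_comp; [exact: cF|exact: cg]. Qed.

(** Fubini with the differentiated variable innermost, where the fundamental
    theorem of calculus gives 0; the other two coordinates need the two orders of
    integration in the plane. *)
Lemma integral_partial3 : (forall x : R * R * R, is_derive x.2 (1 : R) (fun t : R => psi (x.1, t)) (g x)) ->
  (\int[leb3]_x (g x)%:E = 0)%E.
Proof.
move=> dpsi; have [_ _ p3] := out psi0; have [_ _ q3] := out g0.
rewrite leb3E -(integral12_prod_meas1 Ig).
apply: integral0_eq => -[x1 x2] _.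
apply: (@integral_derivative_line (fun t => psi (x1, x2, t)) (fun t => g (x1, x2, t)) M) => //.
- by move=> t; exact: (dpsi (x1, x2, t)).
- apply: (cline (F := fun t => (x1, x2, t))) => t.
  by apply: (@cvg_pair _ _ _ (nbhs t) (nbhs (x1, x2)) (nbhs t)); [exact: cvg_cst|exact: cvg_id].
- by move=> t Mt; exact: (p3 (x1, x2, t)).
- by move=> t Mt; apply: (q3 (x1, x2, t)); exact: ltW.
Qed.

Let Ig2 x3 : leb2.-integrable setT (EFin \o (fun y => g (y, x3))).
Proof.
have [C gC] := bg.
have [x3M|x3M] := leP `|x3| M; last first.
  rewrite (_ : _ \o _ = cst 0%E); first exact: integrable0.
  apply/funext => y /=; congr EFin; apply: gcube => /cubeP[_ _ /= h].
  by rewrite leNgt x3M in h.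
apply: (@integrable_bounded_support _ _ _ leb2 (`[-M, M] `*` `[-M, M]) _ C).
- exact: measurableX.
- have mI : measurable (`[- M, M] : set (measurableTypeR R)) by exact: measurable_itv.
  apply: (@le_lt_trans _ _ (leb [set` `[(- M)%R, M]] * leb [set` `[(- M)%R, M]])%E).
    by rewrite le_eqVlt; apply/orP; left; apply/eqP; exact: (product_measure1E _ _ mI mI).
  rewrite !lebesgue_measure_itv /=.
  by case: ifPn => _; rewrite ?mule0 // -!EFinB -EFinM ltry.
- exact: (measurableT_comp mg (measurable_pair2 x3)).
- move=> y [y1 y2]; apply: gC; split=> //=.
  by rewrite in_itv /= -ler_norml.
- move=> y ny; apply: gcube => -[yc _]; exact: ny.
Qed.

Lemma integral_partial2 :
  (forall x : R * R * R, is_derive x.1.2 (1 : R) (fun t : R => psi (x.1.1, t, x.2)) (g x)) ->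
  (\int[leb3]_x (g x)%:E = 0)%E.
Proof.
move=> dpsi; have [_ p2 _] := out psi0; have [_ q2 _] := out g0.
rewrite leb3E -(integral21_prod_meas1 Ig).
apply: integral0_eq => x3 _.
apply: etrans (esym (integral12_prod_meas1 (Ig2 x3))) _.
apply: integral0_eq => x1 _.
apply: (@integral_derivative_line (fun t => psi (x1, t, x3)) (fun t => g (x1, t, x3)) M) => //.
- by move=> t; exact: (dpsi (x1, t, x3)).
- apply: (cline (F := fun t => (x1, t, x3))) => t.
  apply: (@cvg_pair _ _ _ (nbhs t) (nbhs (x1, t)) (nbhs x3)); last exact: cvg_cst.
  by apply: (@cvg_pair _ _ _ (nbhs t) (nbhs x1) (nbhs t)); [exact: cvg_cst|exact: cvg_id].
- by move=> t Mt; exact: (p2 (x1, t, x3)).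
- by move=> t Mt; apply: (q2 (x1, t, x3)); exact: ltW.
Qed.

Lemma integral_partial1 :
  (forall x : R * R * R, is_derive x.1.1 (1 : R) (fun t : R => psi (t, x.1.2, x.2)) (g x)) ->
  (\int[leb3]_x (g x)%:E = 0)%E.
Proof.
move=> dpsi; have [p1 _ _] := out psi0; have [q1 _ _] := out g0.
rewrite leb3E -(integral21_prod_meas1 Ig).
apply: integral0_eq => x3 _.
apply: etrans (esym (integral21_prod_meas1 (Ig2 x3))) _.
apply: integral0_eq => x2 _.
apply: (@integral_derivative_line (fun t => psi (t, x2, x3)) (fun t => g (t, x2, x3)) M) => //.
- by move=> t; exact: (dpsi (t, x2, x3)).
- apply: (cline (F := fun t => (t, x2, x3))) => t.
  apply: (@cvg_pair _ _ _ (nbhs t) (nbhs (t, x2)) (nbhs x3)); last exact: cvg_cst.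
  by apply: (@cvg_pair _ _ _ (nbhs t) (nbhs t) (nbhs x2)); [exact: cvg_id|exact: cvg_cst].
- by move=> t Mt; exact: (p1 (t, x2, x3)).
- by move=> t Mt; apply: (q1 (t, x2, x3)); exact: ltW.
Qed.

End Vanish.
End Divergence.

Section ByParts.
Context {R : realType}.
Local Notation T3 := (measurableTypeR R * measurableTypeR R * measurableTypeR R)%type.
Variable rad : R.
Let B : set T3 := eball rad.
Let mB : measurable B. Proof. exact: measurable_eball. Qed.

Lemma continuous_bounded_eball (f : R * R * R -> R) : continuous f ->
  exists2 M, 0 <= M & forall x, B x -> `|f x| <= M.
Proof.
move=> cf; have [M M0 fM] := continuous_bounded_cube rad cf; exists M => // x Bx.
exact/fM/eball_cube.
Qed.

Lemma continuous_integrable_eball (f : R * R * R -> R) : continuous f ->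
  leb3.-integrable B (EFin \o f).
Proof.
move=> cf; have [M _ fM] := continuous_bounded_eball cf.
apply: measurable_bounded_integrable => //; first exact: leb3_eball_fin.
  by apply: measurable_funTS; exact: continuous_measurable3.
exists M; split; first by rewrite num_real.
by move=> N MN x Bx; exact: le_trans (fM x Bx) (ltW MN).
Qed.

Lemma bump_derive_eq0 (w : R * R * R -> R) r x v :
  (forall x, w x != 0 -> enorm x <= r) -> r < enorm x -> 'D_v w x = 0.
Proof.
move=> wr rx; rewrite -(derive_cst (0 : R) x v); apply: near_eq_derive.
have op : open [set y : R * R * R | r < enorm y].
  apply: (open_comp (f := @enorm R) (D := [set t | r < t])); last exact: open_gt.
  by move=> y _; exact: continuous_enorm.
have : nbhs x [set y : R * R * R | r < enorm y] by exact: open_nbhs_nbhs.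
apply: filterS => y /= ry; apply/eqP; apply: contraTT ry => wy.
by rewrite -leNgt wr.
Qed.

Lemma scale_add3 (h a b c x y z : R) :
  h *: (a, b, c) + (x, y, z) = (h * a + x, h * b + y, h * c + z).
Proof. by []. Qed.

Definition coordinate_vector : set (R * R * R) :=
  [set v | [\/ v = (1, 0, 0), v = (0, 1, 0) | v = (0, 0, 1)]].

(** The product [w phi] has compact support, so that its derivative integrates
    to 0. *)
Lemma bump_by_parts (w phi : R * R * R -> R) v : coordinate_vector v -> bump rad w ->
  (forall x, derivable phi x v) -> continuous phi -> continuous ('D_v phi) ->
  \int[leb3]_(x in B) (w x * 'D_v phi x) = - \int[leb3]_(x in B) ('D_v w x * phi x).
Proof.
move=> cv [sw [r rR wr]] dphi cphi cdphi.
have dw x : derivable w x v by exact/diff_derivable/smooth_differentiable.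
have w0 x : r < enorm x -> w x = 0.
  by move=> rx; apply/eqP; apply: contraTT rx => wx; rewrite -leNgt wr.
pose psi x := w x * phi x.
pose g x := w x * 'D_v phi x + phi x * 'D_v w x.
have cw := smooth_continuous sw; have cdw := smooth_continuous (smooth_derive v sw).
have c1 : continuous (fun x => w x * 'D_v phi x).
  by move=> x; apply: cvgM; [exact: cw|exact: cdphi].
have c2 : continuous (fun x => phi x * 'D_v w x).
  by move=> x; apply: cvgM; [exact: cphi|exact: cdw].
have cg : continuous g by move=> x; apply: cvgD; [exact: c1|exact: c2].
have dpsi x : derivable psi x v by exact: derivableM.
have gE x : 'D_v psi x = g x by rewrite deriveM.
have psi0 x : r < enorm x -> psi x = 0 by move=> rx; rewrite /psi w0 ?mul0r.
have g0 x : r < enorm x -> g x = 0.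
  by move=> rx; rewrite /g w0 // (bump_derive_eq0 v wr rx) mul0r mulr0 addr0.
have I0 : (\int[leb3]_x (g x)%:E = 0)%E.
  case: cv => vE; [apply: (@integral_partial1 _ psi g r)|apply: (@integral_partial2 _ psi g r)|
    apply: (@integral_partial3 _ psi g r)] => // -[[x1 x2] x3] /=; rewrite -gE;
    apply: is_derive_line => // h; congr psi; rewrite vE;
    by rewrite scale_add3 ?mulr1 ?mulr0 ?add0r.
have IB : \int[leb3]_(x in B) g x = 0.
  rewrite /Rintegral (_ : integral _ _ _ = 0)%E // -[RHS]I0 integral_mkcond.
  apply: eq_integral => x _; rewrite patchE; have [//|] := ifPn.
  rewrite notin_setE => nBx /=; congr EFin; apply/esym/g0.
  by apply: (lt_le_trans rR); rewrite leNgt; apply/negP.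
move: IB; rewrite /g RintegralD //.
- move/eqP; rewrite addr_eq0 => /eqP ->; congr (- _); apply: eq_Rintegral => x _.
  by rewrite mulrC.
- exact: continuous_integrable_eball.
- exact: continuous_integrable_eball.
Qed.

End ByParts.

(** * The Newton kernel on a ball *)

Section NewtonKernel.
Context {R : realType}.
Local Notation T3 := (measurableTypeR R * measurableTypeR R * measurableTypeR R)%type.
Variable rad : R.
Let B : set T3 := eball rad.
Let mB : measurable B. Proof. exact: measurable_eball. Qed.

Definition kern (x y : R * R * R) : R := (enorm (x - y))^-1.

Lemma measurable_kern2 : measurable_fun setT (fun z : T3 * T3 => kern z.1 z.2).
Proof.
rewrite (_ : (fun z : T3 * T3 => _) =
  (fun z : T3 * T3 => (enorm (z.1.1.1 - z.2.1.1, z.1.1.2 - z.2.1.2, z.1.2 - z.2.2)) `^ (-1))); last first.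
  by apply/funext => z; rewrite powR_inv1 ?enorm_ge0.
have m1 (u : T3 -> R) : measurable_fun setT u ->
    measurable_fun setT (fun z : T3 * T3 => u z.1 - u z.2).
  move=> mu; apply: measurable_funB.
    exact: (measurableT_comp mu measurable_fst).
  exact: (measurableT_comp mu measurable_snd).
have d1 := m1 _ (@measurable_x1 R setT).
have d2 := m1 _ (@measurable_x2 R setT).
have d3 := m1 _ (@measurable_x3 R setT).
have mp := @measurable_powR R (-1).
apply: (measurableT_comp mp).
have me : measurable_fun setT (@enorm R : T3 -> R) by exact: measurable_enorm.
apply: (measurableT_comp me).
apply: (measurable_fun_pair (T1 := (measurableTypeR R * measurableTypeR R)%type) (T2 := measurableTypeR R)).
  exact: (measurable_fun_pair (T1 := measurableTypeR R) (T2 := measurableTypeR R)).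
exact: d3.
Qed.

Lemma measurable_kern x : measurable_fun setT (kern x : T3 -> R).
Proof.
have H := @measurable_pair1 _ _ T3 T3 x.
by have := measurableT_comp measurable_kern2 H.
Qed.

Lemma kernC x y : kern x y = kern y x.
Proof.
by rewrite /kern /enorm; congr (Num.sqrt _)^-1; rewrite /dot /=; ring.
Qed.

Lemma kern_ge0 x y : 0 <= kern x y. Proof. by rewrite invr_ge0 enorm_ge0. Qed.

(** The cube of half-side [2^-j] about [x]. *)
Definition shell (x : R * R * R) (j : nat) : set T3 :=
  ([set` `[x.1.1 - 2 ^- j, x.1.1 + 2 ^- j]] `*` [set` `[x.1.2 - 2 ^- j, x.1.2 + 2 ^- j]])
  `*` [set` `[x.2 - 2 ^- j, x.2 + 2 ^- j]].

Lemma measurable_shell x j : measurable (shell x j).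
Proof. by apply: measurableX; [apply: measurableX|]; exact: measurable_itv. Qed.

Lemma leb3_shell x j : leb3 (shell x j) = (8 * (8 ^+ j)^-1)%:E.
Proof.
have i0 : 0 < 2 ^- j :> R by rewrite invr_gt0 exprn_gt0.
rewrite leb3_box; [|exact: measurable_itv|exact: measurable_itv|exact: measurable_itv].
rewrite !lebesgue_measure_itv /= !lte_fin.
do 3![rewrite ifT; last by lra]; rewrite -!EFinM; congr EFin.
rewrite (_ : 8 ^+ j = (2 ^+ j) ^+ 3); last first.
  by rewrite -exprM mulnC exprM; congr (_ ^+ _); ring.
have b0 : 2 ^+ j != 0 :> R by rewrite expf_neq0 // pnatr_eq0.
by move: (2 ^+ j) b0 => b b0; field.
Qed.

(** The sup-norm distance [s] of [x] and [y] lies in some dyadic interval, and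
    the Euclidean distance is at least [s]. *)
Lemma kern_sqr_dyadic x y :
  ((kern x y ^+ 2)%:E <= 1 + \sum_(j <oo) (4 ^+ j.+1 * \1_(shell x j) y)%:E)%E.
Proof.
have t0 j : (0 <= (4 ^+ j.+1 * \1_(shell x j) y)%:E :> \bar R)%E.
  by rewrite lee_fin mulr_ge0 ?exprn_ge0.
have S0 : (0 <= \sum_(j <oo) (4 ^+ j.+1 * \1_(shell x j) y)%:E :> \bar R)%E.
  by apply: nneseries_ge0 => j _ _.
pose z := x - y; pose s := Num.max (Num.max `|z.1.1| `|z.1.2|) `|z.2|.
have sz : s <= enorm z.
  by rewrite !ge_max norm_x1_le norm_x2_le norm_x3_le.
have [s1|s1] := ltP 1 s.
  apply: (@le_trans _ _ 1%E); last by rewrite leeDl.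
  rewrite lee_fin expr_le1 ?kern_ge0 // invf_le1; first exact: le_trans (ltW s1) sz.
  exact: lt_le_trans ltr01 (le_trans (ltW s1) sz).
have s0 : 0 <= s by rewrite !le_max normr_ge0.
have [z0|z0] := eqVneq s 0.
  have : `|z.1.1| <= 0 /\ `|z.1.2| <= 0 /\ `|z.2| <= 0.
    by rewrite -z0 /s !le_max !lexx ?orbT.
  rewrite !normr_le0 => -[/eqP z1 [/eqP z2 /eqP z3]].
  rewrite /kern -/z /enorm /dot z1 z2 z3 mulr0 !addr0 sqrtr0 invr0 expr0n /=.
  by apply: adde_ge0.
have {}s0 : 0 < s by rewrite lt_neqAle eq_sym z0.
have ex : exists j, 2 ^- j.+1 < s.
  exists (Num.bound s^-1); rewrite invf_plt ?posrE ?exprn_gt0 //.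
  exact: upper_nthrootP (leqnSn _).
case: (ex_minnP ex) => j js jmin.
have sj : s <= 2 ^- j.
  case: j jmin {js} => [|j] jmin; first by rewrite expr0 invr1.
  by rewrite leNgt; apply/negP => /jmin; rewrite ltnn.
rewrite (nneseriesD1 (n := j)) //.
apply: (@le_trans _ _ (4 ^+ j.+1)%:E).
  rewrite lee_fin -[leRHS]invrK exprVn lef_pV2 ?posrE ?invr_gt0 ?exprn_gt0 //.
    apply: (@le_trans _ _ (s ^+ 2)).
      rewrite (_ : 4 = 2 ^+ 2); last by ring.
      by rewrite -exprM mulnC exprM -exprVn ler_pXn2r ?nnegrE ?invr_ge0 ?exprn_ge0 // ltW.
    by rewrite ler_pXn2r // nnegrE ?(ltW s0) ?enorm_ge0.
  exact: lt_le_trans s0 sz.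
rewrite indicE mem_set ?mulr1; last first.
  have zj : `|z.1.1| <= 2 ^- j /\ `|z.1.2| <= 2 ^- j /\ `|z.2| <= 2 ^- j.
    by split; [|split]; apply: le_trans sj; rewrite /s !le_max !lexx ?orbT.
  move: zj; rewrite /shell /z /= !ler_norml !in_itv /= => -[/andP[a b] [/andP[c d] /andP[e f]]].
  by split; [split|]; apply/andP; split; lra.
rewrite addeCA leeDl // adde_ge0 //; apply: nneseries_ge0 => k _ _; exact: t0.
Qed.

(** The singularity [|x - y|^-2] is integrable in dimension three: shell [j]
    contributes [4^(j+1) 8^(1-j)], a geometric series with sum 64. *)
Lemma kern_sqr_integral : exists2 K, 0 <= K & forall x,
  (\int[leb3]_(y in B) (kern x y ^+ 2)%:E <= K%:E)%E.
Proof.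
have Bfin := leb3_eball_fin rad.
have Bf : leb3 B \is a fin_num by rewrite ge0_fin_numE.
exists (fine (leb3 B) + 64); first by rewrite addr_ge0 ?fine_ge0.
move=> x.
pose t j y : \bar R := (4 ^+ j.+1 * \1_(shell x j) y)%:E.
have t0 j y : (0 <= t j y)%E by rewrite lee_fin mulr_ge0 ?exprn_ge0.
have mt j : measurable_fun B (t j).
  apply/measurable_EFinP; apply: measurable_funM; first exact: measurable_cst.
  apply: measurable_indic; exact: measurable_shell.
have mS : measurable_fun B (fun y => \sum_(j <oo) t j y)%E.
  by apply: ge0_emeasurable_sum => [j y _ _|j _]; [exact: t0|exact: mt].
have S0 y : (0 <= \sum_(j <oo) t j y)%E by apply: nneseries_ge0 => j _ _.
apply: (@le_trans _ _ (\int[leb3]_(y in B) (1 + \sum_(j <oo) t j y))%E).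
  apply: ge0_le_integral => //.
  - by move=> y _; rewrite lee_fin sqr_ge0.
  - apply/measurable_EFinP/measurable_funX; apply: measurable_funTS.
    exact: measurable_kern.
  - exact: emeasurable_funD.
  - by move=> y _; exact: kern_sqr_dyadic.
rewrite ge0_integralD // integral_cst // mul1e EFinD fineK // leeD2l //.
rewrite integral_nneseries //.
apply: (@le_trans _ _ (\sum_(j <oo) (64 / (2 ^ (j + 1))%:R)%:E)%E).
  apply: lee_nneseries => [j _ _|j _]; first by apply: integral_ge0 => y _; exact: t0.
  rewrite /t; under eq_integral do rewrite EFinM.
  rewrite ge0_integralZl //; last first.
    by apply/measurable_EFinP; apply: measurable_indic; exact: measurable_shell.
  rewrite integral_indic //; last exact: measurable_shell.
  apply: (@le_trans _ _ ((4 ^+ j.+1)%:E * leb3 (shell x j))%E).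
    apply: lee_wpmul2l; first by rewrite lee_fin exprn_ge0.
    apply: le_measure; rewrite ?inE; [|exact: measurable_shell|exact: subIsetl].
    by apply: measurableI => //; exact: measurable_shell.
  rewrite leb3_shell -EFinM lee_fin natrX addn1 le_eqVlt; apply/orP; left; apply/eqP.
  rewrite (_ : 8 ^+ j = 4 ^+ j * 2 ^+ j); last by rewrite -exprMn; congr (_ ^+ _); ring.
  have a0 : 4 ^+ j != 0 :> R by rewrite expf_neq0 // pnatr_eq0.
  have b0 : 2 ^+ j != 0 :> R by rewrite expf_neq0 // pnatr_eq0.
  rewrite !exprS; move: (4 ^+ j) (2 ^+ j) a0 b0 => a b a0 b0; field.
  by rewrite a0 b0.
have /cvg_lim := @cvg_geometric_eseries_half R 64 0.
by rewrite /eseries => -> //; rewrite expr0 divr1.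
Qed.

Let one : R * R * R -> R := cst 1.
Let m1 : measurable_fun B (one : T3 -> R). Proof. exact: measurable_cst. Qed.
Let one0 x : B x -> 0 < one x. Proof. by move=> _; exact: ltr01. Qed.

Definition L2ball : set (R * R * R -> R) := wL2 leb3 B one.
Definition ip_ball : (R * R * R -> R) -> (R * R * R -> R) -> R := wip leb3 B one.

Lemma ip_ballE f g : ip_ball f g = \int[leb3]_(x in B) (f x * g x).
Proof. by apply: eq_Rintegral => x _; rewrite mul1r. Qed.

Lemma ip_ball_form : symm_bilinear_form L2ball ip_ball.
Proof. exact: wip_form. Qed.

Lemma ip_ball_ge0 f : 0 <= ip_ball f f. Proof. exact: wip_ge0. Qed.

Lemma ip_ball_complete : ip_complete L2ball ip_ball.
Proof. exact: (wip_complete mB m1 one0). Qed.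

Lemma L2ball_measurable h : L2ball h -> measurable_fun B (h : T3 -> R).
Proof. by case. Qed.

Lemma L2ball_mul_integrable f g : L2ball f -> L2ball g ->
  leb3.-integrable B (EFin \o (fun x => f x * g x)).
Proof.
move=> Lf Lg; have := wL2_mul_integrable mB m1 one0 Lf Lg.
by apply: eq_integrable => // x _; rewrite /= mul1r.
Qed.

Lemma bounded_L2ball (f : R * R * R -> R) M : measurable_fun B (f : T3 -> R) ->
  (forall x, B x -> `|f x| <= M) -> L2ball f.
Proof.
move=> mf fM; split => //.
apply: (@le_lt_trans _ _ (\int[leb3]_(x in B) (cst (M ^+ 2)%:E x))%E).
  apply: ge0_le_integral => //.
  - by move=> x Bx; rewrite lee_fin mulr_ge0 ?sqr_ge0.
  - by apply/measurable_EFinP; apply: measurable_funM => //; exact: measurable_funX.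
  - move=> x Bx; rewrite lee_fin mul1r -(real_normK (num_real (f x))).
    by rewrite ler_pXn2r ?nnegrE ?fM // (le_trans _ (fM x Bx)).
rewrite integral_cst // lte_mul_pinfty ?lee_fin ?sqr_ge0 //.
exact: leb3_eball_fin.
Qed.

Lemma L2ball_integrable h : L2ball h -> leb3.-integrable B (EFin \o h).
Proof.
move=> Lh; have L1 : L2ball (cst 1).
  by apply: (@bounded_L2ball _ 1) => // x _; rewrite normr1.
by apply: eq_integrable (L2ball_mul_integrable Lh L1) => // x _; rewrite /= mulr1.
Qed.

Lemma kern_L2ball : exists2 K, 0 <= K & forall x, L2ball (kern x) /\
  ip_ball (kern x) (kern x) <= K.
Proof.
have [K K0 kK] := kern_sqr_integral; exists K => // x.
have Lx : L2ball (kern x).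
  split; first by apply: measurable_funTS; exact: measurable_kern.
  apply: le_lt_trans (ltry K); apply: le_trans (kK x).
  by rewrite le_eqVlt; apply/orP; left; apply/eqP/eq_integral => y _; rewrite mul1r.
split=> //; rewrite -lee_fin /ip_ball (wip_sqr mB m1 one0 Lx).
by apply: le_trans (kK x); rewrite le_eqVlt; apply/orP; left; apply/eqP/eq_integral => y _; rewrite mul1r.
Qed.

(** The extension by 0 of [h] moves to the integrand, after which the potential is
    an inner product with the kernel. *)
Lemma newton_kernel_patch h x : newton_kernel (eball rad) h x =
  (fun y => h y * kern x y) \_ B.
Proof.
by apply/funext => y; rewrite /newton_kernel !patchE; case: ifP => // _; rewrite mul0r.
Qed.

Lemma newton_kernel_integrable h x : L2ball h ->
  leb3.-integrable setT (fun y => (newton_kernel (eball rad) h x y)%:E).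
Proof.
move=> Lh; have [K _ /(_ x) [Lx _]] := kern_L2ball.
have := (integrable_mkcond _ mB).1 (L2ball_mul_integrable Lh Lx).
apply: eq_integrable => // y _; rewrite newton_kernel_patch /= !patchE.
by case: ifP.
Qed.

Lemma newtonE h x : newton (eball rad) h x = (4 * pi)^-1 * ip_ball h (kern x).
Proof.
rewrite /newton; congr (_ * _); rewrite ip_ballE [RHS]Rintegral_mkcond.
by rewrite -newton_kernel_patch.
Qed.

Lemma newton_bounded h : L2ball h -> exists M, forall x, `|newton (eball rad) h x| <= M.
Proof.
move=> Lh; have [K K0 kK] := kern_L2ball.
exists ((4 * pi)^-1 * Num.sqrt (ip_ball h h * K)) => x.
rewrite newtonE normrM ger0_norm; last by rewrite invr_ge0 mulr_ge0 ?pi_ge0.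
rewrite ler_wpM2l ?invr_ge0 ?mulr_ge0 ?pi_ge0 // -sqrtr_sqr ler_wsqrtr //.
have [Lx xK] := kK x.
apply: le_trans (form_CS ip_ball_form (fun f _ => ip_ball_ge0 f) Lh Lx) _.
by rewrite ler_wpM2l // ip_ball_ge0.
Qed.

Let F (g h : R * R * R -> R) (z : T3 * T3) : R :=
  (g \_ B) z.1 * ((h \_ B) z.2 * kern z.1 z.2).

Let mF g h : L2ball g -> L2ball h -> measurable_fun setT (EFin \o F g h).
Proof.
move=> [mg _] [mh _]; apply/measurable_EFinP.
have mgB : measurable_fun setT (g \_ B : T3 -> R) by apply/(measurable_restrictT _ mB).
have mhB : measurable_fun setT (h \_ B : T3 -> R) by apply/(measurable_restrictT _ mB).
apply: measurable_funM; first exact: (measurableT_comp mgB measurable_fst).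
apply: measurable_funM; last exact: measurable_kern2.
exact: (measurableT_comp mhB measurable_snd).
Qed.

Let patch_norm (g : R * R * R -> R) x : `|(g \_ B) x| = ((fun y => `|g y|) \_ B) x.
Proof. by rewrite !patchE; case: ifP; rewrite ?normr0. Qed.

(** The potential of [|h|] is bounded and [g] is integrable. *)
Let IF g h : L2ball g -> L2ball h ->
  (leb3_sf \x leb3_sf)%E.-integrable setT (EFin \o F g h).
Proof.
move=> Lg Lh; apply/(integrable12ltyP leb3_sf leb3_sf (mF Lg Lh)).
have Lnh : L2ball (fun y => `|h y|).
  have [mh h2] := Lh; split; first exact: measurableT_comp.
  by apply: le_lt_trans h2; rewrite le_eqVlt; apply/orP; left; apply/eqP/eq_integral => y _; rewrite real_normK ?num_real.
have [M nM] := newton_bounded Lnh.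
have inner x : (\int[leb3_sf]_y `|(EFin \o F g h) (x, y)| <= (`|(g \_ B) x| * (4 * pi * M))%:E)%E.
  have In := newton_kernel_integrable x Lnh.
  have E y : (`|(EFin \o F g h) (x, y)| =
      `|(g \_ B) x|%:E * (newton_kernel (eball rad) (fun y => `|h y|) x y)%:E)%E.
    rewrite newton_kernel_patch /F /= -EFinM; congr EFin.
    rewrite !normrM (ger0_norm (kern_ge0 _ _)); congr (_ * _).
    by rewrite !patchE; case: ifP => // _; rewrite normr0 mul0r.
  under eq_integral do rewrite E.
  rewrite ge0_integralZl //; last 2 first.
  - exact: measurable_int In.
  - by move=> y _; rewrite newton_kernel_patch lee_fin patchE; case: ifP => // _; rewrite mulr_ge0 ?kern_ge0.
  rewrite -(EFin_Rintegral measurableT In) -EFinM lee_fin ler_wpM2l //.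
  have -> : \int[leb3_sf]_y newton_kernel (eball rad) (fun y => `|h y|) x y =
      4 * pi * newton (eball rad) (fun y => `|h y|) x.
    by rewrite /newton mulrA divff ?mul1r // mulf_neq0 // gt_eqF // pi_gt0.
  rewrite ler_wpM2l ?mulr_ge0 ?pi_ge0 //.
  exact: le_trans (ler_norm _) (nM x).
have mgB : measurable_fun setT (g \_ B : T3 -> R).
  by have [mg _] := Lg; apply/(measurable_restrictT _ mB).
have mb : measurable_fun setT (fun x : T3 => `|(g \_ B) x| * (4 * pi * M)).
  by apply: measurable_funM => //; exact: measurableT_comp.
apply: (@le_lt_trans _ _ (\int[leb3_sf]_x (`|(g \_ B) x| * (4 * pi * M))%:E)%E).
  apply: ge0_le_integral => //.
  - by move=> x _; exact: integral_ge0.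
  - have mabs : measurable_fun setT (abse \o (EFin \o F g h)) by exact: measurableT_comp (mF Lg Lh).
    exact: (measurable_fun_fubini_tonelli_F (m2 := leb3_sf) _ mabs (fun z => abse_ge0 _)).
  - exact/measurable_EFinP.
have Ig := integrable_norm (L2ball_integrable Lg).
have Igm := (integrable_mkcond _ mB).1 (integrable_mull mB (4 * pi * M) Ig).
have /integrableP[_] := Igm; apply: le_lt_trans.
rewrite le_eqVlt; apply/orP; left; apply/eqP/eq_integral => x _.
have M0 : 0 <= 4 * pi * M by rewrite !mulr_ge0 ?pi_ge0 // (le_trans _ (nM 0)).
rewrite patch_norm !patchE /=; case: ifP => _; last by rewrite mul0r abse0.
by congr EFin; rewrite normrM normr_id (ger0_norm M0) mulrC.
Qed.

Let pairing (g h : R * R * R -> R) (x : T3) : R := g x * (4 * pi * newton (eball rad) h x).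

Let innerF g h x : L2ball h ->
  (\int[leb3_sf]_y (F g h (x, y))%:E)%E = ((pairing g h \_ B) x)%:E.
Proof.
move=> Lh; have In := newton_kernel_integrable x Lh.
have E y : ((F g h (x, y))%:E = ((g \_ B) x)%:E * (newton_kernel (eball rad) h x y)%:E)%E.
  rewrite newton_kernel_patch /F /= -EFinM; congr (_ * _)%:E.
  by rewrite !patchE; case: ifP => // _; rewrite mul0r.
under eq_integral do rewrite E.
rewrite integralZl // -(EFin_Rintegral measurableT In) -EFinM; congr EFin.
have -> : \int[leb3_sf]_y newton_kernel (eball rad) h x y = 4 * pi * newton (eball rad) h x.
  by rewrite /newton mulrA divff ?mul1r // mulf_neq0 // gt_eqF // pi_gt0.
by rewrite /pairing !patchE; case: ifP => // _; rewrite mul0r.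
Qed.

Let innerG g h y : L2ball g ->
  (\int[leb3_sf]_x (F g h (x, y))%:E)%E = ((pairing h g \_ B) y)%:E.
Proof.
move=> Lg; rewrite -innerF //; apply: eq_integral => x _; congr EFin.
by rewrite /F /= kernC; ring.
Qed.

Let pairing_integrable g h : L2ball g -> L2ball h ->
  leb3.-integrable B (EFin \o pairing g h).
Proof.
move=> Lg Lh; apply/(integrable_mkcond _ mB).
have := integrable_fubini_F (IF Lg Lh).
apply: eq_integrable => // x _.
by apply: (etrans (innerF g x Lh)); rewrite !patchE; case: ifP.
Qed.

Lemma newton_pairing_integrable h g : L2ball h -> L2ball g ->
  leb3.-integrable B (EFin \o (fun x => newton (eball rad) h x * g x)).
Proof.
move=> Lh Lg; have := integrable_mull mB (4 * pi)^-1 (pairing_integrable Lg Lh).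
apply: eq_integrable => // x _ /=; congr EFin; rewrite /pairing.
have p0 : 4 * pi != 0 :> R by rewrite mulf_neq0 // gt_eqF // pi_gt0.
by rewrite mulrCA mulKf // mulrC.
Qed.

(** Fubini on the absolutely integrable kernel [g(x) h(y) / |x - y|]. *)
Lemma newton_symm h g : L2ball h -> L2ball g ->
  \int[leb3]_(x in B) (newton (eball rad) h x * g x) =
  \int[leb3]_(x in B) (newton (eball rad) g x * h x).
Proof.
move=> Lh Lg; have p0 : 4 * pi != 0 :> R by rewrite mulf_neq0 // gt_eqF // pi_gt0.
apply: (mulfI p0); rewrite -!RintegralZl //; [|exact: newton_pairing_integrable..].
have H : \int[leb3]_(x in B) pairing g h x = \int[leb3]_(x in B) pairing h g x.
  have := Fubini (IF Lg Lh).
  under eq_integral do rewrite innerF //.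
  under [RHS]eq_integral do rewrite innerG //.
  have pE k1 k2 : (\int[leb3]_(x in B) (pairing k1 k2 x)%:E =
      \int[leb3_sf]_x ((pairing k1 k2 \_ B) x)%:E)%E.
    by rewrite integral_mkcond; apply: eq_integral => x _; rewrite !patchE; case: ifP.
  by move=> H; rewrite /Rintegral !pE H.
rewrite (eq_Rintegral _ _ (g := pairing g h)); last by move=> x _; rewrite /pairing; ring.
by rewrite H; apply: eq_Rintegral => x _; rewrite /pairing; ring.
Qed.

Lemma measurable_newton h : L2ball h -> measurable_fun B (newton (eball rad) h : T3 -> R).
Proof.
move=> Lh; have L1 : L2ball (cst 1).
  by apply: (@bounded_L2ball _ 1) => // x _; rewrite normr1.
have /integrableP[/measurable_EFinP + _] := newton_pairing_integrable Lh L1.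
by apply: eq_measurable_fun => x _; rewrite mulr1.
Qed.

Lemma newton_L2ball h : L2ball h -> L2ball (newton (eball rad) h).
Proof.
move=> Lh; have [M nM] := newton_bounded Lh.
by apply: (bounded_L2ball (M := M)) => //; exact: measurable_newton.
Qed.

Lemma bump_L2ball phi : bump rad phi -> L2ball phi.
Proof.
move=> [sphi _]; have cphi := smooth_continuous sphi.
have [M _ pM] := continuous_bounded_eball rad cphi.
by apply: (bounded_L2ball (M := M)) => //; apply: measurable_funTS; exact: continuous_measurable3.
Qed.

Lemma bump_dense : 0 < rad -> hdense L2ball ip_ball (bump rad).
Proof.
move=> rad0.
apply: (dense_of_orthogonal ip_ball_form (fun f _ => ip_ball_ge0 f) ip_ball_complete).
- exact: bump_L2ball.
- exact: bump_subspace.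
- move=> y Ly y0; have y1 : {ae leb3, forall x, B x -> y x = 0}.
    apply: bump_vanish_ae => //; first exact: L2ball_integrable.
    by move=> phi bphi; rewrite -ip_ballE y0.
  rewrite ip_ballE (ae_eq_Rintegral mB (g := cst 0)).
  + by rewrite Rintegral_cst // mul0r.
  + by apply: measurable_funM; exact: L2ball_measurable.
  + exact: measurable_cst.
  + by apply: filterS y1 => x + Bx => /(_ Bx) ->; rewrite mul0r.
Qed.

(** Weak convergence to 0 is improved to convergence of the Newton energies: the
    potentials tend to 0 pointwise because the kernel is square-integrable, and
    they are uniformly bounded. *)
Lemma newton_energy_cvg0 (h_ : nat -> R * R * R -> R) (M : R) : 0 < rad ->
  (forall n, L2ball (h_ n)) -> (forall n, ip_ball (h_ n) (h_ n) <= M) ->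
  (forall phi, bump rad phi -> ip_ball (h_ n) phi @[n --> \oo] --> (0 : R)) ->
  \int[leb3]_(x in B) (newton (eball rad) (h_ n) x * h_ n x) @[n --> \oo] --> (0 : R).
Proof.
move=> rad0 Lh hM hphi.
have CS := form_CS ip_ball_form (fun f _ => ip_ball_ge0 f).
have M0 : 0 <= M by exact: le_trans (ip_ball_ge0 _) (hM 0%N).
(* bounded sequences: testing on a dense set suffices *)
have weak g : L2ball g -> ip_ball (h_ n) g @[n --> \oo] --> (0 : R).
  move=> Lg; apply/cvgrPdist_lt => e e0.
  have d0 : 0 < e / 2 / (Num.sqrt M + 1) by rewrite !divr_gt0 // ltr_wpDl ?sqrtr_ge0.
  have [_ /(_ g Lg _ d0) [phi bphi gphi]] := bump_dense rad0.
  have Lphi := bump_L2ball bphi; have Lgp := subspaceB ip_ball_form Lg Lphi.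
  have e2 : 0 < e / 2 by lra.
  have [N _ HN] := (cvgrPdist_lt _ _).1 (hphi phi bphi) _ e2.
  exists N => // n Nn; rewrite sub0r normrN.
  have -> : ip_ball (h_ n) g = ip_ball (h_ n) (g - phi) + ip_ball (h_ n) phi.
    by rewrite (formBr ip_ball_form) // subrK.
  apply: (le_lt_trans (ler_normD _ _)).
  have h1 : `|ip_ball (h_ n) (g - phi)| <= e / 2.
    rewrite -sqrtr_sqr; apply: (@le_trans _ _ (Num.sqrt M * hnorm ip_ball (g - phi))).
      rewrite /hnorm -sqrtrM //; apply: ler_wsqrtr; apply: le_trans (CS _ _ (Lh n) Lgp) _.
      by rewrite ler_wpM2r ?ip_ball_ge0.
    apply: (@le_trans _ _ ((Num.sqrt M + 1) * hnorm ip_ball (g - phi))).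
      by rewrite ler_wpM2r ?sqrtr_ge0 // lerDl.
    by rewrite mulrC -ler_pdivlMr ?ltW // ltr_wpDl ?sqrtr_ge0.
  have h2 : `|ip_ball (h_ n) phi| < e / 2.
    by have := HN n Nn; rewrite sub0r normrN.
  lra.
have [K K0 kK] := kern_L2ball.
pose U n := newton (eball rad) (h_ n).
have LU n : L2ball (U n) by exact: newton_L2ball.
pose C := (4 * pi)^-1 * Num.sqrt (M * K).
have UC n x : `|U n x| <= C.
  rewrite /U newtonE normrM ger0_norm; last by rewrite invr_ge0 mulr_ge0 ?pi_ge0.
  rewrite ler_wpM2l ?invr_ge0 ?mulr_ge0 ?pi_ge0 // -sqrtr_sqr ler_wsqrtr //.
  have [Lx xK] := kK x.
  by apply: le_trans (CS _ _ (Lh n) Lx) _; rewrite ler_pM ?ip_ball_ge0.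
have U0 x : U n x @[n --> \oo] --> (0 : R).
  rewrite -(mulr0 (4 * pi)^-1); rewrite (_ : (fun n => _) = fun n => (4 * pi)^-1 * ip_ball (h_ n) (kern x)); last first.
    by apply/funext => n; rewrite /U newtonE.
  by apply: cvgMr; apply: weak; case: (kK x).
have UU : ip_ball (U n) (U n) @[n --> \oo] --> (0 : R).
  rewrite (_ : (fun n => _) = fun n => \int[leb3]_(x in B) (U n x * U n x)); last first.
    by apply/funext => n; rewrite ip_ballE.
  rewrite -[0 : R](mul0r (fine (leb3 B))) -Rintegral_cst //.
  apply: (@dominated_Rintegral _ _ _ leb3 B mB _ _ (cst (C ^+ 2))).
  - by move=> n; apply: measurable_funM; exact: measurable_newton.
  - by move=> x Bx; rewrite -[X in _ --> X](mulr0 (0 : R)); apply: cvgM; exact: U0.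
  - exact: (continuous_integrable_eball (f := cst (C ^+ 2)) _ (fun=> cvg_cst _)).
  - by move=> n x Bx; rewrite normrM expr2 ler_pM.
apply/cvgrPdist_lt => e e0.
have d0 : 0 < e ^+ 2 / (M + 1) by rewrite divr_gt0 ?exprn_gt0 // ltr_wpDl.
have [N _ HN] := (cvgrPdist_lt _ _).1 UU _ d0.
exists N => // n Nn; rewrite sub0r normrN.
rewrite (_ : \int[_]_(x in _) _ = ip_ball (U n) (h_ n)); last by rewrite ip_ballE.
rewrite normr_lt_sqr //.
apply: (le_lt_trans (CS _ _ (LU n) (Lh n))).
apply: (@le_lt_trans _ _ (ip_ball (U n) (U n) * (M + 1))).
  by rewrite ler_wpM2l ?ip_ball_ge0 // (le_trans (hM n)) // lerDl.
rewrite -ltr_pdivlMr ?ltr_wpDl //.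
by have := HN n Nn; rewrite sub0r normrN ger0_norm ?ip_ball_ge0.
Qed.

End NewtonKernel.

(** * Regularity and bounds of the equilibrium coefficients *)

Section CkFacts.
Context {R : realType}.

Lemma Ck_onS (E : normedModType R) k (A A' : set E) (g : E -> R) :
  A' `<=` A -> Ck_on k A g -> Ck_on k A' g.
Proof.
move=> AA' [U [h [oO AO Ch gh]]]; exists U, h; split=> //.
  exact: subset_trans AO.
by move=> x; rewrite inE => /AA' Ax; apply: gh; rewrite inE.
Qed.

Lemma Ck_on_extension (E : normedModType R) k (A : set E) (g : E -> R) :
  Ck_on k A g -> exists2 h, (forall x, A x -> g x = h x) &
    forall x, A x -> {for x, continuous h}.
Proof.
move=> [U [h [_ AO Ch gh]]]; exists h => x Ax; first by apply: gh; rewrite inE.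
by have [ch _] := Ch [::] isT; exact: ch (AO x Ax).
Qed.

(** [Ck_on] speaks of an extension [h]; on an open set [g] and [h] coincide near
    each point and hence have the same derivatives. *)
Lemma Ck_on_open (E : normedModType R) k (A : set E) (g : E -> R) :
  open A -> Ck_on k.+1 A g -> forall v x, A x ->
  derivable g x v /\ {for x, continuous ('D_v g)}.
Proof.
move=> oA [U [h [oO AO Ch gh]]] v x Ax.
have nA y : A y -> \forall z \near y, h z = g z.
  move=> Ay; have : nbhs y A by exact: open_nbhs_nbhs.
  by apply: filterS => z Az; rewrite gh // inE.
split.
  have [_ dh] := Ch [::] isT.
  exact: near_eq_derivable (nA x Ax) (dh isT v x (AO x Ax)).
have [+ _] := Ch [:: v] isT; move=> /(_ x (AO x Ax)) /= ch.
have Dgh y : A y -> 'D_v h y = 'D_v g y by move=> Ay; exact/near_eq_derive/nA.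
have cg : 'D_v g @ x --> 'D_v h x.
  apply: cvg_trans ch; apply: near_eq_cvg; have : nbhs x A by exact: open_nbhs_nbhs.
  by apply: filterS => y; exact: Dgh.
by rewrite (Dgh x Ax) in cg.
Qed.

Lemma Ck_on_interior_continuous (E : normedModType R) k (A : set E) (g : E -> R) x :
  open A -> Ck_on k A g -> A x -> {for x, continuous g}.
Proof.
move=> oA Cg Ax; have [h gh ch] := Ck_on_extension Cg.
have cg : g @ x --> h x.
  apply: cvg_trans (ch x Ax); apply: near_eq_cvg.
  have : nbhs x A by exact: open_nbhs_nbhs.
  by apply: filterS => y Ay; rewrite gh.
by rewrite -(gh x Ax) in cg.
Qed.

Lemma within_continuous_ext (A : set R) (g h : R -> R) :
  (forall x, A x -> g x = h x) -> (forall x, A x -> {for x, continuous h}) ->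
  {within A, continuous g}.
Proof.
move=> gh ch; apply: (@subspace_eq_continuous _ _ _ h).
  by move=> x xA; apply/esym/gh; exact: set_mem.
by apply: continuous_in_subspaceT => x xA; apply: ch; exact: set_mem.
Qed.

Lemma itv_continuous_bounds (g : R -> R) (r : R) : 0 <= r ->
  {within `[0, r], continuous g} -> (forall t, 0 <= t <= r -> 0 < g t) ->
  exists c C, [/\ 0 < c, 0 < C & forall t, 0 <= t <= r -> c <= g t <= C].
Proof.
move=> r0 cg g0.
have [m mr mP] := EVT_min r0 cg; have [M Mr MP] := EVT_max r0 cg.
exists (g m), (g M); split; [exact: g0|exact: g0|].
by move=> t tr; rewrite mP // MP.
Qed.

End CkFacts.

Section Equilibrium.
Context {R : realType}.
Variables (P : R * R -> R) (gamma0 rad : R) (rho0 S0 f : R -> R).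
Hypothesis H : hypU P rad rho0 S0 f gamma0.

Let rad0 : 0 < rad. Proof. by case: H. Qed.

Lemma rho0_extension : exists2 h, (forall r, 0 <= r <= rad -> rho0 r = h r) &
  forall r, 0 <= r <= rad -> {for r, continuous h}.
Proof. by have [h] := Ck_on_extension (hypU_rho_C1 H); exists h. Qed.

Lemma S0_extension : exists2 h, (forall r, 0 <= r <= rad -> S0 r = h r) &
  forall r, 0 <= r <= rad -> {for r, continuous h}.
Proof. by have [h] := Ck_on_extension (hypU_S_C1 H); exists h. Qed.

Lemma rho0_continuous : {within `[0, rad], continuous rho0}.
Proof. by have [h e c] := rho0_extension; exact: within_continuous_ext e c. Qed.

Lemma S0_continuous : {within `[0, rad], continuous S0}.
Proof. by have [h e c] := S0_extension; exact: within_continuous_ext e c. Qed.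

Let rho0_C1 : Ck_on 1 `]0, rad[ rho0.
Proof. by apply: Ck_onS (hypU_rho_C1 H); exact: subset_itv_oo_cc. Qed.

Lemma rho0_derivable r : 0 < r < rad -> derivable rho0 r 1.
Proof.
move=> r0; have rI : `]0, rad[%classic r by rewrite /= in_itv.
have oI : open (`]0, rad[%classic : set R) by exact: itv_open.
by have [] := Ck_on_open oI rho0_C1 1 rI.
Qed.

Lemma rho0_decr r s : 0 <= r -> r < s -> s <= rad -> rho0 s < rho0 r.
Proof.
apply: ltr0_derive1_decr; last exact: rho0_continuous.
- by move=> x; rewrite in_itv; exact: rho0_derivable.
- by move=> x; rewrite in_itv => /(hypU_drho_lt0 H).
Qed.

Lemma rho0_gt0 r : 0 <= r < rad -> 0 < rho0 r.
Proof.
by move=> /andP[r0 rr]; rewrite -(hypU_rho_boundary H); exact: rho0_decr.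
Qed.

Lemma rho0_le r : 0 <= r <= rad -> rho0 r <= rho0 0.
Proof.
rewrite le_eqVlt => /andP[/predU1P[<- //|r0] rr]; apply/ltW/rho0_decr => //.
Qed.

Lemma S0_bounded : exists a b, a < b /\ forall r, 0 <= r <= rad -> S0 r \in `[a, b].
Proof.
have [m mr mP] := EVT_min (ltW rad0) S0_continuous.
have [M Mr MP] := EVT_max (ltW rad0) S0_continuous.
exists (S0 m - 1), (S0 M + 1); split.
  by have := mP M Mr; lra.
move=> r rr; rewrite in_itv /=; have := mP r rr; have := MP r rr.
by move=> *; apply/andP; split; lra.
Qed.

Let open_upper : open [set z : R * R | 0 < z.2].
Proof.
apply: (open_comp (f := snd) (D := [set t : R | 0 < t])); last exact: open_gt.
by move=> z _; exact: cvg_snd.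
Qed.

Let P_C3 : Ck_on 3 [set z : R * R | 0 < z.2] P. Proof. exact: hypP_C3 (hypU_P H). Qed.

Lemma P_derivable v z : 0 < z.2 -> derivable P z v.
Proof. by move=> z0; have [] := Ck_on_open open_upper P_C3 v z0. Qed.

Lemma dP_continuous v z : 0 < z.2 -> {for z, continuous ('D_v P)}.
Proof. by move=> z0; have [] := Ck_on_open open_upper P_C3 v z0. Qed.

Lemma dP_profile_continuous v (s1 rho1 : R -> R) r : {for r, continuous s1} ->
  {for r, continuous rho1} -> 0 < rho1 r ->
  {for r, continuous (fun t => 'D_v P (s1 t, rho1 t))}.
Proof.
move=> cs cr r0.
have cpair : {for r, continuous (fun t => (s1 t, rho1 t))}.
  by apply: (@cvg_pair _ _ _ (nbhs r) (nbhs (s1 r)) (nbhs (rho1 r))).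
have cD : {for (s1 r, rho1 r), continuous ('D_v P)} by exact: dP_continuous.
by have := @continuous_comp _ _ _ (fun t => (s1 t, rho1 t)) ('D_v P) r cpair cD.
Qed.

Lemma dP_profile_extension v : exists2 h,
  (forall r, 0 <= r < rad -> 'D_v P (S0 r, rho0 r) / rho0 r = h r) &
  forall r, 0 <= r < rad -> {for r, continuous h}.
Proof.
have [s1 es cs] := S0_extension; have [h1 eh ch] := rho0_extension.
exists (fun r => 'D_v P (s1 r, h1 r) / h1 r) => r /andP[r0 rr].
  by rewrite es ?eh ?r0 ?ltW.
have rl : 0 <= r <= rad by rewrite r0 ltW.
have hr : 0 < h1 r by rewrite -eh // rho0_gt0 ?r0.
apply: cvgM; first by apply: dP_profile_continuous => //; [exact: cs|exact: ch].
by apply: cvgV; [rewrite gt_eqF|exact: ch].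
Qed.

Lemma fraka_continuous : {within `[0, rad[, continuous (fraka P rho0 S0)}.
Proof.
have [h e c] := dP_profile_extension drho.
by apply: (within_continuous_ext (h := h)) => r; rewrite /= in_itv /=; [exact: e|exact: c].
Qed.

Lemma fraka_gt0 r : 0 <= r < rad -> 0 < fraka P rho0 S0 r.
Proof. by move=> rr; rewrite divr_gt0 ?(hypU_Prho H) // rho0_gt0. Qed.

Lemma within_sub (A A' : set R) (g : R -> R) : A' `<=` A ->
  {within A, continuous g} -> {within A', continuous g}.
Proof. exact: continuous_subspaceW. Qed.

Lemma fraka_local_bounds r : 0 <= r < rad ->
  exists c C, [/\ 0 < c, 0 < C & forall t, 0 <= t <= r -> c <= fraka P rho0 S0 t <= C].
Proof.
move=> /andP[r0 rr]; apply: itv_continuous_bounds => //.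
  apply: within_sub fraka_continuous => t; rewrite /= !in_itv /= => /andP[-> tr].
  exact: le_lt_trans tr rr.
by move=> t /andP[t0 tr]; apply: fraka_gt0; rewrite t0 (le_lt_trans tr rr).
Qed.

Lemma rho0_local_bound r : 0 <= r < rad ->
  exists2 c, 0 < c & forall t, 0 <= t <= r -> c <= rho0 t.
Proof.
move=> /andP[r0 rr]; exists (rho0 r); first by rewrite rho0_gt0 ?r0.
move=> t /andP[t0]; rewrite le_eqVlt => /predU1P[-> //|tr].
by apply/ltW/rho0_decr => //; exact: ltW.
Qed.

(** The polytropic asymptotics give [P_rho >= c rho^(gamma0 - 1)] near the
    vacuum, and [gamma0 - 1 <= 1]. *)
Lemma dP_vacuum_lower (a b : R) : a < b -> exists c d, [/\ 0 < c, 0 < d &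
  forall S r, S \in `[a, b] -> 0 < r < d -> c * r <= 'D_drho P (S, r)].
Proof.
move=> ab; have [alpha al0 /(_ a b ab) [K [CK K0 asy]]] := hypP_asympt (hypU_P H).
have /andP[g1 g2] := hypP_gamma0 (hypU_P H).
pose k0 := inf [set K S | S in `[a, b]].
have hK : has_inf [set K S | S in `[a, b]].
  by apply: contrapT => nK; move: K0; rewrite (inf_out nK) ltxx.
have kK S : S \in `[a, b] -> k0 <= K S.
  by move=> Sab; case: hK => _ lb; apply: ge_inf => //; exists S.
have [C [e /= e0 eC]] := asy 0%N 1%N isT.
(* half of the coefficient of [r^(gamma0 - 1)], the remainder taking the other half *)
pose q := k0 * gamma0 / 2.
have q0 : 0 < q by rewrite /q divr_gt0 // mulr_gt0 //; lra.
pose q1 := q / (`|C| + 1).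
have q10 : 0 < q1 by rewrite divr_gt0 // ltr_wpDl.
exists q, (Num.min (Num.min e 1) (q1 `^ alpha^-1)); split=> //.
  by rewrite !lt_min e0 ltr01 powR_gt0.
move=> S r Sab /andP[r0]; rewrite !lt_min => /andP[/andP[re r1] rq].
have := eC r; rewrite /ball /= sub0r normrN gtr0_norm // => /(_ re r0 S Sab).
rewrite /dSrho /=.
have dpow : is_derive (S, r) drho (fun z : R * R => K z.1 * z.2 `^ gamma0)
    (K S * (gamma0 * r `^ (gamma0 - 1))).
  apply: (@is_derive_of_line _ _ _ _ _ (fun t => K S * t `^ gamma0) r).
    by move=> h /=; rewrite /GRing.scale /= mulr0 add0r mulr1.
  exact: (is_deriveZ (K S) (is_derive1_powR gamma0 r0)).
have dP : derivable P (S, r) drho by exact: P_derivable.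
have dK : derivable (fun z : R * R => K z.1 * z.2 `^ gamma0) (S, r) drho by case: dpow.
rewrite (deriveB dP dK).
have -> : 'D_drho (fun z : R * R => K z.1 * z.2 `^ gamma0) (S, r) = K S * (gamma0 * r `^ (gamma0 - 1)).
  by case: dpow.
rewrite (@powRD _ r (gamma0 - 1%:R) alpha); last by rewrite (gt_eqF r0) implybT.
set p := r `^ (gamma0 - 1); set t := r `^ alpha => hC.
have pr : r <= p.
  rewrite -[leLHS](powRr1 (ltW r0)); apply: ger_powR; last by lra.
  by rewrite r0 ltW.
have p0 : 0 < p by exact: powR_gt0.
have t0 : 0 < t by exact: powR_gt0.
have tq : t <= q1.
  apply: (@le_trans _ _ ((q1 `^ alpha^-1) `^ alpha)).
    by apply: ge0_ler_powR; rewrite ?nnegrE ?powR_ge0 ?(ltW al0) ?(ltW r0) ?(ltW rq).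
  by rewrite -powRrM mulVf ?gt_eqF // powRr1 // ltW.
have Ctq : C * t <= q.
  apply: (@le_trans _ _ (`|C| * t)); first by rewrite (ler_wpM2r (ltW t0)) // ler_norm.
  apply: (@le_trans _ _ (`|C| * q1)); first by rewrite ler_wpM2l.
  apply: (@le_trans _ _ ((`|C| + 1) * q1)); first by rewrite (ler_wpM2r (ltW q10)) // lerDl.
  by rewrite /q1 mulrC divfK // gt_eqF // ltr_wpDl.
have Kk := kK S Sab.
have qr : q * r <= q * p by rewrite ler_wpM2l // ltW.
have Cp : C * (p * t) <= q * p by rewrite mulrCA mulrC ler_wpM2r // ltW.
have Kp : k0 * (gamma0 * p) <= K S * (gamma0 * p) by rewrite ler_wpM2r // mulr_ge0 ?(ltW p0) //; lra.
have qE : k0 * (gamma0 * p) = 2 * (q * p) by rewrite /q; field.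
move: hC; rewrite ler_norml => /andP[hC _]; lra.
Qed.

(** Near the boundary [rho0] is small and the vacuum asymptotics apply; on the rest
    of the ball [a] is continuous and positive. *)
Lemma fraka_lower_bound : exists2 c, 0 < c &
  forall r, 0 <= r < rad -> c <= fraka P rho0 S0 r.
Proof.
have [a [b [ab Sab]]] := S0_bounded.
have [c [d [c0 d0 cd]]] := dP_vacuum_lower ab.
have [h1 eh ch] := rho0_extension.
have radI : 0 <= rad <= rad by rewrite lexx ltW.
have hr0 : h1 rad = 0 by rewrite -eh // (hypU_rho_boundary H).
have [e e0 he] : exists2 e, 0 < e & forall r, rad - e < r <= rad -> h1 r < d.
  have := (cvgrPdist_lt _ _).1 (ch rad radI) d d0; rewrite hr0 => -[e /= e0 he].
  exists e => // r /andP[re rr].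
  have := he r; rewrite /ball /= => /(_ _); rewrite sub0r normrN => hh.
  apply: le_lt_trans (ler_norm _) (hh _); rewrite ger0_norm ?subr_ge0 //; lra.
pose r1 := Num.max 0 (rad - e / 2).
have r1I : 0 <= r1 < rad by rewrite le_max lexx gt_max rad0 /=; lra.
have [c1 [C1 [c10 _ hc1]]] := fraka_local_bounds r1I.
exists (Num.min c c1); first by rewrite lt_min c0.
move=> r /andP[r0 rr]; rewrite ge_min; have [rr1|rr1] := leP r r1.
  by have /andP[-> _] := hc1 r (introT andP (conj r0 rr1)); rewrite orbT.
have rhor : 0 < rho0 r by apply: rho0_gt0; rewrite r0.
have rl : 0 <= r <= rad by rewrite r0 ltW.
rewrite /fraka ler_pdivlMr // cd //; first exact: Sab.
rewrite rhor eh // he // ltW // andbT.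
by move: rr1; rewrite gt_max => /andP[_]; lra.
Qed.

Local Notation T3 := (measurableTypeR R * measurableTypeR R * measurableTypeR R)%type.
Let B : set T3 := eball rad.
Let mB : measurable B. Proof. exact: measurable_eball. Qed.

Lemma eball_enorm (x : R * R * R) : B x -> 0 <= enorm x < rad.
Proof. by move=> Bx; rewrite enorm_ge0. Qed.

Lemma measurable_radial (g : R -> R) : measurable_fun `[0, rad[ g ->
  measurable_fun B (radial g : T3 -> R).
Proof.
move=> mg; have me : measurable_fun B (@enorm R : T3 -> R).
  by apply: measurable_funTS; exact: measurable_enorm.
apply: (measurable_comp (F := `[0, rad[%classic) _ _ mg me); first exact: measurable_itv.
by move=> _ [x Bx <-]; rewrite /= in_itv /=; exact: eball_enorm.
Qed.

Lemma measurable_rho0 : measurable_fun B (radial rho0 : T3 -> R).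
Proof.
apply: measurable_radial; apply: subspace_continuous_measurable_fun => //.
by apply: within_sub rho0_continuous; exact: subset_itv_co_cc.
Qed.

Lemma measurable_fraka : measurable_fun B (radial (fraka P rho0 S0) : T3 -> R).
Proof.
by apply: measurable_radial; apply: subspace_continuous_measurable_fun => //; exact: fraka_continuous.
Qed.

Let rho0_interior r : 0 < r < rad -> 0 < rho0 r < rho0 0.
Proof.
by move=> /andP[r0 rr]; rewrite rho0_gt0 ?rho0_decr // ltW.
Qed.

Lemma frakG_continuous r : 0 < r < rad -> {for r, continuous (frakG P rho0 S0 f)}.
Proof.
move=> rI; have /andP[r0 rr] := rI.
have open0 : open (`]0, rad[%classic : set R) by exact: itv_open.
have openf : open (`]0, rho0 0[%classic : set R) by exact: itv_open.
have cr : {for r, continuous rho0}.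
  by apply: (Ck_on_interior_continuous open0 rho0_C1); rewrite /= in_itv.
have cs : {for r, continuous S0}.
  by apply: (Ck_on_interior_continuous open0 (hypU_S_C2 H)); rewrite /= in_itv.
have rhor : 0 < rho0 r by apply: rho0_gt0; rewrite ltW.
have frI : `]0, rho0 0[%classic (rho0 r) by rewrite /= in_itv /=; exact: rho0_interior.
have [_ cdf] := Ck_on_open openf (hypU_f_C2 H) 1 frI.
have cf : {for r, continuous (fun t => derive1 f (rho0 t))}.
  have cdf' : {for rho0 r, continuous (derive1 f)}.
    by rewrite (_ : derive1 f = 'D_1 f) //; apply/funext => t; rewrite derive1E.
  by have := @continuous_comp _ _ _ rho0 (derive1 f) r cr cdf'.
rewrite /frakG; apply: cvgM; last by apply: cvgV; [rewrite gt_eqF|exact: cr].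
apply: cvgM; last exact: cf.
by apply: cvgN; exact: (@dP_profile_continuous dS S0 rho0 r cs cr rhor).
Qed.

Lemma measurable_frakG : measurable_fun B (radial (frakG P rho0 S0 f) : T3 -> R).
Proof.
apply: measurable_radial; apply/measurable_fun_itv_obnd_cbndP.
apply: subspace_continuous_measurable_fun => //.
apply: continuous_in_subspaceT => r; rewrite inE /= in_itv /=.
exact: frakG_continuous.
Qed.

Lemma derive_radial_rho0 (x v : R * R * R) : 0 < enorm x < rad ->
  'D_v (radial rho0) x = derive1 rho0 (enorm x) * ((2 * enorm x)^-1 * 'D_v (fun y => dot y y) x).
Proof.
move=> xI; have /andP[x0 _] := xI.
have dx : 0 < dot x x by rewrite -sqrtr_gt0.
have ds : is_derive (dot x x) (1 : R) Num.sqrt (2 * Num.sqrt (dot x x))^-1.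
  exact: is_derive1_sqrt.
have difs : differentiable (Num.sqrt : R -> R) (dot x x).
  by apply/derivable1_diffP; case: ds.
have difd : differentiable (fun y : R * R * R => dot y y) x.
  by apply: smooth_differentiable; exact: smooth_dot.
have dife : differentiable (@enorm R) x by exact: (differentiable_comp (g := Num.sqrt) difd difs).
have difr : differentiable rho0 (enorm x) by apply/derivable1_diffP; exact: rho0_derivable.
have de : 'D_v (@enorm R) x = derive1 Num.sqrt (dot x x) * 'D_v (fun y => dot y y) x.
  exact: (@derive_comp1 R Num.sqrt (fun y => dot y y) x v difs difd).
apply: (etrans (@derive_comp1 R rho0 (@enorm R) x v difr dife)).
rewrite de derive1E [in RHS]/enorm; congr (_ * (_ * _)).
by rewrite derive1E; case: ds.
Qed.

Let measurable_drho0 : measurable_fun B (radial (derive1 rho0) : T3 -> R).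
Proof.
apply: measurable_radial; apply/measurable_fun_itv_obnd_cbndP.
apply: subspace_continuous_measurable_fun => //.
apply: continuous_in_subspaceT => r; rewrite inE => rI.
have open0 : open (`]0, rad[%classic : set R) by exact: itv_open.
have [_ +] := Ck_on_open open0 rho0_C1 1 rI.
by rewrite (_ : derive1 rho0 = 'D_1 rho0) //; apply/funext => t; rewrite derive1E.
Qed.

(** Only the value at the origin is not given by the chain rule. *)
Lemma measurable_derive_rho0 (v : R * R * R) :
  measurable_fun B ('D_v (radial rho0) : T3 -> R).
Proof.
pose F (x : T3) := radial (derive1 rho0) x * ((2 * enorm x) `^ (-1) * 'D_v (fun y => dot y y) x).
have mF : measurable_fun B F.
  apply: measurable_funM => //; apply: measurable_funM.
    apply: measurable_funTS.
    have me : measurable_fun setT (fun x : T3 => 2 * enorm x).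
      by apply: measurable_funM => //; exact: measurable_enorm.
    by have := measurableT_comp (@measurable_powR R (-1)) me.
  apply: measurable_funTS; apply: (continuous_measurable3 (smooth_continuous (smooth_derive v smooth_dot))).
have mz : measurable_fun B (fun x : T3 => enorm x == 0).
  apply: measurable_fun_eqr; last exact: measurable_cst.
  by apply: measurable_funTS; exact: measurable_enorm.
have := measurable_fun_if mB mz (measurable_cst ('D_v (radial rho0) 0)) (measurable_funS mB (@subIsetl _ _ _) mF).
apply: eq_measurable_fun => x; rewrite inE => Bx /=.
have [x0|x0] := eqVneq (enorm x) 0.
  congr ('D_v _ _); have := norm_x1_le x; have := norm_x2_le x; have := norm_x3_le x.
  rewrite x0 !normr_le0; case: x {Bx x0} => [[a b] c] /= /eqP -> /eqP -> /eqP ->.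
  by [].
rewrite /F powR_inv1 ?mulr_ge0 ?enorm_ge0 // derive_radial_rho0 //.
by rewrite lt_neqAle eq_sym x0 enorm_ge0.
Qed.

End Equilibrium.

(** * The space Y and the weak divergence *)

Section AlmostEverywhere.
Context d (T : measurableType d) {R : realType} (mu : {measure set T -> \bar R}).
Variable D : set T.
Hypothesis mD : measurable D.

Lemma integrable_le_ae (f g : T -> R) : measurable_fun D f ->
  {ae mu, forall x, D x -> `|f x| <= g x} ->
  mu.-integrable D (EFin \o g) -> mu.-integrable D (EFin \o f).
Proof.
move=> mf fg Ig; apply/integrableP; split; first exact/measurable_EFinP.
have /integrableP[mg] := Ig; apply: le_lt_trans.
apply: ae_ge0_le_integral => //.
- exact/measurableT_comp/measurable_EFinP.
- exact/measurableT_comp.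
- apply: filterS fg => x + Dx => /(_ Dx) h; rewrite /= lee_fin.
  exact: le_trans h (ler_norm _).
Qed.

Lemma ae_le_Rintegral (f g : T -> R) : mu.-integrable D (EFin \o f) ->
  mu.-integrable D (EFin \o g) -> {ae mu, forall x, D x -> f x <= g x} ->
  \int[mu]_(x in D) f x <= \int[mu]_(x in D) g x.
Proof.
move=> If Ig fg.
have mf : measurable_fun D f by apply/measurable_EFinP; exact: measurable_int If.
have mg : measurable_fun D g by apply/measurable_EFinP; exact: measurable_int Ig.
have mfg : measurable_fun D (fun x => Num.max (f x) (g x)) by exact: measurable_maxr.
rewrite (@ae_eq_Rintegral _ _ _ mu D mD g (fun x => Num.max (f x) (g x))) //.
  apply: le_Rintegral => //; last by move=> x _; rewrite le_max lexx.
  apply: (integrable_le mD mfg _ (integrable_add mD (integrable_norm If) (integrable_norm Ig))).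
  move=> x _ /=; have [_|_] := leP (f x) (g x); first by rewrite lerDr.
  by rewrite lerDl.
by apply: filterS fg => x + Dx => /(_ Dx) h; rewrite max_r.
Qed.

End AlmostEverywhere.

Section EnergySpace.
Context {R : realType}.
Local Notation T3 := (measurableTypeR R * measurableTypeR R * measurableTypeR R)%type.
Local Notation vfield := (R * R * R -> R * R * R).
Variables (P : R * R -> R) (gamma0 rad : R) (rho0 S0 f : R -> R).
Hypothesis H : hypU P rad rho0 S0 f gamma0.

Let B : set T3 := eball rad.
Let mB : measurable B. Proof. exact: measurable_eball. Qed.
Let rho : R * R * R -> R := radial rho0.
Let mrho : measurable_fun B (rho : T3 -> R). Proof. exact: measurable_rho0 H. Qed.
Let rho_gt0 x : B x -> 0 < rho x.
Proof. by move=> /eball_enorm /(rho0_gt0 H). Qed.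
Let rho_le x : B x -> rho x <= rho0 0.
Proof.
by move=> /eball_enorm /andP[x0 xr]; apply: (rho0_le H); rewrite x0 ltW.
Qed.

Local Notation Y := (Yspace rad rho0).
Local Notation ip := (Yip rad rho0).

Definition c1 (u : vfield) x := (u x).1.1.
Definition c2 (u : vfield) x := (u x).1.2.
Definition c3 (u : vfield) x := (u x).2.
Definition vec (a b c : R * R * R -> R) : vfield := fun x => (a x, b x, c x).

Local Notation L := (wL2 leb3 B rho).
Local Notation w := (wip leb3 B rho).

Lemma measurable_vfield (u : vfield) : measurable_fun B (u : T3 -> T3) <->
  [/\ measurable_fun B (c1 u : T3 -> R), measurable_fun B (c2 u : T3 -> R) &
      measurable_fun B (c3 u : T3 -> R)].
Proof.
split=> [mu|[m1 m2 m3]].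
  split.
  - exact: (measurableT_comp (@measurable_x1 R setT) mu).
  - exact: (measurableT_comp (@measurable_x2 R setT) mu).
  - exact: (measurableT_comp (@measurable_x3 R setT) mu).
apply/(measurable_restrictT _ mB).
have r1 : measurable_fun setT (c1 u \_ B : T3 -> R) by apply/(measurable_restrictT _ mB).
have r2 : measurable_fun setT (c2 u \_ B : T3 -> R) by apply/(measurable_restrictT _ mB).
have r3 : measurable_fun setT (c3 u \_ B : T3 -> R) by apply/(measurable_restrictT _ mB).
have r12 := measurable_fun_pair r1 r2.
have r123 := measurable_fun_pair r12 r3.
rewrite (_ : _ \_ _ = fun x => ((c1 u \_ B) x, (c2 u \_ B) x, (c3 u \_ B) x)); first exact: r123.
apply/funext => x; rewrite !patchE; case: ifP => // _.
by rewrite /c1 /c2 /c3; case: (u x) => [[]].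
Qed.

Lemma YspaceP (u : vfield) : Y u <-> [/\ L (c1 u), L (c2 u) & L (c3 u)].
Proof.
have dotE x : rho x * dot (u x) (u x) =
    rho x * c1 u x ^+ 2 + rho x * c2 u x ^+ 2 + rho x * c3 u x ^+ 2.
  by rewrite /dot /c1 /c2 /c3; ring.
split=> [[/measurable_vfield[m1 m2 m3] fin]|[L1 L2 L3]].
  have sq g : measurable_fun B (g : T3 -> R) -> (forall x, g x ^+ 2 <= dot (u x) (u x)) -> L g.
    move=> mg gu; split=> //; apply: le_lt_trans fin.
    apply: ge0_le_integral => //.
    - by move=> x Bx; rewrite lee_fin mulr_ge0 ?sqr_ge0 // ltW // rho_gt0.
    - by apply/measurable_EFinP; apply: measurable_funM => //; exact: measurable_funX.
    - apply/measurable_EFinP; apply: measurable_funM => //.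
      by do 2?apply: measurable_funD; apply: measurable_funM.
    - by move=> x Bx; rewrite lee_fin ler_wpM2l ?gu // ltW // rho_gt0.
  split; apply: sq => // x; rewrite /c1 /c2 /c3 /dot.
  - by have := sqr_ge0 (u x).1.2; have := sqr_ge0 (u x).2; nra.
  - by have := sqr_ge0 (u x).1.1; have := sqr_ge0 (u x).2; nra.
  - by have := sqr_ge0 (u x).1.1; have := sqr_ge0 (u x).1.2; nra.
split; first by apply/measurable_vfield; split; [case: L1|case: L2|case: L3].
have I1 := wL2_sqr_integrable mrho rho_gt0 L1.
have I2 := wL2_sqr_integrable mrho rho_gt0 L2.
have I3 := wL2_sqr_integrable mrho rho_gt0 L3.
have /integrableP[_] := integrable_add mB (integrable_add mB I1 I2) I3.
apply: le_lt_trans; rewrite le_eqVlt; apply/orP; left; apply/eqP/eq_integral => x.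
rewrite inE => Bx; rewrite /= dotE ger0_norm //.
by rewrite !addr_ge0 // mulr_ge0 ?sqr_ge0 // ltW // rho_gt0.
Qed.

Lemma Yip_components (u v : vfield) : Y u -> Y v ->
  ip u v = w (c1 u) (c1 v) + w (c2 u) (c2 v) + w (c3 u) (c3 v).
Proof.
move=> /YspaceP[u1 u2 u3] /YspaceP[v1 v2 v3].
have I1 := wL2_mul_integrable mB mrho rho_gt0 u1 v1.
have I2 := wL2_mul_integrable mB mrho rho_gt0 u2 v2.
have I3 := wL2_mul_integrable mB mrho rho_gt0 u3 v3.
rewrite /wip -RintegralD // -RintegralD //; last exact: integrable_add.
by apply: eq_Rintegral => x _; rewrite /rho /dot /c1 /c2 /c3; ring.
Qed.

Let wform : symm_bilinear_form L w. Proof. exact: wip_form. Qed.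
Let w0 g : 0 <= w g g. Proof. exact: wip_ge0. Qed.

Lemma Yspace_subspace : lin_subspace Y.
Proof.
split; first by apply/YspaceP; split; exact: (subspace0 wform).
move=> c u v /YspaceP[u1 u2 u3] /YspaceP[v1 v2 v3]; apply/YspaceP.
by split; [exact: (subspaceDZ wform c u1 v1)|exact: (subspaceDZ wform c u2 v2)|exact: (subspaceDZ wform c u3 v3)].
Qed.

Lemma Yip_form : symm_bilinear_form Y ip.
Proof.
split; first exact: Yspace_subspace.
  by move=> u v _ _; apply: eq_Rintegral => x _; rewrite dotC.
move=> c u v z Yu Yv Yz; have Yuv := Yspace_subspace.2 c u v Yu Yv.
rewrite !Yip_components //.
move: Yu Yv Yz => /YspaceP[u1 u2 u3] /YspaceP[v1 v2 v3] /YspaceP[z1 z2 z3].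
have e1 := formDZ wform c u1 v1 z1; have e2 := formDZ wform c u2 v2 z2.
have e3 := formDZ wform c u3 v3 z3.
have -> : c1 (c *: u + v) = c *: c1 u + c1 v by [].
have -> : c2 (c *: u + v) = c *: c2 u + c2 v by [].
have -> : c3 (c *: u + v) = c *: c3 u + c3 v by [].
rewrite e1 e2 e3; ring.
Qed.

Lemma Yip_ge0 u : 0 <= ip u u.
Proof.
apply: Rintegral_ge0 => x Bx; rewrite mulr_ge0 ?dot_ge0 // ltW // rho_gt0 //.
Qed.

Lemma Yip_complete : ip_complete Y ip.
Proof.
move=> u_ Yu uC.
have Yd n m : Y (u_ n - u_ m) by exact: (subspaceB Yip_form).
have Lu n := (YspaceP (u_ n)).1 (Yu n).
have C (c : vfield -> R * R * R -> R) : (forall u v, c (u - v) = c u - c v) ->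
    (forall n, L (c (u_ n))) -> (forall n m, w (c (u_ n - u_ m)) (c (u_ n - u_ m)) <= ip (u_ n - u_ m) (u_ n - u_ m)) ->
    exists2 g, L g & ip_cvg w (fun n => c (u_ n)) g.
  move=> cB Lc cle; have cC : ip_cauchy w (fun n => c (u_ n)).
    move=> e e0; have [N HN] := uC e e0; exists N => n m Nn Nm.
    by rewrite -cB; exact: le_lt_trans (cle n m) (HN n m Nn Nm).
  exact: (wip_complete mB mrho rho_gt0 Lc cC).
have le3 n m := Yip_components (Yd n m) (Yd n m).
have [|||g1 Lg1 cg1] := C c1.
- by [].
- by move=> n; case: (Lu n).
- by move=> n m; rewrite le3 -addrA lerDl addr_ge0.
have [|||g2 Lg2 cg2] := C c2.
- by [].
- by move=> n; case: (Lu n).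
- by move=> n m; rewrite le3 addrAC lerDr addr_ge0.
have [|||g3 Lg3 cg3] := C c3.
- by [].
- by move=> n; case: (Lu n).
- by move=> n m; rewrite le3 lerDr addr_ge0.
pose u := vec g1 g2 g3.
have Yu' : Y u by apply/YspaceP.
exists u => // e e0; have e3 : 0 < e / 3 by lra.
have [N1 H1] := cg1 _ e3; have [N2 H2] := cg2 _ e3; have [N3 H3] := cg3 _ e3.
exists (maxn N1 (maxn N2 N3)) => n; rewrite !geq_max => /and3P[n1 n2 n3].
have Ynu := subspaceB Yip_form (Yu n) Yu'; rewrite Yip_components //.
have := H1 n n1; have := H2 n n2; have := H3 n n3.
have -> : c1 (u_ n - u) = c1 (u_ n) - g1 by [].
have -> : c2 (u_ n - u) = c2 (u_ n) - g2 by [].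
have -> : c3 (u_ n - u) = c3 (u_ n) - g3 by [].
lra.
Qed.

End EnergySpace.

Section WeakDivergence.
Context {R : realType}.
Local Notation T3 := (measurableTypeR R * measurableTypeR R * measurableTypeR R)%type.
Local Notation vfield := (R * R * R -> R * R * R).
Variables (P : R * R -> R) (gamma0 rad : R) (rho0 S0 f : R -> R).
Hypothesis H : hypU P rad rho0 S0 f gamma0.

Let B : set T3 := eball rad.
Let mB : measurable B. Proof. exact: measurable_eball. Qed.
Let rad0 : 0 < rad. Proof. by case: H. Qed.
Let rho : R * R * R -> R := radial rho0.
Let mrho : measurable_fun B (rho : T3 -> R). Proof. exact: measurable_rho0 H. Qed.
Let rho_gt0 x : B x -> 0 < rho x.
Proof. by move=> /eball_enorm /(rho0_gt0 H). Qed.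
Let rho_le x : B x -> rho x <= rho0 0.
Proof.
by move=> /eball_enorm /andP[x0 xr]; apply: (rho0_le H); rewrite x0 ltW.
Qed.
Let a : R * R * R -> R := radial (fraka P rho0 S0).
Let ma : measurable_fun B (a : T3 -> R). Proof. exact: measurable_fraka H. Qed.
Let a_gt0 x : B x -> 0 < a x.
Proof. by move=> /eball_enorm /(fraka_gt0 H). Qed.

Let mone : measurable_fun B (cst 1 : T3 -> R). Proof. exact: measurable_cst. Qed.

Local Notation Y := (Yspace rad rho0).
Local Notation ip := (Yip rad rho0).
Let Yform : symm_bilinear_form Y ip := Yip_form H.
Let Y0 u (_ : Y u) : 0 <= ip u u := Yip_ge0 H u.

Local Notation La := (wL2 leb3 B a).
Local Notation wa := (wip leb3 B a).
Local Notation Lb := (L2ball rad).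
Local Notation wb := (ip_ball rad).

Lemma La_form : symm_bilinear_form La wa.
Proof. exact: wip_form. Qed.

Lemma wa_ge0 h : 0 <= wa h h. Proof. exact: wip_ge0. Qed.

(** As [a] is bounded below up to the vacuum, [L^2_a] embeds in [L^2(B)], where
    the Newton operator acts. *)
Lemma La_L2ball : exists2 c, 0 < c & forall h, La h -> Lb h /\ c * wb h h <= wa h h.
Proof.
have [c c0 ca] := fraka_lower_bound H; exists c => // h Lh.
have ca' x : B x -> c <= a x by move=> /eball_enorm; exact: ca.
have Lbh : Lb h.
  apply: (wL2_dominated (w := cst 1) (K := c^-1) mB mone _ ma a_gt0 _ Lh) => //.
    by case: Lh.
  by move=> x Bx; rewrite mul1r ler_pdivlMl // ler_wpM2r ?sqr_ge0 // ca'.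
split=> //; rewrite ip_ballE -RintegralZl //; last exact: L2ball_mul_integrable.
rewrite /wip; apply: le_Rintegral => //.
- exact: (integrable_mull mB c (L2ball_mul_integrable Lbh Lbh)).
- exact: wL2_mul_integrable.
- by move=> x Bx; rewrite -mulrA ler_wpM2r ?ca' // -expr2 sqr_ge0.
Qed.

Lemma La_sub h : La h -> Lb h.
Proof. by have [c _ cP] := La_L2ball; move=> /cP[]. Qed.

Lemma test_continuous (phi : R * R * R -> R) : test_function B phi -> continuous phi.
Proof. by move=> [Cphi _ _] x; have [+ _] := Cphi 0%N [::] isT; apply. Qed.

Lemma test_derive_continuous (phi : R * R * R -> R) v : test_function B phi ->
  continuous ('D_v phi).
Proof. by move=> [Cphi _ _] x; have [+ _] := Cphi 1%N [:: v] isT; apply. Qed.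

Lemma test_derivable (phi : R * R * R -> R) v x : test_function B phi -> derivable phi x v.
Proof. by move=> [Cphi _ _]; have [_ +] := Cphi 1%N [::] isT; apply. Qed.

Lemma test_L2ball phi : test_function B phi -> Lb phi.
Proof.
move=> tphi; have cphi := test_continuous tphi.
have [M _ pM] := continuous_bounded_eball rad cphi.
by apply: (bounded_L2ball (M := M)) => //; apply: measurable_funTS; exact: continuous_measurable3.
Qed.

Lemma bounded_Lrho (g : R * R * R -> R) M : measurable_fun B (g : T3 -> R) ->
  (forall x, B x -> `|g x| <= M) -> wL2 leb3 B rho g.
Proof.
move=> mg gM; apply: (wL2_dominated (K := rho0 0) mB mrho rho_gt0 mone _ mg
  (bounded_L2ball mg gM)) => // x Bx.
by rewrite mul1r ler_wpM2r ?sqr_ge0 // rho_le.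
Qed.

Lemma grad_Y phi : test_function B phi -> Y (grad phi).
Proof.
move=> tphi; apply/(YspaceP H).
have bd v : wL2 leb3 B rho ('D_v phi).
  have cd : continuous ('D_v phi) by exact: test_derive_continuous.
  have [M _ pM] := continuous_bounded_eball rad cd.
  by apply: (bounded_Lrho (M := M)) => //; apply: measurable_funTS; exact: continuous_measurable3.
by split; exact: bd.
Qed.

Lemma dotZl (r : R) (x y : R * R * R) : dot (r *: x) y = r * dot x y.
Proof.
case: x => [[x1 x2] x3]; rewrite /dot.
have -> : r *: (x1, x2, x3) = (r * x1, r * x2, r * x3) by [].
by rewrite /=; ring.
Qed.

(** The distribution [div (rho u)] is minus the Y-inner product with the gradient
    of the test function, and is therefore continuous in [u]. *)
Lemma Ddistr_Yip u phi : Ddistr rad rho0 u phi = - ip u (grad phi).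
Proof.
by rewrite /Ddistr /div_distr; congr (- _); apply: eq_Rintegral => x _; rewrite dotZl.
Qed.

Local Notation Du := (D_L2a P rad rho0 S0).

Lemma D_L2aP u h : Du u h <-> La h /\
  forall phi, test_function B phi -> - ip u (grad phi) = wb h phi.
Proof.
split=> -[Lh Dh]; split=> // phi /Dh.
  by rewrite Ddistr_Yip ip_ballE.
by rewrite Ddistr_Yip ip_ballE.
Qed.

Lemma bump_test phi : bump rad phi -> test_function B phi.
Proof. by move=> [sphi [r rr phir]]; exact: smooth_test_function phir. Qed.

Lemma ball_vanish_ae h : Lb h -> (forall phi, bump rad phi -> wb h phi = 0) ->
  {ae leb3, forall x, B x -> h x = 0}.
Proof.
move=> Lh h0; apply: bump_vanish_ae => //; first exact: L2ball_integrable.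
by move=> phi bphi; rewrite -ip_ballE h0.
Qed.

Let bform := ip_ball_form rad.

Lemma D_L2a_lin c u u' h h' : Y u -> Y u' -> Du u h -> Du u' h' ->
  Du (c *: u + u') (c *: h + h').
Proof.
move=> Yu Yu' /D_L2aP[Lh Dh] /D_L2aP[Lh' Dh']; apply/D_L2aP.
split; first exact: (subspaceDZ La_form).
move=> phi tphi; have Yphi := grad_Y tphi; have Lphi := test_L2ball tphi.
rewrite (formDZ Yform) // (formDZ bform) //; [|exact: La_sub|exact: La_sub].
by rewrite -Dh // -Dh' //; ring.
Qed.

Lemma D_L2a_unique u h h' : Du u h -> Du u h' -> {ae leb3, forall x, B x -> h x = h' x}.
Proof.
move=> /D_L2aP[Lh Dh] /D_L2aP[Lh' Dh'].
have Lb1 := La_sub Lh; have Lb2 := La_sub Lh'.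
have := @ball_vanish_ae (h - h') (subspaceB bform Lb1 Lb2).
have v0 phi : bump rad phi -> wb (h - h') phi = 0.
  move=> bphi; have tphi := bump_test bphi; have Lphi := test_L2ball tphi.
  by rewrite (formB bform) // -Dh // -Dh' // subrr.
move=> /(_ v0); apply: filterS => x + Bx => /(_ Bx) /eqP.
by rewrite subr_eq0 => /eqP.
Qed.

Local Notation V := (Vspace P rad rho0 S0).
Local Notation DF := (Dfun P rad rho0 S0).

Lemma VspaceY u : V u -> Y u. Proof. by case. Qed.

Lemma Dfun_D u : V u -> Du u (DF u).
Proof. by move=> [_ exh]; exact: getPex. Qed.

Lemma Dfun_La u : V u -> La (DF u).
Proof. by move=> /Dfun_D/D_L2aP[]. Qed.

Lemma Dfun_ae u h : V u -> Du u h -> {ae leb3, forall x, B x -> DF u x = h x}.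
Proof. by move=> Vu; apply: D_L2a_unique; exact: Dfun_D. Qed.

Lemma Vspace_subspace : lin_subspace V.
Proof.
split.
  split; first exact: (subspace0 Yform).
  exists 0; apply/D_L2aP; split; first exact: (subspace0 La_form).
  move=> phi tphi; rewrite (form0 Yform) ?(form0 bform) ?oppr0 //; [exact: test_L2ball|exact: grad_Y].
move=> c u v Vu Vv; split; first exact: (subspaceDZ Yform c (VspaceY Vu) (VspaceY Vv)).
exists (c *: DF u + DF v); apply: D_L2a_lin; [exact: VspaceY|exact: VspaceY|exact: Dfun_D|exact: Dfun_D].
Qed.

(** * Integrability and boundedness of the form *)

Let G : R * R * R -> R := radial (frakG P rho0 S0 f).
Let mG : measurable_fun B (G : T3 -> R). Proof. exact: measurable_frakG H. Qed.
Local Notation af := (afun rho0).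

Let n2 x : R := dot (grad rho x) (grad rho x).

Lemma measurable_afun u : Y u -> measurable_fun B (af u : T3 -> R).
Proof.
move=> [/measurable_vfield[m1 m2 m3] _].
apply: measurable_funD; [apply: measurable_funD|]; apply: measurable_funM => //;
  exact: measurable_derive_rho0 H _.
Qed.

Lemma afun_sqr_le u x : af u x ^+ 2 <= n2 x * dot (u x) (u x).
Proof. exact: dot_CS. Qed.

(** With the Cauchy-Schwarz bound on [a_u^2] this makes the terms in [a_u]
    continuous on Y. *)
Lemma coefficient_ae : exists2 M, 0 <= M & {ae leb3, forall x, B x ->
  `|G x| * n2 x <= M * rho x /\ G x ^+ 2 / a x * n2 x <= M * rho x}.
Proof.
have [_ [M HM0]] := hypU_Linfty H; exists `|M| => //.
have HM : {ae leb3, forall x, B x -> `|(`|G x| + G x ^+ 2 / a x) * n2 x / rho x| <= M} by exact: HM0.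
apply: filterS HM => x + Bx => /(_ Bx) h.
have {}h := le_trans (le_trans (ler_norm _) h) (ler_norm M).
have r0 := rho_gt0 Bx; have a0 := a_gt0 Bx; have n0 : 0 <= n2 x by exact: dot_ge0.
move: h; rewrite ler_pdivrMr // mulrDl => h.
have q1 : 0 <= `|G x| * n2 x by rewrite mulr_ge0.
have q2 : 0 <= G x ^+ 2 / a x * n2 x by rewrite mulr_ge0 // divr_ge0 ?sqr_ge0 // ltW.
by split; apply: le_trans h; rewrite ?lerDl ?lerDr.
Qed.

Lemma Y_integrable u : Y u -> leb3.-integrable B (EFin \o (fun x => rho x * dot (u x) (u x))).
Proof.
move=> Yu; have [/measurable_vfield[m1 m2 m3] fin] := Yu.
apply: integrable_ge0 fin.
  apply: measurable_funM => //.
  by do 2?apply: measurable_funD; apply: measurable_funM.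
by move=> x Bx; rewrite mulr_ge0 ?dot_ge0 // ltW // rho_gt0.
Qed.

(** Young's inequality in the form used for [G h a_u], whose square is a product
    of the two densities to be compared. *)
Lemma young_le (x s t : R) : 0 <= s -> 0 <= t -> x ^+ 2 <= 4 * (s * t) -> `|x| <= s + t.
Proof.
move=> s0 t0 xst; rewrite -(@ler_pXn2r _ 2) ?nnegrE ?addr_ge0 //.
rewrite real_normK ?num_real //; apply: le_trans xst _.
by have := sqr_ge0 (s - t); nra.
Qed.

Lemma mixed_integrable k u : La k -> Y u ->
  leb3.-integrable B (EFin \o (fun x => G x * (k x * af u x))).
Proof.
move=> Lk Yu; have [M M0 aeM] := coefficient_ae.
have Ik := wL2_sqr_integrable ma a_gt0 Lk; have Iu := Y_integrable Yu.
apply: (integrable_le_ae mB _ _ (integrable_add mB Ik (integrable_mull mB M Iu))).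
  by apply: measurable_funM => //; apply: measurable_funM; [case: Lk|exact: measurable_afun].
apply: filterS aeM => x + Bx => /(_ Bx)[_ h].
have r0 := rho_gt0 Bx; have a0 := a_gt0 Bx.
have au := afun_sqr_le u x; have u0 := dot_ge0 (u x).
have g0 : 0 <= G x ^+ 2 / a x by rewrite divr_ge0 ?sqr_ge0 // ltW.
apply: (@le_trans _ _ (a x * k x ^+ 2 + G x ^+ 2 / a x * af u x ^+ 2)).
  have p1 : 0 <= a x * k x ^+ 2 by rewrite mulr_ge0 ?sqr_ge0 // ltW.
  have p2 : 0 <= G x ^+ 2 / a x * af u x ^+ 2 by rewrite mulr_ge0 // sqr_ge0.
  apply: young_le => //.
  have -> : (G x * (k x * af u x)) ^+ 2 = (a x * k x ^+ 2) * (G x ^+ 2 / a x * af u x ^+ 2).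
    by move: (af u x) => t; field; rewrite gt_eqF.
  by rewrite [leRHS]mulr_natl mulrS lerDl mulrn_wge0 // mulr_ge0.
rewrite lerD2l; apply: (@le_trans _ _ (G x ^+ 2 / a x * (n2 x * dot (u x) (u x)))).
  by rewrite ler_wpM2l.
by rewrite !mulrA ler_wpM2r.
Qed.

Lemma quadratic_integrable u v : Y u -> Y v ->
  leb3.-integrable B (EFin \o (fun x => G x * af u x * af v x)).
Proof.
move=> Yu Yv; have [M M0 aeM] := coefficient_ae.
have Iu := Y_integrable Yu; have Iv := Y_integrable Yv.
apply: (integrable_le_ae mB _ _ (integrable_mull mB M (integrable_add mB Iu Iv))).
  by apply: measurable_funM; [apply: measurable_funM => //|]; exact: measurable_afun.
apply: filterS aeM => x + Bx => /(_ Bx)[h _].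
have au := afun_sqr_le u x; have av := afun_sqr_le v x.
have u0 := dot_ge0 (u x); have v0 := dot_ge0 (v x).
rewrite -mulrA normrM -mulrDr.
apply: (@le_trans _ _ (`|G x| * (n2 x * (dot (u x) (u x) + dot (v x) (v x))))).
  apply: ler_wpM2l => //; rewrite [leRHS]mulrDr; apply: le_trans (lerD au av).
  rewrite ler_norml; have := sqr_ge0 (af u x - af v x); have := sqr_ge0 (af u x + af v x).
  have := sqr_ge0 (af u x); have := sqr_ge0 (af v x).
  by move: (af u x) (af v x) => s t; nra.
by rewrite !mulrA ler_wpM2r // addr_ge0.
Qed.

(** The form with the representative of [D_u] as a separate argument, so that it
    can be varied within its class independently of the choice in [Dfun]. *)
Definition pair_form (z z' : (R * R * R -> R) * vfield) : R :=
  wa z.1 z'.1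
  - \int[leb3]_(x in B) (G x * (z.1 x * af z'.2 x + af z.2 x * z'.1 x))
  + \int[leb3]_(x in B) (G x * af z.2 x * af z'.2 x)
  - 4 * pi * \int[leb3]_(x in B) (newton (eball rad) z.1 x * z'.1 x).

Lemma frakqE u v : frakq P rad rho0 S0 f u v = pair_form (DF u, u) (DF v, v).
Proof. by []. Qed.

Lemma mixed2_integrable h k u v : La h -> La k -> Y u -> Y v ->
  leb3.-integrable B (EFin \o (fun x => G x * (h x * af v x + af u x * k x))).
Proof.
move=> Lh Lk Yu Yv.
apply: (eq_integrable_fun mB _ (integrable_add mB (mixed_integrable Lh Yv) (mixed_integrable Lk Yu))).
by move=> x _ /=; ring.
Qed.

Lemma frakq_well_definedP : frakq_well_defined P rad rho0 S0 f.
Proof.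
move=> u v Vu Vv; have Lu := Dfun_La Vu; have Lv := Dfun_La Vv.
have Yu := VspaceY Vu; have Yv := VspaceY Vv.
split.
- exact: (wL2_mul_integrable mB ma a_gt0 Lu Lv).
- exact: (mixed2_integrable Lu Lv Yu Yv).
- exact: (quadratic_integrable Yu Yv).
- by move=> x; exact: (newton_kernel_integrable x (La_sub Lu)).
- exact: (newton_pairing_integrable (La_sub Lu) (La_sub Lv)).
Qed.

Lemma dotDZr (g x y : R * R * R) c : dot g (c *: x + y) = c * dot g x + dot g y.
Proof.
by case: x y => [[x1 x2] x3] [[y1 y2] y3]; rewrite scale_add3 /dot /=; ring.
Qed.

Lemma afunDZ c u v x : af (c *: u + v) x = c * af u x + af v x.
Proof. exact: dotDZr. Qed.

Lemma newtonDZ c h k x : Lb h -> Lb k ->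
  newton (eball rad) (c *: h + k) x = c * newton (eball rad) h x + newton (eball rad) k x.
Proof.
move=> Lh Lk; have [K _ /(_ x)[Lx _]] := kern_L2ball rad.
by rewrite !newtonE (formDZ bform) //; ring.
Qed.

Lemma RintegralDZ c (g h : R * R * R -> R) : leb3.-integrable B (EFin \o g) ->
  leb3.-integrable B (EFin \o h) ->
  \int[leb3]_(x in B) (c * g x + h x) =
  c * \int[leb3]_(x in B) g x + \int[leb3]_(x in B) h x.
Proof.
move=> Ig Ih; rewrite RintegralD ?RintegralZl //; exact: (integrable_mull mB c Ig).
Qed.

Lemma pair_form_bilinear : symm_bilinear_form (La `*` Y) pair_form.
Proof.
have La0 := subspace0 La_form; have Yz := subspace0 Yform.
split.
- split; first by split.
  move=> c [h u] [k v] [/= Lh Yu] [/= Lk Yv].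
  by split; [exact: (subspaceDZ La_form)|exact: (subspaceDZ Yform)].
- move=> [h u] [k v] [/= Lh Yu] [/= Lk Yv]; rewrite /pair_form /=.
  rewrite (formC La_form Lh Lk) (newton_symm (La_sub Lh) (La_sub Lk)).
  congr (_ - _ + _ - _); apply: eq_Rintegral => x _; ring.
- move=> c [h u] [h' u'] [k v] [/= Lh Yu] [/= Lh' Yu'] [/= Lk Yv].
  rewrite /pair_form /= (formDZ La_form) //.
  have -> : \int[leb3]_(x in B) (G x * ((c *: h + h') x * af v x + af (c *: u + u') x * k x)) =
    \int[leb3]_(x in B) (c * (G x * (h x * af v x + af u x * k x)) +
      G x * (h' x * af v x + af u' x * k x)).
    apply: eq_Rintegral => x _; rewrite afunDZ.
    have -> : (c *: h + h') x = c * h x + h' x by [].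
    by move: (af u x) (af u' x) (af v x) => s t r; ring.
  have -> : \int[leb3]_(x in B) (G x * af (c *: u + u') x * af v x) =
    \int[leb3]_(x in B) (c * (G x * af u x * af v x) + G x * af u' x * af v x).
    apply: eq_Rintegral => x _; rewrite afunDZ.
    by move: (af u x) (af u' x) (af v x) => s t r; ring.
  have -> : \int[leb3]_(x in B) (newton (eball rad) (c *: h + h') x * k x) =
    \int[leb3]_(x in B) (c * (newton (eball rad) h x * k x) + newton (eball rad) h' x * k x).
    apply: eq_Rintegral => x _; rewrite (newtonDZ c x (La_sub Lh) (La_sub Lh')).
    by rewrite mulrDl mulrA.
  rewrite (RintegralDZ c (mixed2_integrable Lh Lk Yu Yv) (mixed2_integrable Lh' Lk Yu' Yv)).
  rewrite (RintegralDZ c (quadratic_integrable Yu Yv) (quadratic_integrable Yu' Yv)).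
  rewrite (RintegralDZ c (newton_pairing_integrable (La_sub Lh) (La_sub Lk))
    (newton_pairing_integrable (La_sub Lh') (La_sub Lk))).
  move: (wa _ _) (wa _ _) (\int[_]_(_ in _) _) (\int[_]_(_ in _) _) (\int[_]_(_ in _) _)
    (\int[_]_(_ in _) _) (\int[_]_(_ in _) _) (\int[_]_(_ in _) _) => *; ring.
Qed.


Lemma L2ball_ae_newton h h' x : Lb h -> Lb h' ->
  {ae leb3, forall y, B y -> h y = h' y} ->
  newton (eball rad) h x = newton (eball rad) h' x.
Proof.
move=> Lh Lh' hh'; have [K _ /(_ x)[Lx _]] := kern_L2ball rad.
have mh := L2ball_measurable Lh; have mh' := L2ball_measurable Lh'.
have mx := L2ball_measurable Lx.
rewrite !newtonE; congr (_ * _); rewrite !ip_ballE.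
apply: ae_eq_Rintegral => //; [exact: measurable_funM|exact: measurable_funM|].
by apply: filterS hh' => y + By => /(_ By) ->.
Qed.

Lemma pair_form_ae h h' u z : La h -> La h' -> Y u -> (La `*` Y) z ->
  {ae leb3, forall y, B y -> h y = h' y} ->
  pair_form (h, u) z = pair_form (h', u) z.
Proof.
case: z => k v Lh Lh' Yu [/= Lk Yv] hh'; rewrite /pair_form /=.
have [mh _] := Lh; have [mh' _] := Lh'; have [mk _] := Lk.
have mau := measurable_afun Yu; have mav := measurable_afun Yv.
have e1 : wa h k = wa h' k.
  apply: ae_eq_Rintegral => //; [exact: wL2_measurable_mul|exact: wL2_measurable_mul|].
  by apply: filterS hh' => y + By => /(_ By) ->.
have e2 : \int[leb3]_(x in B) (G x * (h x * af v x + af u x * k x)) =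
          \int[leb3]_(x in B) (G x * (h' x * af v x + af u x * k x)).
  apply: ae_eq_Rintegral => //.
  - by apply: measurable_funM => //; apply: measurable_funD; apply: measurable_funM.
  - by apply: measurable_funM => //; apply: measurable_funD; apply: measurable_funM.
  - by apply: filterS hh' => y + By => /(_ By) ->.
rewrite e1 e2; congr (_ - _ * _); apply: eq_Rintegral => x _.
by rewrite (L2ball_ae_newton x (La_sub Lh) (La_sub Lh') hh').
Qed.

Definition energy h : R :=
  4 * pi * \int[leb3]_(x in B) (newton (eball rad) h x * h x).

(** The mixed terms are absorbed by Young's inequality and the essential bound on
    the coefficients. *)
Lemma pair_form_local_part : exists2 C, 0 <= C & forall h u, La h -> Y u ->
  `|pair_form (h, u) (h, u) + energy h - wa h h| <= 2^-1 * wa h h + C * ip u u.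
Proof.
have [M M0 aeM] := coefficient_ae; exists (3 * M); first by rewrite mulr_ge0.
move=> h u Lh Yu.
have I2 := mixed2_integrable Lh Lh Yu Yu; have I3 := quadratic_integrable Yu Yu.
have Ih := wL2_mul_integrable mB ma a_gt0 Lh Lh; have Iu := Y_integrable Yu.
have -> : pair_form (h, u) (h, u) + energy h - wa h h =
    \int[leb3]_(x in B) (- 1 * (G x * (h x * af u x + af u x * h x)) + G x * af u x * af u x).
  by rewrite (RintegralDZ (-1) I2 I3) /pair_form /energy /=; ring.
have I23 := integrable_add mB (integrable_mull mB (-1) I2) I3.
apply: (le_trans (le_normr_Rintegral mB I23)).
have -> : 2^-1 * wa h h + 3 * M * ip u u =
    \int[leb3]_(x in B) (2^-1 * (a x * h x * h x) + 3 * M * (rho x * dot (u x) (u x))).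
  by rewrite (RintegralDZ 2^-1 Ih (integrable_mull mB (3 * M) Iu)) RintegralZl.
apply: ae_le_Rintegral => //.
- exact: integrable_norm I23.
- exact: (integrable_add mB (integrable_mull mB 2^-1 Ih) (integrable_mull mB (3 * M) Iu)).
apply: filterS aeM => x + Bx => /(_ Bx)[h1 h2].
have r0 := rho_gt0 Bx; have a0 := a_gt0 Bx.
have au := afun_sqr_le u x; have u0 := dot_ge0 (u x).
have au0 := sqr_ge0 (af u x).
have g0 : 0 <= G x ^+ 2 / a x by rewrite divr_ge0 ?sqr_ge0 // ltW.
have k1 : `|G x| * af u x ^+ 2 <= M * (rho x * dot (u x) (u x)).
  apply: (@le_trans _ _ (`|G x| * (n2 x * dot (u x) (u x)))); first by rewrite ler_wpM2l.
  by rewrite !mulrA ler_wpM2r.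
have k2 : G x ^+ 2 / a x * af u x ^+ 2 <= M * (rho x * dot (u x) (u x)).
  apply: (@le_trans _ _ (G x ^+ 2 / a x * (n2 x * dot (u x) (u x)))); first by rewrite ler_wpM2l.
  by rewrite !mulrA ler_wpM2r.
have young : `|2 * (G x * h x * af u x)| <= 2^-1 * (a x * h x ^+ 2) + 2 * (G x ^+ 2 / a x * af u x ^+ 2).
  apply: young_le.
  - by rewrite mulr_ge0 ?invr_ge0 // mulr_ge0 ?sqr_ge0 // ltW.
  - by rewrite mulr_ge0 // mulr_ge0.
  - rewrite le_eqVlt; apply/orP; left; apply/eqP.
    by move: (af u x) => t; field; rewrite gt_eqF.
have q : `|G x * af u x * af u x| = `|G x| * af u x ^+ 2.
  by rewrite -mulrA -expr2 normrM (ger0_norm au0).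
apply: (@le_trans _ _ (`|2 * (G x * h x * af u x)| + `|G x * af u x * af u x|)).
  apply: le_trans (ler_normD _ _) _; rewrite lerD2r mulN1r normrN.
  have -> // : G x * (h x * af u x + af u x * h x) = 2 * (G x * h x * af u x).
  by move: (af u x) => t; ring.
rewrite q -(mulrA (a x)) -expr2 -(mulrA 3).
move: (M * (rho x * _)) k1 k2 young => m.
move: `|2 * _| (`|G x| * _) (G x ^+ 2 / _ * _) (a x * _) => y1 y2 y3 y4; lra.
Qed.

Lemma D_L2aZ c u h : Y u -> Du u h -> Du (c *: u) (c *: h).
Proof.
move=> Yu /D_L2aP[Lh Dh]; apply/D_L2aP; split; first exact: (subspaceZ La_form).
move=> phi tphi; have Yphi := grad_Y tphi; have Lphi := test_L2ball tphi.
by rewrite (formZ Yform) // (formZ bform) //; [rewrite -Dh //; ring|exact: La_sub].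
Qed.

Lemma energyZ c h : Lb h -> energy (c *: h) = c ^+ 2 * energy h.
Proof.
move=> Lh; rewrite /energy mulrCA; congr (_ * _).
have I := newton_pairing_integrable Lh Lh; rewrite -RintegralZl //.
apply: eq_Rintegral => x _; have := newtonDZ c x Lh (subspace0 bform).
rewrite addr0 => ->; rewrite [newton _ 0 x]newtonE (form0 bform); last first.
  by have [K _ /(_ x)[Lx _]] := kern_L2ball rad.
have -> : (c *: h) x = c * h x by [].
ring.
Qed.

(** An Ehrling inequality: were it false, a sequence normalised by [|energy| = 1]
    would have [u_n] tending to 0 in Y, hence weak divergences tending weakly to
    0, and the compactness of the Newton energy would give [energy] tending
    to 0. *)
Lemma energy_small e : 0 < e -> exists2 C, 0 <= C & forall u h, Y u -> Du u h ->
  `|energy h| <= e * wa h h + C * ip u u.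
Proof.
move=> e0; apply: contrapT => nC.
have ex n : exists z, [/\ Y z.2, Du z.2 z.1 &
    e * wa z.1 z.1 + n%:R * ip z.2 z.2 < `|energy z.1|].
  apply: contrapT => nz; apply: nC; exists n%:R => // u h Yu Dh.
  by rewrite leNgt; apply/negP => lt; apply: nz; exists (h, u).
pose z n := projT1 (cid (ex n)).
have zP n : [/\ Y (z n).2, Du (z n).2 (z n).1 &
    e * wa (z n).1 (z n).1 + n%:R * ip (z n).2 (z n).2 < `|energy (z n).1|].
  exact: (projT2 (cid (ex n))).
have Lz n : La (z n).1 by have [_ /D_L2aP[]] := zP n.
have s0 n : 0 < `|energy (z n).1|.
  have [Yz _ lt] := zP n; apply: le_lt_trans lt.
  by rewrite addr_ge0 // mulr_ge0 ?(ltW e0) ?wa_ge0 ?Y0.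
pose c n := (Num.sqrt `|energy (z n).1|)^-1.
have c2 n : c n ^+ 2 = `|energy (z n).1|^-1 by rewrite exprVn sqr_sqrtr // ltW.
pose h n := c n *: (z n).1; pose u n := c n *: (z n).2.
have Yz n : Y (z n).2 by case: (zP n).
have Yu n : Y (u n) by exact: (subspaceZ Yform).
have Dh n : Du (u n) (h n) by apply: D_L2aZ => //; case: (zP n).
have Lh n : La (h n) by have /D_L2aP[] := Dh n.
have E1 n : `|energy (h n)| = 1.
  by rewrite energyZ ?c2; [rewrite normrM normfV normr_id mulVf // gt_eqF|exact: La_sub].
have small n : e * wa (h n) (h n) + n%:R * ip (u n) (u n) < 1.
  rewrite (formZ La_form (c n) (Lz n) (Lh n)) (formZr La_form (c n) (Lz n) (Lz n)).
  rewrite (formZ Yform (c n) (Yz n) (Yu n)) (formZr Yform (c n) (Yz n) (Yz n)).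
  have -> (s t : R) : e * (c n * (c n * s)) + n%:R * (c n * (c n * t)) = c n ^+ 2 * (e * s + n%:R * t) by ring.
  by rewrite c2 -[ltRHS](mulVf (lt0r_neq0 (s0 n))) ltr_pM2l ?invr_gt0 //; case: (zP n).
have [c0 c00 cb] := La_L2ball.
have hM n : wb (h n) (h n) <= (e * c0)^-1.
  have [_ hb] := cb _ (Lh n); rewrite -[leRHS]mul1r ler_pdivlMr ?mulr_gt0 //.
  have pn : 0 <= n%:R * ip (u n) (u n) by rewrite mulr_ge0 // Y0.
  apply: le_trans (ltW (small n)); rewrite mulrCA -[leLHS]addr0.
  apply: lerD => //.
  by rewrite ler_pM2l // mulrC.
have hphi phi : bump rad phi -> wb (h n) phi @[n --> \oo] --> (0 : R).
  move=> bphi; have tphi := bump_test bphi; have Yphi := grad_Y tphi.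
  apply/cvgrPdist_lt => d d0.
  pose K := ip (grad phi) (grad phi) + 1.
  have K0 : 0 < K by rewrite ltr_wpDl // Y0.
  exists (Num.truncn (K / d ^+ 2)).+1 => // n /= Nn.
  have n0 : 0 < n%:R :> R by rewrite ltr0n (leq_trans _ Nn).
  have Kn : K / d ^+ 2 < n%:R.
    by apply: lt_le_trans (truncnS_gt _) _; rewrite ler_nat.
  have /D_L2aP[_ <-] := Dh n; last exact: tphi.
  rewrite sub0r opprK normr_lt_sqr //.
  apply: le_lt_trans (form_CS Yform Y0 (Yu n) Yphi) _.
  have t0 : 0 <= ip (u n) (u n) by exact: Y0.
  have t1 : n%:R * ip (u n) (u n) < 1.
    by apply: le_lt_trans (small n); rewrite lerDr mulr_ge0 ?(ltW e0) // wa_ge0.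
  have KK : ip (grad phi) (grad phi) <= K by rewrite lerDl.
  apply: (@le_lt_trans _ _ (ip (u n) (u n) * K)); first by rewrite ler_wpM2l.
  rewrite ltr_pdivrMr ?exprn_gt0 // in Kn.
  have d2 : 0 < d ^+ 2 by rewrite exprn_gt0.
  move: (ip (u n) (u n)) (d ^+ 2) n%:R t0 t1 Kn d2 n0 => t D N t0 t1 Kn d2 n0.
  apply: (@le_lt_trans _ _ (t * (N * D))); first by rewrite ler_wpM2l // ltW.
  by rewrite mulrA -[ltRHS]mul1r ltr_pM2r // mulrC.
have E0 := newton_energy_cvg0 rad0 (fun n => La_sub (Lh n)) hM hphi.
have : energy (h n) @[n --> \oo] --> 4 * pi * (0 : R) by apply: cvgM E0; exact: cvg_cst.
rewrite mulr0 => /cvgrPdist_lt /(_ 1 ltr01) [N _ HN].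
by have := HN N (leqnn N); rewrite sub0r normrN E1 ltxx.
Qed.

(** * The form is closed and semibounded *)

(** A quarter of the leading term survives when the mixed terms are absorbed by
    one half and the Newton energy by another quarter. *)
Lemma pair_form_bounds : exists2 C, 0 <= C & forall u h, Y u -> Du u h ->
  4^-1 * wa h h <= pair_form (h, u) (h, u) + C * ip u u /\
  `|pair_form (h, u) (h, u)| <= 2 * wa h h + C * ip u u.
Proof.
have [C1 C10 loc] := pair_form_local_part.
have e0 : 0 < 4^-1 :> R by rewrite invr_gt0.
have [C2 C20 en] := energy_small e0.
exists (C1 + C2) => [|u h Yu Dh]; first exact: addr_ge0.
have /D_L2aP[Lh _] := Dh.
have := loc _ _ Lh Yu; have := en _ _ Yu Dh; have := wa_ge0 h.
rewrite mulrDl; move: (wa h h) (energy h) (pair_form _ _) (C1 * _) (C2 * _) => w s p y z.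
by rewrite !ler_norml => w0 /andP[s1 s2] /andP[p1 p2]; split; [lra|apply/andP; split; lra].
Qed.

Local Notation q := (frakq P rad rho0 S0 f).

(** Any representative of [D_u] computes the form. *)
Lemma frakq_pair u v h k : V u -> V v -> Du u h -> Du v k ->
  q u v = pair_form (h, u) (k, v).
Proof.
move=> Vu Vv Dh Dk; have /D_L2aP[Lh _] := Dh; have /D_L2aP[Lk _] := Dk.
have Yu := VspaceY Vu; have Yv := VspaceY Vv.
have Lu := Dfun_La Vu; have Lv := Dfun_La Vv.
rewrite frakqE (pair_form_ae Lu Lh Yu _ (Dfun_ae Vu Dh)) //.
rewrite (formC pair_form_bilinear) // (pair_form_ae Lv Lk Yv _ (Dfun_ae Vv Dk)) //.
by rewrite (formC pair_form_bilinear).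
Qed.

Lemma frakq_form : symm_bilinear_form V q.
Proof.
split; first exact: Vspace_subspace.
  move=> u v Vu Vv; rewrite !frakqE (formC pair_form_bilinear) //.
    by split; [exact: Dfun_La|exact: VspaceY].
  by split; [exact: Dfun_La|exact: VspaceY].
move=> c u v w Vu Vv Vw.
have Z x : V x -> (La `*` Y) (DF x, x) by move=> Vx; split; [exact: Dfun_La|exact: VspaceY].
rewrite (frakq_pair (Vspace_subspace.2 c u v Vu Vv) Vw
  (D_L2a_lin c (VspaceY Vu) (VspaceY Vv) (Dfun_D Vu) (Dfun_D Vv)) (Dfun_D Vw)).
exact: (formDZ pair_form_bilinear c (Z _ Vu) (Z _ Vv) (Z _ Vw)).
Qed.

Lemma frakq_lower_semibounded : lower_semibounded ip V q.
Proof.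
have [C _ bd] := pair_form_bounds; exists (- C) => u Vu.
have [+ _] := bd _ _ (VspaceY Vu) (Dfun_D Vu); rewrite -frakqE mulNr.
by have := wa_ge0 (DF u); move: (wa _ _) (q u u) (C * _) => w s t; lra.
Qed.

Lemma D_L2aB u v h k : Y u -> Y v -> Du u h -> Du v k -> Du (u - v) (h - k).
Proof.
move=> Yu Yv Dh Dk; have := D_L2a_lin (-1) Yv Yu Dk Dh.
by rewrite !scaleN1r addrC [- k + h]addrC.
Qed.

(** The weak divergence is a closed operator from Y to L^2_a. *)
Lemma D_L2a_closed u_ h_ u h : (forall n, Y (u_ n)) -> (forall n, Du (u_ n) (h_ n)) ->
  Y u -> La h -> ip_cvg ip u_ u -> ip_cvg wa h_ h -> Du u h.
Proof.
move=> Yn Dn Yu Lh uu hh; apply/D_L2aP; split=> // phi tphi.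
have Yphi := grad_Y tphi; have Lphi := test_L2ball tphi.
have Ln n : La (h_ n) by have /D_L2aP[] := Dn n.
have [c c0 cb] := La_L2ball.
have bh : ip_cvg wb h_ h.
  move=> e e0; have [N HN] := hh _ (mulr_gt0 c0 e0); exists N => n /HN.
  have [_ +] := cb _ (subspaceB La_form (Ln n) Lh); move=> /le_lt_trans h1 /h1.
  by rewrite ltr_pM2l.
apply/eqP; rewrite -subr_eq0 -normr_le0; apply/ler_addgt0Pr => e e0; rewrite add0r.
have e2 : 0 < e / 2 by rewrite divr_gt0.
have [N1 H1] := ip_cvg_form Yform Y0 Yn Yu Yphi uu e2.
have [N2 H2] := ip_cvg_form bform (fun g _ => ip_ball_ge0 rad g) (fun n => La_sub (Ln n))
  (La_sub Lh) Lphi bh e2.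
have := H1 _ (leq_maxl N1 N2); have := H2 _ (leq_maxr N1 N2).
have /D_L2aP[_ /(_ _ tphi) <-] := Dn (maxn N1 N2).
move: (ip _ _) (ip _ _) (wb _ _) => s t r.
by rewrite !ltr_norml ler_norml => /andP[? ?] /andP[? ?]; apply/andP; split; lra.
Qed.

Lemma frakq_closed : closed_form Y ip V q.
Proof.
have [C C0 bd] := pair_form_bounds.
move=> u_ u Vn Yu uu qc.
have Yn n := VspaceY (Vn n); have Dn n := Dfun_D (Vn n); have Ln n := Dfun_La (Vn n).
have {}uu : ip_cvg ip u_ u by apply/(hnorm_cvg Yform Y0 Yn Yu).
have uc := ip_cvg_cauchy Yform Y0 Yn Yu uu.
pose h_ n := DF (u_ n).
have hc : ip_cauchy wa h_.
  move=> e e0; have e8 : 0 < e / 8 by lra.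
  have d0 : 0 < e / (8 * (C + 1)) by rewrite divr_gt0 // mulr_gt0 // ltr_wpDl.
  have [N1 H1] := qc _ e8; have [N2 H2] := uc _ d0.
  exists (maxn N1 N2) => n m; rewrite !geq_max => /andP[nN1 nN2] /andP[mN1 mN2].
  have Dnm := D_L2aB (Yn n) (Yn m) (Dn n) (Dn m).
  have Vnm : V (u_ n - u_ m) by exact: (subspaceB frakq_form).
  have [+ _] := bd _ _ (VspaceY Vnm) Dnm; rewrite -(frakq_pair Vnm Vnm Dnm Dnm).
  have := H1 _ _ nN1 mN1; have := H2 _ _ nN2 mN2; have := Y0 (VspaceY Vnm).
  rewrite ltr_pdivlMr ?mulr_gt0 ?ltr_wpDl // -/(h_ n) -/(h_ m).
  move: (ip _ _) (q _ _) (wa _ _) => s t r s0 sC; rewrite ltr_norml => /andP[t1 t2] bdr.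
  have : C * s <= e / 8 by nra.
  lra.
have [h Lh hh] := wip_complete mB ma a_gt0 Ln hc.
have Dh : Du u h by exact: (D_L2a_closed Yn Dn Yu Lh uu hh).
have Vu : V u by split=> //; exists h.
split=> //; apply/cvgrPdist_lt => e e0.
have e4 : 0 < e / 4 by lra.
have d0 : 0 < e / (4 * (C + 1)) by rewrite divr_gt0 // mulr_gt0 // ltr_wpDl.
have [N1 H1] := hh _ e4; have [N2 H2] := uu _ d0.
exists (maxn N1 N2) => // n /=; rewrite geq_max => /andP[nN1 nN2].
have Dnu := D_L2aB (Yn n) Yu (Dn n) Dh.
have Vnu : V (u_ n - u) by exact: (subspaceB frakq_form).
rewrite sub0r normrN (frakq_pair Vnu Vnu Dnu Dnu).
have [_] := bd _ _ (VspaceY Vnu) Dnu; move=> /le_lt_trans; apply.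
have := H1 _ nN1; have := H2 _ nN2; have := Y0 (VspaceY Vnu).
rewrite ltr_pdivlMr ?mulr_gt0 ?ltr_wpDl //.
move: (ip _ _) (wa _ _) => s r s0 sC r1.
have : C * s <= e / 4 by nra.
lra.
Qed.

(** * The form domain is dense *)

Lemma bump_continuous phi : bump rad phi -> continuous phi.
Proof. by move=> [sphi _]; exact: smooth_continuous. Qed.

Lemma bump_measurable phi : bump rad phi -> measurable_fun B (phi : T3 -> R).
Proof.
by move=> bphi; apply: measurable_funTS; apply: continuous_measurable3; exact: bump_continuous.
Qed.

(** A bump vanishes near the boundary of the ball, where alone [rho0] is small. *)
Lemma bump_div_rho phi : bump rad phi -> wL2 leb3 B rho (fun x => phi x / rho x).
Proof.
move=> bphi; have [_ [r rr phir]] := bphi.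
have [M _ pM] := continuous_bounded_eball rad (bump_continuous bphi).
have mq : measurable_fun B ((fun x => phi x / rho x) : T3 -> R).
  apply: measurable_funM; first exact: bump_measurable.
  have := measurableT_comp (@measurable_powR R (-1)) mrho.
  by apply: eq_measurable_fun => x; rewrite inE => Bx /=; rewrite powR_inv1 // ltW // rho_gt0.
have [r0|r0] := ltP r 0.
  apply: (bounded_Lrho (M := 0)) => // x _; rewrite normr_le0.
  have [->|/phir] := eqVneq (phi x) 0; first by rewrite mul0r.
  by move=> xr; have := le_lt_trans xr r0; rewrite ltNge enorm_ge0.
have rr0 : 0 <= r < rad by rewrite r0.
have [c c0 cr] := rho0_local_bound H rr0.
apply: (bounded_Lrho (M := M / c)) => // x Bx.
have [->|phix] := eqVneq (phi x) 0.
  by rewrite mul0r normr0 divr_ge0 ?(ltW c0) // (le_trans _ (pM x Bx)).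
have cx : c <= rho x by apply: cr; rewrite enorm_ge0 phir.
rewrite normrM ler_pM ?pM // normfV lef_pV2 ?posrE ?normr_gt0 ?gt_eqF ?rho_gt0 //.
by rewrite (le_trans cx) ?ler_norm.
Qed.

(** The support of a bump stays away from the boundary, where [a] may be
    unbounded. *)
Lemma bump_derive_La phi v : bump rad phi -> La ('D_v phi).
Proof.
move=> [sphi [r rr phir]].
have cd := smooth_continuous (smooth_derive v sphi).
have [M _ dM] := continuous_bounded_eball rad cd.
have md : measurable_fun B ('D_v phi : T3 -> R).
  by apply: measurable_funTS; exact: continuous_measurable3.
have Ld : Lb ('D_v phi) by exact: bounded_L2ball dM.
pose s := Num.max r 0.
have ss : 0 <= s < rad by rewrite le_max lexx orbT gt_max rr rad0.
have [c [C [c0 C0 aC]]] := fraka_local_bounds H ss.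
apply: (wL2_dominated (K := C) mB ma a_gt0 mone _ md Ld) => // x Bx.
rewrite mul1r; have [xs|sx] := leP (enorm x) s.
  rewrite ler_wpM2r ?sqr_ge0 //.
  by have /andP[] : c <= fraka P rho0 S0 (enorm x) <= C by apply: aC; rewrite enorm_ge0.
rewrite (bump_derive_eq0 v phir) ?expr0n ?mulr0 //.
by apply: le_lt_trans sx; rewrite le_max lexx.
Qed.

(** Division by [rho0] turns [D_u] into the classical divergence of the field
    [(phi1, phi2, phi3)]. *)
Definition bump_fields : set vfield := [set u | exists phi1 phi2 phi3,
  [/\ bump rad phi1, bump rad phi2, bump rad phi3 &
      u = vec (fun x => phi1 x / rho x) (fun x => phi2 x / rho x) (fun x => phi3 x / rho x)]].

Lemma mul_dot_div (r a1 a2 a3 : R) (y : R * R * R) : r != 0 ->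
  r * dot (a1 / r, a2 / r, a3 / r) y = a1 * y.1.1 + a2 * y.1.2 + a3 * y.2.
Proof. by move=> r0; rewrite /dot /=; field. Qed.

Lemma bump_fields_V : bump_fields `<=` V.
Proof.
move=> _ [p1 [p2 [p3 [b1 b2 b3 ->]]]].
pose e1 : R * R * R := (1, 0, 0); pose e2 : R * R * R := (0, 1, 0); pose e3 : R * R * R := (0, 0, 1).
set u := vec _ _ _.
have Yu : Y u by apply/(YspaceP H); split; exact: bump_div_rho.
have L1 := bump_derive_La e1 b1; have L2 := bump_derive_La e2 b2; have L3 := bump_derive_La e3 b3.
have L12 := subspaceD La_form L1 L2; have L123 := subspaceD La_form L12 L3.
split=> //; exists ('D_e1 p1 + 'D_e2 p2 + 'D_e3 p3); apply/D_L2aP; split=> // phi tphi.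
have Lphi := test_L2ball tphi.
have part w v : coordinate_vector v -> bump rad w ->
    wb ('D_v w) phi = - \int[leb3]_(x in B) (w x * 'D_v phi x).
  move=> cv bw; rewrite (bump_by_parts cv bw) ?opprK ?ip_ballE //.
  - by move=> x; exact: test_derivable.
  - exact: test_continuous.
  - exact: test_derive_continuous.
have Ip w v : bump rad w -> leb3.-integrable B (EFin \o (fun x => w x * 'D_v phi x)).
  move=> bw; have cw : continuous (fun x => w x * 'D_v phi x).
    by move=> x; apply: cvgM; [exact: bump_continuous|exact: test_derive_continuous].
  exact: continuous_integrable_eball cw.
rewrite (formD bform (La_sub L12) (La_sub L3) Lphi) (formD bform (La_sub L1) (La_sub L2) Lphi).
rewrite (part p1 e1 _ b1) ?(part p2 e2 _ b2) ?(part p3 e3 _ b3); last 3 first.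
- exact: Or33.
- exact: Or32.
- exact: Or31.
have I1 := Ip p1 e1 b1; have I2 := Ip p2 e2 b2; have I3 := Ip p3 e3 b3.
rewrite -!opprD -(RintegralD mB I1 I2) -(RintegralD mB (integrable_add mB I1 I2) I3).
congr (- _); apply: eq_Rintegral => x; rewrite inE => Bx.
exact: (mul_dot_div (p1 x) (p2 x) (p3 x) (grad phi x) (lt0r_neq0 (rho_gt0 Bx))).
Qed.

Lemma bump_fields_subspace : lin_subspace bump_fields.
Proof.
have [bump0 bumpDZ] := bump_subspace rad.
split.
  exists 0, 0, 0; split=> //; apply/funext => x.
  by rewrite /vec; congr (_, _, _); rewrite mul0r.
move=> c _ _ [p1 [p2 [p3 [b1 b2 b3 ->]]]] [q1 [q2 [q3 [d1 d2 d3 ->]]]].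
exists (c *: p1 + q1), (c *: p2 + q2), (c *: p3 + q3).
split; [exact: bumpDZ|exact: bumpDZ|exact: bumpDZ|].
apply/funext => x; rewrite /vec.
have -> : (c *: vec (fun x => p1 x / rho x) (fun x => p2 x / rho x) (fun x => p3 x / rho x) +
   vec (fun x => q1 x / rho x) (fun x => q2 x / rho x) (fun x => q3 x / rho x)) x =
   c *: (p1 x / rho x, p2 x / rho x, p3 x / rho x) + (q1 x / rho x, q2 x / rho x, q3 x / rho x) by [].
rewrite scale_add3.
have E (p' q' : R * R * R -> R) : (c *: p' + q') x / rho x = c * (p' x / rho x) + q' x / rho x.
  by rewrite mulrA -mulrDl.
by rewrite !E.
Qed.

(** A function of weighted L^2 need not be integrable up to the boundary; its
    products with the cutoffs are, and the cutoffs exhaust the ball. *)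
Lemma weighted_vanish_ae g : wL2 leb3 B rho g ->
  (forall phi, bump rad phi -> \int[leb3]_(x in B) (g x * phi x) = 0) ->
  {ae leb3, forall x, B x -> g x = 0}.
Proof.
move=> Lg g0; have mg : measurable_fun B (g : T3 -> R) by case: Lg.
have cut0 n : {ae leb3, forall x, B x -> g x * cutoff rad n x = 0}.
  have bn := cutoff_bump n rad0; have [sn [r rr rn]] := bn.
  have mn := bump_measurable bn.
  apply: (ball_vanish_ae (h := fun x => g x * cutoff rad n x)).
    pose s := Num.max r 0.
    have ss : 0 <= s < rad by rewrite le_max lexx orbT gt_max rr rad0.
    have [c c0 cr] := rho0_local_bound H ss.
    apply: (wL2_dominated (w := cst 1) (K := c^-1) mB mone _ mrho rho_gt0 _ Lg) => //.
      exact: measurable_funM.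
    move=> x Bx; rewrite mul1r ler_pdivlMl //.
    have [->|cx] := eqVneq (cutoff rad n x) 0.
      by rewrite mulr0 expr0n mulr0 mulr_ge0 ?sqr_ge0 // ltW // rho_gt0.
    apply: ler_pM; rewrite ?(ltW c0) ?sqr_ge0 //.
      by apply: cr; rewrite enorm_ge0 le_max rn.
    rewrite exprMn ler_piMr ?sqr_ge0 // -real_normK ?num_real //.
    by rewrite expr_le1 // cutoff_norm.
  move=> phi bphi; rewrite ip_ballE -[RHS](g0 (fun x => cutoff rad n x * phi x)).
    by apply: eq_Rintegral => x _; rewrite mulrA.
  by apply: bump_mul => //; case: bphi.
apply: filterS (ae_foralln cut0) => x + Bx => gx.
apply/eqP; apply: contraT => gx0.
have /cvgrPdist_lt /(_ 1 ltr01) [n _ /(_ n (leqnn n))] := cutoff_cvg rad0 Bx.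
have /eqP := gx n Bx; rewrite mulf_eq0 (negPf gx0) /= => /eqP ->.
by rewrite subr0 normr1 ltxx.
Qed.

Lemma Vspace_dense : hdense Y ip V.
Proof.
suff [_ Wd] : hdense Y ip bump_fields.
  split=> [u|u Yu e e0]; first exact: VspaceY.
  by have [w Ww uw] := Wd u Yu e e0; exists w => //; exact: bump_fields_V.
have WY : bump_fields `<=` Y by move=> u /bump_fields_V/VspaceY.
apply: (dense_of_orthogonal Yform Y0 (Yip_complete H)) => //.
  exact: bump_fields_subspace.
move=> y Yy y0; have [y1 y2 y3] := (YspaceP H y).1 Yy.
have [bump0 _] := bump_subspace rad.
have test g phi : wL2 leb3 B rho g -> bump rad phi ->
    wip leb3 B rho g (fun x => phi x / rho x) = \int[leb3]_(x in B) (g x * phi x).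
  move=> Lg bphi; apply: eq_Rintegral => x; rewrite inE => /rho_gt0 r0.
  by field; rewrite gt_eqF.
have ipE p1 p2 p3 : bump rad p1 -> bump rad p2 -> bump rad p3 ->
    \int[leb3]_(x in B) (c1 y x * p1 x) + \int[leb3]_(x in B) (c2 y x * p2 x) +
    \int[leb3]_(x in B) (c3 y x * p3 x) = 0.
  move=> b1 b2 b3; have Wp : bump_fields (vec (fun x => p1 x / rho x)
    (fun x => p2 x / rho x) (fun x => p3 x / rho x)) by exists p1, p2, p3.
  by have := y0 _ Wp; rewrite (Yip_components H Yy (WY _ Wp)) !test.
have int0 g : \int[leb3]_(x in B) (g x * (0 : R * R * R -> R) x) = 0.
  by rewrite (eq_Rintegral _ _ (g := cst 0)) ?Rintegral_cst ?mul0r // => x _; rewrite mulr0.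
have z1 : {ae leb3, forall x, B x -> c1 y x = 0}.
  by apply: weighted_vanish_ae => // phi bphi; have := ipE _ _ _ bphi bump0 bump0; rewrite !int0 !addr0.
have z2 : {ae leb3, forall x, B x -> c2 y x = 0}.
  by apply: weighted_vanish_ae => // phi bphi; have := ipE _ _ _ bump0 bphi bump0; rewrite !int0 add0r addr0.
have z3 : {ae leb3, forall x, B x -> c3 y x = 0}.
  by apply: weighted_vanish_ae => // phi bphi; have := ipE _ _ _ bump0 bump0 bphi; rewrite !int0 !add0r.
have comp g : wL2 leb3 B rho g -> {ae leb3, forall x, B x -> g x = 0} -> wip leb3 B rho g g = 0.
  move=> [mg _] g0; rewrite /wip (ae_eq_Rintegral mB (g := cst 0)).
  + by rewrite Rintegral_cst // mul0r.
  + exact: wL2_measurable_mul.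
  + exact: measurable_cst.
  + by apply: filterS g0 => x + Bx => /(_ Bx) ->; rewrite mulr0.
by rewrite (Yip_components H Yy Yy) !comp // !addr0.
Qed.
End WeakDivergence.

Theorem lemma8p2 (R : realType) (P : R * R -> R) (gamma0 rad : R)
    (rho0 S0 f : R -> R) :
  hypU P rad rho0 S0 f gamma0 ->
  let Y := Yspace rad rho0 in
  let ip := Yip rad rho0 in
  let V := Vspace P rad rho0 S0 in
  let q := frakq P rad rho0 S0 f in
  [/\ frakq_well_defined P rad rho0 S0 f,
      symm_bilinear_form V q,
      hdense Y ip V,
      closed_form Y ip V q &
      lower_semibounded ip V q] /\
  exists! L : set ((R * R * R -> R * R * R) * (R * R * R -> R * R * R)),
    self_adjoint Y ip L /\ represents_form ip V q L.
Proof.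
move=> H Y ip V q.
have dV := Vspace_dense H; have qform := frakq_form H.
have qc := frakq_closed H; have qb := frakq_lower_semibounded H.
split; first by split=> //; exact: frakq_well_definedP H.
exact: (form_representation (Yip_form H) (fun u _ => Yip_ge0 H u) (Yip_complete H) qform dV qc qb).
Qed.
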